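(* Let $M$ be a highest weight representation of $\mathfrak g$ of highest weight $\Lambda$ with respect to $\Delta^+$. Then, for every weight $\mu$ of $M$, $$\bigl(-(\Lambda+2\rho,\Lambda)+(\mu+2\rho,\mu)\bigr)\,d(\mu)=-2\sum_{\alpha\in\Delta^+}\sum_{k\ge1}(-1)^{(k+1)p(\alpha)}(\mu+k\alpha,\alpha)\,d(\mu+k\alpha).$$
   Context: Lie superalgebra. $\mathfrak g=\mathfrak g_{\bar0}\oplus\mathfrak g_{\bar1}$ is one of the complex Lie superalgebras $\mathfrak{sl}(m|n)$ ($m,n\ge1$, $m\neq n$; for $m=n$ one works with $\mathfrak{gl}(n|n)$ instead of $\mathfrak{sl}(n|n)$), $\mathfrak{osp}(m|2n)$ ($m,n\ge1$), or the exceptional $F(4)$ ($\mathfrak g_{\bar0}=\mathfrak{so}(7)\oplus\mathfrak{sl}(2)$, $\mathfrak g_{\bar1}=$ spin $\otimes\,\mathbb C^2$). The invariant form $(X,Y)$ is $\mathrm{str}(XY)$, $\frac12\mathrm{str}(XY)$, $\frac16\mathrm{str}_{\mathfrak g}(\mathrm{ad}X\,\mathrm{ad}Y)$, respectively; it induces a form $(\cdot,\cdot)$ on $\mathfrak h^*$. With $\Omega_n=\begin{pmatrix}0&I_n\\-I_n&0\end{pmatrix}$, $\mathfrak{osp}(m|2n)$ consists of the block matrices $\begin{pmatrix}A&B\\C&D\end{pmatrix}\in\mathfrak{gl}(m|2n)$ with $A=-A^T$, $D=\Omega_nD^T\Omega_n$, $C=-\Omega_nB^T$. Cartan subalgebra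 $\mathfrak h\subseteq\mathfrak g_{\bar0}$: diagonal matrices for $\mathfrak{sl},\mathfrak{gl}$, with coordinates $\epsilon_i$ (entry $i\leq m$), $\delta_a$ (entry $m+a$); for $\mathfrak{osp}(m|2n)$, $r=\lfloor m/2\rfloor$, the matrices $H=\mathrm{diag}(t_1K,\dots,t_rK,0_{m-2r},i\Omega_n\mathrm{diag}(D,D))$ with $K=\begin{pmatrix}0&i\\-i&0\end{pmatrix}$, $D=\mathrm{diag}(d_1,\dots,d_n)$, $\epsilon_i(H)=t_i$, $\delta_a(H)=d_a$; for $F(4)$ the complexification of a Cartan subalgebra of a maximal compact subalgebra of the even real form below, with $\epsilon_1,\epsilon_2,\epsilon_3$ for $\mathfrak{so}(7)$ and $\delta$ the root of $\mathfrak{sl}(2)$. Roots $\Delta=\Delta_{\bar0}\sqcup\Delta_{\bar1}$; $p(\alpha)\in\{0,1\}$ is the parity of the root $\alpha$. Fixed even positive system $\Delta_{\bar0}^+$: $\{\epsilon_i-\epsilon_j,\delta_a-\delta_b:i<j,a<b\}$ for $\mathfrak{sl},\mathfrak{gl}$; $\{\delta_a\pm\delta_b\ (a<b),2\delta_a,\epsilon_i\pm\epsilon_j\ (i<j)\}$, plus $\{\epsilon_i\}$ if $m$ is odd, for $\mathfrak{osp}$; $\{\delta,\epsilon_i,\epsilon_i\pm\epsilon_j\ (i<j)\}$ for $F(4)$. A positive system $\Delta^+=\Delta_{\bar0}^+\sqcup\Delta_{\bar1}^+$ extends this; $\rho=\rho_{\bar0}-\rho_{\bar1}$, $\rho_{\bar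 z}=\frac12\sum_{\alpha\in\Delta_{\bar z}^+}\alpha$; $\mathfrak n_{\bar1}^\pm=\bigoplus_{\alpha\in\Delta_{\bar1}^+}\mathfrak g^{\pm\alpha}$. Standing assumption of the section: $\Delta^+$ is $\omega$-adapted for a fixed conjugate-linear anti-involution $\omega$ of $\mathfrak g$ (parity preserving, $\omega^2=\mathrm{id}$, $\omega([X,Y])=[\omega(Y),\omega(X)]$), i.e. there are bases $\{\partial_i\}$ of $\mathfrak n_{\bar1}^+$ and $\{x_i\}$ of $\mathfrak n_{\bar1}^-$ and a sign $\varepsilon\in\{\pm1\}$ with $(\partial_i,x_j)=\delta_{ij}$ and $\omega(x_i)=\varepsilon\partial_i$ for all $i,j$. Here $\omega(X)=J^{-1}\overline X^{\,t}J$ with $J=\mathrm{diag}(I_p,-I_q,\pm I_n)$, $p+q=m$, for $\mathfrak{sl},\mathfrak{gl}$; $J=\mathrm{diag}(\pm I_m,i\Omega_n)$ for $\mathfrak{osp}(m|2n)$, or, if $m=2r$, $J=\mathrm{diag}(i\bigoplus_{i=1}^r\Omega_1,\pm I_{2n})$; for $F(4)$, $\omega$ defines a real form with even part $\mathfrak{so}(7)\oplus\mathfrak{sl}(2,\mathbb R)$ or $\mathfrak{so}(2,5)\oplus\mathfrak{su}(2)$ (the even real form is $\{X\in\mathfrak g_{\bar0}:\omega(X)=-X\}$). A highest weight representation of highest weight $\Lambda$ is one generated over $U(\mathfrak g)$ by a nonzero homogeneous vector of weight $\Lambda$ annihilated by all positive root spaces. $d(\nu)=\dim M^\nu$ is the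 dimension of the weight space, with $d(\nu)=0$ if $\nu$ is not a weight of $M$; the sums on the right are finite. *)

(* Defs.v *)
(* The complex numbers are R[i] for R : realType. *)
From mathcomp Require Import all_boot all_order all_algebra.
From mathcomp Require Import complex.
From mathcomp Require Import boolp classical_sets fsbigop reals.

Set Implicit Arguments.
Unset Strict Implicit.
Unset Printing Implicit Defensive.

Import Order.TTheory GRing.Theory Num.Theory.
Local Open Scope ring_scope.

(* Raw data; the index [false] is the even part and [true] the odd part. *)
Record superalgebra (K : fieldType) := SuperAlgebra {
  sa_sort :> vectType K;
  sa_part : bool -> {vspace sa_sort};
  sa_br : sa_sort -> sa_sort -> sa_sort }.

Arguments sa_part {K} _ _.
Arguments sa_br {K} _ _ _.

Definition is_lie_superalgebra (K : fieldType) (g : superalgebra K) : Prop :=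
  let br := sa_br g in
  [/\ [/\ forall (a : K) (x y z : g), br (a *: x + y) z = a *: br x z + br y z
       & forall (a : K) (x y z : g), br z (a *: x + y) = a *: br z x + br z y],
      (sa_part g false + sa_part g true)%VS = fullv /\
      (sa_part g false :&: sa_part g true)%VS = 0%VS,
      forall (p q : bool) (x y : g), x \in sa_part g p -> y \in sa_part g q ->
        br x y \in sa_part g (p (+) q),
      forall (p q : bool) (x y : g), x \in sa_part g p -> y \in sa_part g q ->
        br x y = - ((-1) ^+ (p && q) *: br y x)
    & forall (p q : bool) (x y z : g), x \in sa_part g p -> y \in sa_part g q ->
        br x (br y z) = br (br x y) z + (-1) ^+ (p && q) *: br y (br x z)].

Definition is_simple (K : fieldType) (g : superalgebra K) : Prop :=
  (exists x y : g, sa_br g x y != 0) /\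
  (forall I : {vspace g},
     I = (I :&: sa_part g false + I :&: sa_part g true)%VS ->
     (forall x y : g, y \in I -> sa_br g x y \in I) ->
     I = 0%VS \/ I = fullv).

(* tr(f|even) - tr(f|odd), computed as the trace of (parity operator) o f *)
Definition supertrace_end (K : fieldType) (g : superalgebra K) (f : 'End(g)) : K :=
  let parity : 'End(g) :=
    daddv_pi (sa_part g false) (sa_part g true)
    - daddv_pi (sa_part g true) (sa_part g false) in
  \sum_(i < \dim {:g}) coord (vbasis {:g}) i (parity (f (vbasis {:g})`_i)).

Definition super_killing (K : fieldType) (g : superalgebra K) (x y : g) : K :=
  supertrace_end (linfun (sa_br g x) \o linfun (sa_br g y))%VF.

Section Weights.
Variables (K : fieldType) (g : superalgebra K) (h : {vspace g}).

Definition weight : vectType K := 'Hom(subvs_of h, K^o).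

Definition rootspace (al : weight) : {vspace g} :=
  lker (linfun (fun X : g =>
    linfun (fun H : subvs_of h => sa_br g (vsval H) X - (al H : K) *: X))).

Definition is_root (p : bool) (al : weight) : bool :=
  (al != 0) && ((sa_part g p :&: rootspace al)%VS != 0%VS).

(* the map h -> h^*, H |-> (H, .), whose inverse transports the form to h^* *)
Definition flat (form : g -> g -> K) : 'Hom(subvs_of h, weight) :=
  linfun (fun H : subvs_of h =>
    linfun (fun H' : subvs_of h => (form (vsval H) (vsval H') : K^o)) : weight).

Definition dual_form (form : g -> g -> K) (la mu : weight) : K :=
  form (vsval (((flat form)^-1)%VF la)) (vsval (((flat form)^-1)%VF mu)).

End Weights.

Record basic_data (R : realType) := BasicData {
  bd_alg : superalgebra R[i];
  bd_form : bd_alg -> bd_alg -> R[i];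
  bd_cartan : {vspace bd_alg};
  bd_pos0 : seq (weight bd_cartan);
  (* the conjugate-linear maps that are allowed as omega *)
  bd_omega : (bd_alg -> bd_alg) -> Prop }.

Arguments bd_form {R} _ _ _.
Arguments bd_cartan {R} _.
Arguments bd_pos0 {R} _.
Arguments bd_omega {R} _ _.

Section Matrices.
Variable R : realType.
Local Notation C := R[i].

Definition ctranspose (m n : nat) (X : 'M[C]_(m, n)) : 'M[C]_(n, m) :=
  (map_mx Num.conj X)^T.

Section General.
Variables m n : nat.

Definition mx_part (p : bool) (X : 'M[C]_(m + n)) : 'M[C]_(m + n) :=
  if p then block_mx 0 (ursubmx X) (dlsubmx X) 0
  else block_mx (ulsubmx X) 0 0 (drsubmx X).

Definition supertrace (X : 'M[C]_(m + n)) : C :=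
  \tr (ulsubmx X) - \tr (drsubmx X).

(* XY - (-1)^{|X||Y|} YX on homogeneous X, Y *)
Definition superbracket (X Y : 'M[C]_(m + n)) : 'M[C]_(m + n) :=
  \sum_(p : bool) \sum_(q : bool)
    (mx_part p X *m mx_part q Y
     - (-1) ^+ (p && q) *: (mx_part q Y *m mx_part p X)).

Definition mx_superalgebra (g : {vspace 'M[C]_(m + n)}) : superalgebra C :=
  @SuperAlgebra C (subvs_of g)
    (fun p => lker (linfun (fun X : subvs_of g => mx_part (~~ p) (vsval X))))
    (fun X Y => vsproj g (superbracket (vsval X) (vsval Y))).

Definition mx_cartan (g t : {vspace 'M[C]_(m + n)}) :
    {vspace mx_superalgebra g} :=
  (linfun (vsval : subvs_of g -> _) @^-1: t)%VS.

Definition str_form (c : C) (g : {vspace 'M[C]_(m + n)})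
    (X Y : mx_superalgebra g) : C :=
  c * supertrace (vsval X *m vsval Y).

Definition omega_of (J : 'M[C]_(m + n)) (g : {vspace 'M[C]_(m + n)})
    (omega : mx_superalgebra g -> mx_superalgebra g) : Prop :=
  forall X : mx_superalgebra g,
    vsval (omega X) = invmx J *m ctranspose (vsval X) *m J.

End General.

Arguments str_form {m n} c g X Y.
Arguments omega_of {m n} J g omega.

Definition ltpairs (k : nat) : seq ('I_k * 'I_k) :=
  enum [pred ij : 'I_k * 'I_k | (ij.1 < ij.2)%N].

Section TypeA.
Variables (m n : nat) (g : {vspace 'M[C]_(m + n)}).

Definition A_cartan : {vspace mx_superalgebra g} :=
  mx_cartan g (limg (linfun (@diag_mx C (m + n)))).

Definition A_eps (i : 'I_m) : weight A_cartan :=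
  linfun (fun H : subvs_of A_cartan =>
    (vsval (vsval H) (lshift n i) (lshift n i) : C^o)).

Definition A_delta (a : 'I_n) : weight A_cartan :=
  linfun (fun H : subvs_of A_cartan =>
    (vsval (vsval H) (rshift m a) (rshift m a) : C^o)).

Definition A_pos0 : seq (weight A_cartan) :=
  [seq A_eps ij.1 - A_eps ij.2 | ij <- ltpairs m]
  ++ [seq A_delta ij.1 - A_delta ij.2 | ij <- ltpairs n].

(* J = diag(I_p, -I_(m-p), +-I_n) *)
Definition A_J (p : nat) (s : bool) : 'M[C]_(m + n) :=
  block_mx (diag_mx (\row_(i < m) (if (i < p)%N then 1 else -1))) 0
           0 ((-1) ^+ s)%:M.

Definition A_data : basic_data R :=
  BasicData (str_form 1 g) A_pos0
    (fun omega => exists p s, (p <= m)%N /\ omega_of (A_J p s) g omega).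

End TypeA.

Definition sl_data (m n : nat) : basic_data R :=
  A_data (lker (linfun (fun X : 'M[C]_(m + n) => (supertrace X : C^o)))).

Definition gl_data (m n : nat) : basic_data R :=
  A_data (fullv : {vspace 'M[C]_(m + n)}).

Definition Omega (n : nat) : 'M[C]_(n + n) := block_mx 0 1%:M (- 1%:M) 0.

(* diag(t_0 K, ..., t_(r-1) K, 0_(m-2r)) with r = m/2, K = (0 'i; -'i 0) *)
Definition so_torus (m : nat) (t : 'rV[C]_(m./2)) : 'M[C]_m :=
  \matrix_(i, j) \sum_(k < m./2) t ord0 k *
    ('i *+ ((i == k.*2 :> nat) && (j == k.*2.+1 :> nat))
     - 'i *+ ((i == k.*2.+1 :> nat) && (j == k.*2 :> nat))).

Section Osp.
Variables m n : nat.

(* The three blocks vanish iff A = -A^T, C = -Omega B^T, D = Omega D^T Omega. *)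
Definition osp : {vspace 'M[C]_(m + (n + n))} :=
  lker (linfun (fun X : 'M[C]_(m + (n + n)) =>
    block_mx (ulsubmx X + (ulsubmx X)^T) 0
             (dlsubmx X + Omega n *m (ursubmx X)^T)
             (drsubmx X - Omega n *m (drsubmx X)^T *m Omega n))).

Definition osp_torus (td : 'rV[C]_(m./2) * 'rV[C]_n) : 'M[C]_(m + (n + n)) :=
  block_mx (so_torus td.1) 0
    0 ('i *: (Omega n *m block_mx (diag_mx td.2) 0 0 (diag_mx td.2))).

Definition osp_cartan : {vspace mx_superalgebra osp} :=
  mx_cartan osp (limg (linfun osp_torus)).

(* osp_torus is injective, so this gives (t, d) for H = osp_torus (t, d). *)
Definition osp_coord (H : subvs_of osp_cartan) : 'rV[C]_(m./2) * 'rV[C]_n :=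
  ((linfun osp_torus)^-1)%VF (vsval (vsval H)).

Definition osp_eps (i : 'I_(m./2)) : weight osp_cartan :=
  linfun (fun H => ((osp_coord H).1 ord0 i : C^o)).

Definition osp_delta (a : 'I_n) : weight osp_cartan :=
  linfun (fun H => ((osp_coord H).2 ord0 a : C^o)).

Definition osp_pos0 : seq (weight osp_cartan) :=
  [seq osp_delta ij.1 + osp_delta ij.2 | ij <- ltpairs n]
  ++ [seq osp_delta ij.1 - osp_delta ij.2 | ij <- ltpairs n]
  ++ [seq osp_delta a *+ 2 | a <- enum 'I_n]
  ++ [seq osp_eps ij.1 + osp_eps ij.2 | ij <- ltpairs (m./2)]
  ++ [seq osp_eps ij.1 - osp_eps ij.2 | ij <- ltpairs (m./2)]
  ++ (if odd m then [seq osp_eps i | i <- enum 'I_(m./2)] else [::]).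

Definition osp_J1 (s : bool) : 'M[C]_(m + (n + n)) :=
  block_mx ((-1) ^+ s)%:M 0 0 ('i *: Omega n).

(* Since K = 'i Omega_1, the torus element with all t_k = 1 is
   'i (Omega_1 (+) ... (+) Omega_1); used for m even only. *)
Definition osp_J2 (s : bool) : 'M[C]_(m + (n + n)) :=
  block_mx (so_torus (const_mx 1)) 0 0 ((-1) ^+ s)%:M.

Definition osp_data : basic_data R :=
  BasicData (str_form (2%:R^-1) osp) osp_pos0
    (fun omega => exists s, omega_of (osp_J1 s) osp omega \/
                            ~~ odd m /\ omega_of (osp_J2 s) osp omega).

End Osp.

Definition so7 : {vspace 'M[C]_7} := lker (linfun (fun X : 'M[C]_7 => X + X^T)).
Definition sl2 : {vspace 'M[C]_2} :=
  lker (linfun (fun A : 'M[C]_2 => (\tr A : C^o))).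

Definition commutator (k : nat) (X Y : 'M[C]_k) : 'M[C]_k := X *m Y - Y *m X.

(* 7 gamma matrices of size 8: an irreducible module of the Clifford algebra *)
Definition is_clifford (gam : 'I_7 -> 'M[C]_8) : Prop :=
  forall i j, gam i *m gam j + gam j *m gam i = (2%:R *+ (i == j))%:M.

(* the spin representation of so(7), so that [spin X, gam(v)] = gam(X v) *)
Definition spin (gam : 'I_7 -> 'M[C]_8) (X : 'M[C]_7) : 'M[C]_8 :=
  4%:R^-1 *: \sum_i \sum_j X i j *: (gam i *m gam j).

Section F4.
Variables (gam : 'I_7 -> 'M[C]_8)
  (B : 'M[C]_(8, 2) -> 'M[C]_(8, 2) -> subvs_of so7 * subvs_of sl2).

(* so(7) + sl(2) + (spin (x) C^2), with spin (x) C^2 realized as the 8 x 2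
   matrices. The bracket of two odd elements is B: up to isomorphism there is
   exactly one B for which the result is a simple Lie superalgebra. *)
Definition F4_alg : superalgebra C :=
  @SuperAlgebra C (subvs_of so7 * subvs_of sl2 * 'M[C]_(8, 2))%type
    (fun p => if p then lker (linfun fst) else lker (linfun snd))
    (fun x y =>
       let: (X, A, psi) := x in let: (Y, D, phi) := y in
       ((vsproj so7 (commutator (vsval X) (vsval Y)),
         vsproj sl2 (commutator (vsval A) (vsval D))) + B psi phi,
        (spin gam (vsval X) *m phi + phi *m (vsval A)^T)
        - (spin gam (vsval Y) *m psi + psi *m (vsval D)^T))).

(* H(t, d) = (diag(t_0 K, t_1 K, t_2 K, 0), diag(d/2, -d/2)), so that the
   roots of sl(2) are +-d *)
Definition F4_torus (td : 'rV[C]_3 * C^o) : F4_alg :=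
  (vsproj so7 (@so_torus 7 td.1),
   vsproj sl2 (diag_mx (\row_(i < 2) ((-1) ^+ i * (td.2 / 2%:R)))), 0).

Definition F4_cartan : {vspace F4_alg} := limg (linfun F4_torus).

Definition F4_coord (H : subvs_of F4_cartan) : 'rV[C]_3 * C^o :=
  ((linfun F4_torus)^-1)%VF (vsval H).

Definition F4_eps (i : 'I_3) : weight F4_cartan :=
  linfun (fun H => ((F4_coord H).1 ord0 i : C^o)).

Definition F4_delta : weight F4_cartan := linfun (fun H => (F4_coord H).2).

Definition F4_pos0 : seq (weight F4_cartan) :=
  F4_delta :: [seq F4_eps i | i <- enum 'I_3]
  ++ [seq F4_eps ij.1 + F4_eps ij.2 | ij <- ltpairs 3]
  ++ [seq F4_eps ij.1 - F4_eps ij.2 | ij <- ltpairs 3].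

Local Open Scope classical_set_scope.

(* Isomorphism of real Lie algebras from S onto S'; the values of f outside
   the real subspace S are irrelevant. *)
Definition real_lie_iso (f : 'M[C]_7 * 'M[C]_2 -> F4_alg)
    (S : set ('M[C]_7 * 'M[C]_2)) (S' : set F4_alg) : Prop :=
  [/\ forall (a : R) x y, S x -> S y -> f (a%:C%C *: x + y) = a%:C%C *: f x + f y,
      forall x y, S x -> S y ->
        f (commutator x.1 y.1, commutator x.2 y.2) = sa_br F4_alg (f x) (f y),
      forall x y, S x -> S y -> f x = f y -> x = y
    & f @` S = S'].

Definition real_mx (k l : nat) (X : 'M[C]_(k, l)) : Prop :=
  forall i j, X i j \is Num.real.

Definition I_2_5 : 'M[C]_7 :=
  diag_mx (\row_(i < 7) (if (i < 2)%N then 1 else -1)).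

(* s = false: so(7) + sl(2,R); s = true: so(2,5) + su(2) *)
Definition F4_real_form (s : bool) : set ('M[C]_7 * 'M[C]_2) :=
  [set XA | let: (X, A) := XA in [/\ real_mx X, \tr A = 0
    & if s then X^T *m I_2_5 + I_2_5 *m X = 0 /\ ctranspose A = - A
      else X^T = - X /\ real_mx A]].

(* A Cartan subalgebra of the maximal compact subalgebra so(7) + so(2), resp.
   (so(2) + so(5)) + su(2); all Cartan subalgebras of maximal compact
   subalgebras are conjugate to it. *)
Definition F4_compact_torus (s : bool) : set ('M[C]_7 * 'M[C]_2) :=
  [set XA | [/\ F4_real_form s XA, (exists t, XA.1 = @so_torus 7 t)
    & if s then is_true (is_diag_mx XA.2) else XA.2^T = - XA.2]].

(* The even real form {X | omega(X) = -X} is isomorphic to one of the two real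
   Lie algebras above, the Cartan subalgebra being the complexification of
   the image of the compact torus. *)
Definition F4_omega (omega : F4_alg -> F4_alg) : Prop :=
  exists s f,
    real_lie_iso f (F4_real_form s)
      [set X | X \in sa_part F4_alg false /\ omega X = - X] /\
    f @` F4_compact_torus s = [set X | X \in F4_cartan /\ omega X = - X].

Definition F4_data : basic_data R :=
  BasicData (fun X Y => 6%:R^-1 * super_killing X Y) F4_pos0 F4_omega.

End F4.

End Matrices.

Inductive is_basic (R : realType) : basic_data R -> Prop :=
| Basic_sl (m n : nat) of (0 < m)%N & (0 < n)%N & m != n :
    is_basic (sl_data R m n)
| Basic_gl (n : nat) of (0 < n)%N : is_basic (gl_data R n n)
| Basic_osp (m n : nat) of (0 < m)%N & (0 < n)%N : is_basic (osp_data R m n)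
| Basic_F4 (gam : 'I_7 -> 'M[R[i]]_8)
    (B : 'M[R[i]]_(8, 2) -> 'M[R[i]]_(8, 2) ->
         subvs_of (so7 R) * subvs_of (sl2 R)) of
    is_clifford gam & is_lie_superalgebra (F4_alg gam B)
    & is_simple (F4_alg gam B) :
    is_basic (F4_data gam B).

Section Positive.
Variables (R : realType) (D : basic_data R).
Local Notation C := R[i].
Local Notation g := (bd_alg D).
Local Notation h := (bd_cartan D).

(* [pos1] enumerates the odd positive roots. The positive system is cut out by
   a regular element H of the Cartan subalgebra taking real values on all
   roots; note that 0 < z in R[i] entails that z is real. *)
Definition positive_system (pos1 : seq (weight h)) : Prop :=
  uniq pos1 /\
  exists H : subvs_of h,
    (forall p (al : weight h), is_root p al -> ((0 : C) < al H) || ((al H : C) < 0)) /\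
    (forall p (al : weight h), (al \in if p then pos1 else bd_pos0 D) =
       is_root p al && ((0 : C) < al H)).

Definition anti_involution (omega : g -> g) : Prop :=
  [/\ forall (a : C) (X Y : g), omega (a *: X + Y) = a^* *: omega X + omega Y,
      forall p (X : g), X \in sa_part g p -> omega X \in sa_part g p,
      forall X : g, omega (omega X) = X
    & forall X Y : g, omega (sa_br g X Y) = sa_br g (omega Y) (omega X)].

Definition adapted (omega : g -> g) (pos1 : seq (weight h)) : Prop :=
  exists (k : nat) (d x : k.-tuple g) (s : bool),
    [/\ basis_of (\sum_(al <- pos1) rootspace al)%VS d,
        basis_of (\sum_(al <- pos1) rootspace (- al))%VS x,
        forall i j, bd_form D (tnth d i) (tnth x j) = (i == j)%:R
      & forall i, omega (tnth x i) = (-1) ^+ s *: tnth d i].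

Definition rho (pos1 : seq (weight h)) : weight h :=
  2%:R^-1 *: (\sum_(al <- bd_pos0 D) al)
  - 2%:R^-1 *: (\sum_(al <- pos1) al).

End Positive.

Record representation (K : fieldType) (g : superalgebra K) := Representation {
  rep_sort :> lmodType K;
  rep_part : bool -> set rep_sort;
  rep_act : g -> rep_sort -> rep_sort;
  rep_part0 : forall p, rep_part p 0;
  rep_partP : forall p (a : K) u v,
    rep_part p u -> rep_part p v -> rep_part p (a *: u + v);
  rep_part_sum : forall v, exists v0 v1,
    [/\ rep_part false v0, rep_part true v1 & v = v0 + v1];
  rep_part_direct : forall v, rep_part false v -> rep_part true v -> v = 0;
  rep_act_linl : forall (a : K) x y v,
    rep_act (a *: x + y) v = a *: rep_act x v + rep_act y v;
  rep_act_linr : forall (a : K) x u v,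
    rep_act x (a *: u + v) = a *: rep_act x u + rep_act x v;
  rep_act_part : forall p q x v, x \in sa_part g p -> rep_part q v ->
    rep_part (p (+) q) (rep_act x v);
  rep_act_br : forall p q x y v, x \in sa_part g p -> y \in sa_part g q ->
    rep_act (sa_br g x y) v =
    rep_act x (rep_act y v) - (-1) ^+ (p && q) *: rep_act y (rep_act x v) }.

Arguments rep_part {K g} _ _ _.
Arguments rep_act {K g} _ _ _.

(* [v] generates M over U(g) iff every g-stable subspace containing v is M *)
Definition generates (K : fieldType) (g : superalgebra K)
    (M : representation g) (v : M) : Prop :=
  forall S : set M,
    (forall (a : K) u w, S u -> S w -> S (a *: u + w)) ->
    (forall x u, S u -> S (rep_act M x u)) ->
    S v -> forall u, S u.

Definition weight_space (K : fieldType) (g : superalgebra K) (h : {vspace g})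
    (M : representation g) (nu : weight h) : set M :=
  [set v | forall H : subvs_of h, rep_act M (vsval H) v = (nu H : K) *: v]%classic.

Arguments weight_space {K g h} M nu.

Definition has_dim (K : fieldType) (V : lmodType K) (W : set V) (n : nat) : Prop :=
  exists b : 'I_n -> V,
    (forall v, W v <-> exists c : 'I_n -> K, v = \sum_i c i *: b i) /\
    (forall c : 'I_n -> K, \sum_i c i *: b i = 0 -> forall i, c i = 0).

(* d(nu) = dim M^nu; the default value 0 is for an infinite-dimensional space
   (which does not occur in highest weight representations) *)
Definition wdim (K : fieldType) (g : superalgebra K) (h : {vspace g})
    (M : representation g) (nu : weight h) : nat :=
  xget 0%N [set n | has_dim (weight_space M nu) n]%classic.

Arguments wdim {K g h} M nu.

Definition highest_weight_rep (R : realType) (D : basic_data R)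
    (pos1 : seq (weight (bd_cartan D))) (M : representation (bd_alg D))
    (Lam : weight (bd_cartan D)) : Prop :=
  exists v : M,
    [/\ v <> 0, (exists p, rep_part M p v), weight_space M Lam v,
        forall al X, al \in bd_pos0 D ++ pos1 -> X \in rootspace al ->
          rep_act M X v = 0
      & generates v].

(* Main.v *)
(* The Casimir operator, the sum of y_i x_i over dual bases (x_i), (y_i) of g,
   commutes with g, so it acts on M by its eigenvalue (Lam + 2 rho, Lam) on the
   highest weight vector. On M^nu it equals (nu + 2 rho, nu) plus twice the sum
   of f_al e_al over the positive roots, where (e_al, f_al) = 1. Taking traces
   on M^mu leaves tr(f_al e_al) to be computed: since
   e_al f_al = (-1)^p(al) f_al e_al + (nu, al) on M^nu, and since f_al e_al on
   M^nu and e_al f_al on M^(nu + al) have the same trace, these traces satisfy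
   a recursion along nu, nu + al, nu + 2 al, ..., which ends at 0.
   The argument only needs root spaces of dimension at most one and an invariant
   form that is nondegenerate; for each algebra both are read off an explicit
   spanning family of weight vectors, except that for F(4) the nondegeneracy
   follows from simplicity, because the Killing form does not vanish. *)

From HB Require Import structures.
Require Import Defs.
From mathcomp Require Import all_boot all_order all_algebra.
From mathcomp Require Import complex.
From mathcomp Require Import boolp classical_sets fsbigop reals.
From mathcomp Require Import ring zify.

Set Implicit Arguments.
Unset Strict Implicit.
Unset Printing Implicit Defensive.

Import Order.TTheory GRing.Theory Num.Theory.
Local Open Scope ring_scope.

(** The sign in the formula arises because the trace used is the ordinary one, which is cyclic
    without signs even for odd maps. If t_k denotes the trace of f_al e_al on M^(mu + k al), then
    t_k = (-1)^p(al) t_(k+1) + (mu + (k+1) al, al) d(mu + (k+1) al); unrolling t_0 attaches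
    (-1)^((k-1) p(al)) to the k-th term, which equals (-1)^((k+1) p(al)). As M may be
    infinite-dimensional, every trace is taken on a single weight space. Both the finite dimension
    of these spaces and the end of the recursion come from a real-valued additive height that is
    positive on the positive roots: words in the f_al applied to the highest weight vector span M,
    and each letter lowers the height by at least a fixed amount. For osp(m|2n) the weight vectors
    come from two facts: the orthogonal and the symplectic torus both rotate coordinate planes, and
    the algebra is an image of the tensor square of the natural module. For F(4) the bracket of two
    odd elements is known only through the axioms, so invariance of the form is obtained on general
    grounds from the Killing form. *)

Section LinearFunctions.
Variables (K : fieldType) (U V : vectType K).

(** The maps in the definitions are bare functions wrapped in [linfun], which agrees with a function
    only when that function is linear. Linearity is taken as a plain hypothesis and packed into a
    structure on the spot. *)
Lemma linfun_linearE (f : U -> V) : linear f -> linfun f =1 f.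
Proof.
move=> lf; pose F := GRing.isLinear.Build K U V *:%R f lf.
pose G : {linear U -> V} := HB.pack f F.
exact: (lfunE G).
Qed.

Lemma linear_prop_sum (I : Type) (r : seq I) (P : pred I) (f : U -> V) (F : I -> U) :
  linear f -> f (\sum_(i <- r | P i) F i) = \sum_(i <- r | P i) f (F i).
Proof.
move=> lf; pose G : {linear U -> V} := HB.pack f (GRing.isLinear.Build K U V *:%R f lf).
exact: (linear_sum G).
Qed.

Lemma linear_propZ (f : U -> V) a x : linear f -> f (a *: x) = a *: f x.
Proof.
move=> lf; pose G : {linear U -> V} := HB.pack f (GRing.isLinear.Build K U V *:%R f lf).
exact: (linearZ_LR G).
Qed.

Lemma linear_prop0 (f : U -> V) : linear f -> f 0 = 0.
Proof. by move=> lf; have := linear_propZ 0 0 lf; rewrite !scale0r. Qed.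

End LinearFunctions.

(** * Independence of weight vectors in a possibly infinite-dimensional module *)

Section WeightIndependence.
Variables (K : fieldType) (T : vectType K) (V : lmodType K) (act : T -> V -> V).
Hypothesis act_lin : forall H, linear (act H).
Local Notation wt := ('Hom(T, K^o)).

Definition eigen (nu : wt) (v : V) := forall H, act H v = (nu H : K) *: v.

Lemma act_sum H (I : Type) (r : seq I) (P : pred I) (F : I -> V) :
  act H (\sum_(i <- r | P i) F i) = \sum_(i <- r | P i) act H (F i).
Proof.
pose G : {linear V -> V} := HB.pack (act H) (GRing.isLinear.Build K V V *:%R _ (act_lin H)).
exact: (linear_sum G).
Qed.

Lemma actZ H a v : act H (a *: v) = a *: act H v.
Proof.
pose G : {linear V -> V} := HB.pack (act H) (GRing.isLinear.Build K V V *:%R _ (act_lin H)).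
exact: (linearZ_LR G).
Qed.

Lemma act0 H : act H 0 = 0.
Proof. by have := actZ H 0 0; rewrite !scale0r. Qed.

Lemma eigen0 nu : eigen nu 0.
Proof. by move=> H; rewrite act0 scaler0. Qed.

Lemma eigenP nu a u v : eigen nu u -> eigen nu v -> eigen nu (a *: u + v).
Proof.
by move=> hu hv H; rewrite act_lin hu hv scalerDr !scalerA mulrC.
Qed.

Lemma eigenZ nu a u : eigen nu u -> eigen nu (a *: u).
Proof. by move=> hu; rewrite -[_ *: _]addr0; apply: eigenP => //; apply: eigen0. Qed.

Lemma eigen_sum nu (I : eqType) (r : seq I) (P : pred I) (F : I -> V) :
  (forall i, i \in r -> P i -> eigen nu (F i)) -> eigen nu (\sum_(i <- r | P i) F i).
Proof.
move=> hF; rewrite big_seq_cond; apply: big_ind.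
- exact: eigen0.
- by move=> x y hx hy; rewrite -[x]scale1r; apply: eigenP.
- by move=> i /andP[]; apply: hF.
Qed.

(** Induction on the list: [act H - la0 H] annihilates the [la0] term and multiplies the term at
    [la] by [la H - la0 H]. The element [H] is chosen anew for each [la], because over an arbitrary
    field no single [H] need separate all the weights. *)
Lemma eigen_indep (s : seq wt) (y : wt -> V) :
  uniq s -> (forall la, la \in s -> eigen la (y la)) ->
  \sum_(la <- s) y la = 0 -> forall la, la \in s -> y la = 0.
Proof.
elim: s y => [|la0 s IH] y //= /andP[la0s us] hy; rewrite big_cons => sum0.
have hs la : la \in s -> y la = 0.
  move=> las; have ne : la != la0 by apply: contraNneq la0s => <-.
  have /existsNP [H hH] : ~ forall H, la H = la0 H.
    by move=> E; move/eqP: ne; apply; apply/lfunP.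
  have := IH (fun la => ((la H : K) - la0 H) *: y la) us.
  have -> : \sum_(j <- s) ((j H : K) - la0 H) *: y j = 0.
    have: act H (1 *: y la0 + \sum_(j <- s) y j)
        - (la0 H : K) *: (1 *: y la0 + \sum_(j <- s) y j) = 0.
      by rewrite scale1r sum0 act0 scaler0 subr0.
    rewrite act_lin !scale1r hy ?mem_head // act_sum scalerDr.
    rewrite opprD addrACA subrr add0r scaler_sumr -sumrB => E; rewrite -[RHS]E.
    apply: eq_big_seq => j js; by rewrite hy ?scalerBl // in_cons js orbT.
  move=> /(_ _ erefl la las) => E.
  have {}E : ((la H : K) - la0 H) *: y la = 0.
    by apply: E => j js; apply: eigenZ; apply: hy; rewrite in_cons js orbT.
  by move/eqP: E; rewrite scaler_eq0 subr_eq0 => /orP[/eqP//|/eqP].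
move=> la; rewrite in_cons => /orP[/eqP->|]; last exact: hs.
by move: sum0; rewrite big_seq big1 ?addr0 // => j; apply: hs.
Qed.

(** Group the summands by weight and subtract [v] from the group of weight [nu]: the groups then sum
    to zero, so each of them vanishes. The [F i] need not have distinct weights. *)
Lemma eigen_component (I : eqType) (r : seq I) (F : I -> V) (mu : I -> wt) nu v :
  (forall i, i \in r -> eigen (mu i) (F i)) -> eigen nu v ->
  v = \sum_(i <- r) F i -> v = \sum_(i <- r | mu i == nu) F i.
Proof.
move=> hF hv Ev; pose s := undup (nu :: map mu r).
pose y la := \sum_(i <- r | mu i == la) F i - (if la == nu then v else 0).
have := @eigen_indep s y (undup_uniq _).
have nus : nu \in s by rewrite mem_undup mem_head.
have -> : \sum_(la <- s) y la = 0.
  rewrite /y sumrB.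
  have -> : \sum_(la <- s) (if la == nu then v else 0) = v.
    by rewrite (bigD1_seq nu) ?undup_uniq //= eqxx big1 ?addr0 // => i /negPf ->.
  rewrite (exchange_big_dep xpredT) //= [X in _ - X]Ev; apply/eqP; rewrite subr_eq0; apply/eqP.
  apply: eq_big_seq => i ir.
  have E : (fun la => mu i == la) =1 pred1 (mu i) by move=> la; rewrite eq_sym.
  rewrite (eq_bigl _ _ E) -big_filter filter_pred1_uniq ?undup_uniq ?big_seq1 //.
  by rewrite mem_undup in_cons map_f ?orbT.
move=> H; have := H _ erefl nu nus.
rewrite /y eqxx => E; apply/eqP; rewrite eq_sym -subr_eq0; apply/eqP; apply: E.
move=> la _; rewrite -[X in eigen _ X]addrC -scaleN1r; apply: eigenP.
  by case: eqP => [->|_] //; apply: eigen0.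
by apply: eigen_sum => i ir /eqP <-; apply: hF.
Qed.

End WeightIndependence.

(** * Root spaces *)

(* The family in bs_weight_vectors may contain zero vectors and repetitions. *)
Record basic_structure (K : fieldType) (g : superalgebra K) (form : g -> g -> K)
    (h : {vspace g}) : Prop := BasicStructure {
  bs_br_linl : forall z, linear (fun x => sa_br g x z);
  bs_br_linr : forall x, linear (sa_br g x);
  bs_graded : (sa_part g false + sa_part g true)%VS = fullv;
  bs_direct : (sa_part g false :&: sa_part g true)%VS = 0%VS;
  bs_br_part : forall p q x y, x \in sa_part g p -> y \in sa_part g q ->
    sa_br g x y \in sa_part g (p (+) q);
  bs_br_skew : forall p q x y, x \in sa_part g p -> y \in sa_part g q ->
    sa_br g x y = - ((-1) ^+ (p && q) *: sa_br g y x);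
  bs_form_linl : forall z (a : K) x y, form (a *: x + y) z = a * form x z + form y z;
  bs_form_linr : forall x, linear (form x : g -> K^o);
  bs_formC : forall p q x y, x \in sa_part g p -> y \in sa_part g q ->
    form x y = (-1) ^+ (p && q) * form y x;
  bs_form_even : forall p x y, x \in sa_part g p -> y \in sa_part g (~~ p) ->
    form x y = 0;
  bs_form_inv : forall p q r x y z,
    x \in sa_part g p -> y \in sa_part g q -> z \in sa_part g r ->
    form (sa_br g x y) z = form x (sa_br g y z);
  bs_form_nondeg : forall x, (forall y, form x y = 0) -> x = 0;
  bs_cartan_even : (h <= sa_part g false)%VS;
  bs_cartan_abelian : forall x y, x \in h -> y \in h -> sa_br g x y = 0;
  bs_cartan_der : forall x y z, x \in h ->
    sa_br g x (sa_br g y z) = sa_br g (sa_br g x y) z + sa_br g y (sa_br g x z);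
  bs_weight_vectors : exists (I : finType) (w : I -> g) (wt : I -> weight h) (par : I -> bool),
    [/\ forall i, w i \in sa_part g (par i),
        forall i, w i \in rootspace (wt i),
        forall i, wt i = 0 -> w i \in h,
        forall i j, wt i = wt j -> wt i <> 0 -> w j <> 0 -> w i \in <[w j]>%VS
      & forall S : {vspace g}, (h <= S)%VS -> (forall i, w i \in S) -> S = fullv] }.

Lemma mem_rootspace (K : fieldType) (g : superalgebra K) (h : {vspace g}) (al : weight h) x :
  (forall z, linear (fun y => sa_br g y z)) -> (forall z, linear (sa_br g z)) ->
  x \in rootspace al <-> forall H : subvs_of h, sa_br g (vsval H) x = (al H : K) *: x.
Proof.
move=> br_linl br_linr.
have lin1 (y : g) : linear (fun H : subvs_of h => sa_br g (vsval H) y - (al H : K) *: y).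
  by move=> a H H' /=; rewrite br_linl linearP scalerBr scalerDl opprD addrACA scalerA.
rewrite memv_ker linfun_linearE; last first.
  move=> a y z; apply/lfunP => H; rewrite lfunE /= lfunE /=.
  rewrite !linfun_linearE // br_linr !scalerDr scalerN opprD addrACA !scalerA.
  by rewrite mulrC.
split=> [/eqP E H|E]; last first.
  by apply/eqP/lfunP => H; rewrite linfun_linearE // E subrr lfunE.
move/lfunP: E => /(_ H); rewrite linfun_linearE // lfunE /= => /eqP.
by rewrite subr_eq0 => /eqP.
Qed.

Section BasicStructure.
Variables (K : fieldType) (g : superalgebra K) (form : g -> g -> K) (h : {vspace g}).
Hypothesis bs : basic_structure form h.
Local Notation br := (sa_br g).
Local Notation part := (sa_part g).

Definition part_dec (x : g) : exists x0 x1, [/\ x0 \in part false, x1 \in part true & x = x0 + x1].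
Proof.
have : x \in (part false + part true)%VS by rewrite (bs_graded bs) memvf.
by case/memv_addP => x0 h0 [x1 h1 ->]; exists x0, x1.
Qed.

Lemma brDl x y z : br (x + y) z = br x z + br y z.
Proof. by have := bs_br_linl bs z 1 x y; rewrite !scale1r. Qed.
Lemma brDr x y z : br z (x + y) = br z x + br z y.
Proof. by have := bs_br_linr bs z 1 x y; rewrite !scale1r. Qed.
Lemma br0l z : br 0 z = 0.
Proof. by apply: (addIr (br 0 z)); rewrite -brDl !add0r. Qed.
Lemma br0r z : br z 0 = 0.
Proof. by apply: (addIr (br z 0)); rewrite -brDr !add0r. Qed.
Lemma brZl a x z : br (a *: x) z = a *: br x z.
Proof. by have := bs_br_linl bs z a x 0; rewrite br0l !addr0. Qed.
Lemma brZr a x z : br z (a *: x) = a *: br z x.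
Proof. by have := bs_br_linr bs z a x 0; rewrite br0r !addr0. Qed.

Lemma formDl x y z : form (x + y) z = form x z + form y z.
Proof. by have := bs_form_linl bs z 1 x y; rewrite scale1r mul1r. Qed.
Lemma form0l z : form 0 z = 0.
Proof. by apply: (addIr (form 0 z)); rewrite -formDl !add0r. Qed.
Lemma formZl a x z : form (a *: x) z = a * form x z.
Proof. by have := bs_form_linl bs z a x 0; rewrite form0l !addr0. Qed.

Lemma formDr x y z : form z (x + y) = form z x + form z y.
Proof. by have := bs_form_linr bs z 1 x y; rewrite !scale1r. Qed.
Lemma form0r z : form z 0 = 0.
Proof. by apply: (addIr (form z 0)); rewrite -formDr !add0r. Qed.
Lemma formZr a x z : form z (a *: x) = a * form z x.
Proof. by have := bs_form_linr bs z a x 0; rewrite form0r !addr0. Qed.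

Lemma form_suml (J : Type) (r : seq J) (F : J -> g) z :
  form (\sum_(i <- r) F i) z = \sum_(i <- r) form (F i) z.
Proof. by elim: r => [|i r IH]; rewrite ?big_nil ?form0l // !big_cons formDl IH. Qed.
Lemma form_sumr (J : Type) (r : seq J) (F : J -> g) z :
  form z (\sum_(i <- r) F i) = \sum_(i <- r) form z (F i).
Proof. by elim: r => [|i r IH]; rewrite ?big_nil ?form0r // !big_cons formDr IH. Qed.

Lemma part_ind (P : g -> Prop) : (forall p x, x \in part p -> P x) ->
  (forall x y, P x -> P y -> P (x + y)) -> forall x, P x.
Proof.
by move=> hp hD x; have [x0 [x1 [h0 h1 ->]]] := part_dec x; apply: hD; apply: hp; eassumption.
Qed.

Lemma form_inv x y z : form (br x y) z = form x (br y z).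
Proof.
elim/part_ind: x => [p x hx|x x' hx hx']; last by rewrite brDl !formDl hx hx'.
elim/part_ind: y => [q y hy|y y' hy hy']; last by rewrite brDr brDl formDl formDr hy hy'.
elim/part_ind: z => [r z hz|z z' hz hz']; last by rewrite brDr !formDr hz hz'.
exact: (bs_form_inv bs hx hy hz).
Qed.

Lemma cartan_part H : H \in h -> H \in part false.
Proof. exact: (subvP (bs_cartan_even bs)). Qed.

Lemma br_cartanC H x : H \in h -> br x H = - br H x.
Proof.
move=> hH; elim/part_ind: x => [p x hx|x x' hx hx']; last by rewrite brDl brDr hx hx' opprD.
by rewrite (bs_br_skew bs hx (cartan_part hH)) andbF scale1r.
Qed.

Lemma form_cartanC H x : H \in h -> form x H = form H x.
Proof.
move=> hH; elim/part_ind: x => [p x hx|x x' hx hx']; last by rewrite formDl formDr hx hx'.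
by rewrite (bs_formC bs hx (cartan_part hH)) andbF mul1r.
Qed.

Lemma rootspaceP (al : weight h) x :
  x \in rootspace al <-> forall H : subvs_of h, br (vsval H) x = (al H : K) *: x.
Proof. exact: mem_rootspace (bs_br_linl bs) (bs_br_linr bs). Qed.

(** Invariance moves [H] across the form, so [(al + be) H] times [form x y] is zero for every
    [H]. *)
Lemma form_rootspace_orth (al be : weight h) x y :
  x \in rootspace al -> y \in rootspace be -> al + be <> 0 -> form x y = 0.
Proof.
move=> /rootspaceP hx /rootspaceP hy hab.
apply/eqP; apply/negPn/negP => nz; apply: hab; apply/lfunP => H; rewrite !lfunE /=.
have : form (br (vsval H) x) y = - form x (br (vsval H) y).
  have := br_cartanC x (subvsP H); move/(congr1 (fun t => - t)); rewrite opprK => <-.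
  by rewrite -scaleN1r formZl form_inv mulN1r.
rewrite hx hy formZl formZr => /eqP; rewrite -subr_eq0 opprK -mulrDl mulf_eq0.
by rewrite (negPf nz) orbF => /eqP.
Qed.

Section WeightVectors.
Variables (I : finType) (w : I -> g) (wt : I -> weight h).
Hypothesis wroot : forall i, w i \in rootspace (wt i).
Hypothesis wspan : forall S : {vspace g}, (h <= S)%VS -> (forall i, w i \in S) -> S = fullv.

(** The Cartan subalgebra and the lines of the [w i] together span [g]. The component of weight [nu]
    of such a decomposition keeps only the indices of weight [nu], with the Cartan part counted in
    weight 0. *)
Lemma weight_vector_decomp nu x : x \in rootspace nu ->
  exists x0 (c : I -> g), [/\ x0 \in h, forall i, c i \in <[w i]>%VS
    & x = (if nu == 0 then x0 else 0) + \sum_(i | wt i == nu) c i].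
Proof.
move=> /rootspaceP hx; pose S := (h + \sum_i <[w i]>)%VS.
have : x \in S.
  have -> : S = fullv; last exact: memvf.
  apply: wspan => [|i]; first exact: addvSl.
  by apply: (subvP (addvSr _ _)); apply: (subvP (sumv_sup i _ (subvv _))) => //; apply: memv_line.
case/memv_addP => x0 hx0 [y /memv_sumP [c hc ->]] Ex; exists x0, c; split=> //.
  by move=> i; apply: hc.
pose F o := if o is Some i then c i else x0.
pose mu o := if o is Some i then wt i else 0.
have Ex' : x = \sum_(o <- None :: [seq Some i | i <- index_enum I]) F o.
  by rewrite big_cons big_map.
rewrite [LHS](@eigen_component _ _ _ (fun H y => br (vsval H) y) _ _ _ F mu nu x _ hx Ex').
- rewrite big_cons big_map /= eq_sym.
  by case: eqP; rewrite ?add0r.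
- by move=> H; apply: bs_br_linr bs _.
case=> [i|] _ H /=; last by rewrite lfunE scale0r (bs_cartan_abelian bs) ?subvsP.
have /rootspaceP := wroot i; have /vlineP [k ->] := hc i isT => /(_ H).
by rewrite brZr => ->; rewrite !scalerA mulrC.
Qed.

End WeightVectors.

(** The Cartan subalgebra is its own centralizer, since every member of the family of weight 0 lies
    in it. *)
Lemma cartan_rootspace x : (x \in h) = (x \in rootspace (0 : weight h)).
Proof.
apply/idP/idP => [hx|].
  by apply/rootspaceP => H; rewrite lfunE scale0r (bs_cartan_abelian bs) ?subvsP.
have [I [w [wt [par [wpar wroot w0 wprop wspan]]]]] := bs_weight_vectors bs.
move=> /(weight_vector_decomp wroot wspan) [x0 [c [hx0 hc ->]]].
rewrite eqxx; apply: memvD => //; apply: memv_suml => i /eqP /w0 hw.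
by have /vlineP [k ->] := hc i; apply: memvZ.
Qed.

(** Any nonzero member of the family of weight [al] spans: the others of this weight are multiples
    of it, and the decomposition of a root vector has no Cartan part because [al] is nonzero. *)
Lemma rootspace_line (al : weight h) : al != 0 -> rootspace al != 0%VS ->
  exists p e, [/\ e \in part p, e != 0 & rootspace al = <[e]>%VS].
Proof.
move=> al0 ral.
have [I [w [wt [par [wpar wroot w0 wprop wspan]]]]] := bs_weight_vectors bs.
have [x hx xn0] : exists2 x, x \in rootspace al & x != 0.
  by exists (vpick (rootspace al)); [exact: memv_pick | rewrite vpick0].
have [x0 [c [_ hc Ex]]] := weight_vector_decomp wroot wspan hx.
move: Ex; rewrite (negPf al0) add0r => Ex.
have [j /eqP wtj wj0] : exists2 j, wt j == al & w j != 0.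
  apply: contrapT => no; move: xn0; rewrite Ex big1 ?eqxx // => i wi.
  have wi0 : w i = 0 by apply: contrapT => /eqP wi0; apply: no; exists i.
  by have := hc i; rewrite wi0 => /vlineP [k ->]; rewrite scaler0.
exists (par j), (w j); split=> //; apply/eqP; rewrite eqEsubv; apply/andP; split; last first.
  by apply/subvP => y /vlineP [k ->]; apply: memvZ; rewrite -wtj.
apply/subvP => y /(weight_vector_decomp wroot wspan) [y0 [d [_ hd ->]]].
rewrite (negPf al0) add0r; apply: memv_suml => i /eqP wi.
have wij : w i \in <[w j]>%VS.
  by apply: wprop; rewrite ?wi ?wtj //; apply/eqP.
by have /vlineP [k ->] := hd i; apply: memvZ.
Qed.

(** As the root space is a line, the homogeneous element that makes [al] a root of parity [p]
    generates all of it. *)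
Lemma is_rootP p (al : weight h) : is_root p al ->
  exists e, [/\ e \in part p, e != 0 & rootspace al = <[e]>%VS].
Proof.
case/andP => al0 hp.
have [x] : exists2 x, x \in (part p :&: rootspace al)%VS & x != 0.
  by exists (vpick (part p :&: rootspace al)%VS); [exact: memv_pick | rewrite vpick0].
rewrite memv_cap => /andP [xp xr] xn0.
have ral : rootspace al != 0%VS by apply: contraNneq xn0 => E; rewrite E memv0 in xr.
have [q [e [eq e0 re]]] := rootspace_line al0 ral.
exists x; split=> //; rewrite re; move: xr; rewrite re => /vlineP [k Ex].
have k0 : k != 0 by apply: contraNneq xn0 => k0; rewrite Ex k0 scale0r.
by rewrite Ex; apply/eqP; rewrite eqEsubv -!memvE memvZ ?memv_line //= 
  -[X in X \in _](scalerK k0) memvZ ?memv_line.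
Qed.

Lemma root_parity_disj (al : weight h) : is_root false al -> is_root true al -> False.
Proof.
move=> /is_rootP [e [ep e0 re]] /is_rootP [f [fp f0 rf]].
have : e \in (part false :&: part true)%VS.
  rewrite memv_cap ep /=; have : e \in rootspace al by rewrite re memv_line.
  by rewrite rf => /vlineP [k ->]; apply: memvZ.
by rewrite (bs_direct bs) memv0 (negPf e0).
Qed.

(** Nondegeneracy gives a partner of [e], and the spanning property allows it to be a member of the
    family. Orthogonality of weight spaces then forces its weight to be [- al], evenness of the form
    forces its parity to be [p], and a rescaling normalizes the pairing. *)
Lemma root_pair p (al : weight h) : is_root p al ->
  exists e f, [/\ e \in part p, f \in part p, rootspace al = <[e]>%VS,
    rootspace (- al) = <[f]>%VS & form e f = 1].
Proof.
move=> ral; have [al0 _] := andP ral; have [e [ep e0 re]] := is_rootP ral.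
have [I [w [wt [par [wpar wroot w0 wprop wspan]]]]] := bs_weight_vectors bs.
have er : e \in rootspace al by rewrite re memv_line.
have [y hy] : exists y, form e y != 0.
  apply: contrapT => no; move/eqP: e0; apply; apply: (bs_form_nondeg bs) => y.
  by apply/eqP; apply/negPn/negP => ny; apply: no; exists y.
pose S := lker (linfun (form e : g -> K^o)).
have SP z : (z \in S) = (form e z == 0).
  by rewrite memv_ker linfun_linearE //; apply: bs_form_linr bs _.
have [i wi] : exists i, form e (w i) != 0.
  apply: contrapT => no; move/negP: hy; apply; rewrite -SP.
  have -> : S = fullv; last exact: memvf.
  apply: wspan => [|i]; last by rewrite SP; apply/negPn/negP => ni; apply: no; exists i.
  apply/subvP => z; rewrite cartan_rootspace SP => hz; apply/eqP.
  by apply: form_rootspace_orth er hz _; rewrite addr0; apply/eqP.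
have wti : wt i = - al.
  apply/eqP; rewrite -addr_eq0 addrC; apply: contraR wi => /eqP ne.
  by apply/eqP; apply: form_rootspace_orth er (wroot i) ne.
have pi : par i = p.
  apply: contraNeq wi => pp; apply/eqP; apply: (bs_form_even bs) ep _.
  by move: pp (wpar i); case: (par i); case: (p).
have fr : w i \in rootspace (- al) by rewrite -wti.
have rr : is_root p (- al).
  rewrite /is_root oppr_eq0 al0 /=; apply: contraNneq wi => E.
  have : w i \in (part p :&: rootspace (- al))%VS by rewrite memv_cap fr -pi wpar.
  by rewrite E memv0 => /eqP ->; rewrite form0r.
have [f [fp f0 rf]] := is_rootP rr.
move: fr wi; rewrite rf => /vlineP [k ->]; rewrite formZr mulf_eq0 negb_or => /andP [_ ef].
exists e, ((form e f)^-1 *: f); split=> //.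
- exact: memvZ.
- apply/eqP; rewrite eqEsubv -!memvE memvZ ?memv_line // andbT.
  by rewrite -[X in X \in _](scalerKV ef) memvZ ?memv_line.
- by rewrite formZr mulVf.
Qed.

Lemma root_opp p (al : weight h) : is_root p al -> is_root p (- al).
Proof.
move=> ral; have [al0 _] := andP ral; have [e [f [ep fp re rf ef]]] := root_pair ral.
rewrite /is_root oppr_eq0 al0 /=; apply: contra_eq_neq ef => E.
have : f \in (part p :&: rootspace (- al))%VS by rewrite memv_cap fp rf memv_line.
by rewrite E memv0 => /eqP ->; rewrite form0r eq_sym oner_eq0.
Qed.

Lemma root_span (S : {vspace g}) : (h <= S)%VS ->
  (forall p (al : weight h), is_root p al -> (rootspace al <= S)%VS) -> S = fullv.
Proof.
move=> hS rS; have [I [w [wt [par [wpar wroot w0 wprop wspan]]]]] := bs_weight_vectors bs.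
apply: wspan => // i; have [wt0|wt0] := eqVneq (wt i) 0.
  by apply: (subvP hS); apply: w0.
have [->|wi0] := eqVneq (w i) 0; first exact: mem0v.
apply: (subvP (rS (par i) (wt i) _)) => //; rewrite /is_root wt0 /=.
apply: contraNneq wi0 => E.
have : w i \in (part (par i) :&: rootspace (wt i))%VS by rewrite memv_cap wpar wroot.
by rewrite E memv0.
Qed.

(** The Cartan subalgebra is orthogonal to all root spaces, so a vector of [h] in the radical of the
    restricted form is in the radical on [g]. *)
Lemma form_cartan_nondeg x : x \in h -> (forall y, y \in h -> form x y = 0) -> x = 0.
Proof.
move=> hx hy; apply: (bs_form_nondeg bs) => y.
pose S := lker (linfun (form x : g -> K^o)).
have SP z : (z \in S) = (form x z == 0).
  by rewrite memv_ker linfun_linearE //; apply: bs_form_linr bs _.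
apply/eqP; rewrite -SP; have -> : S = fullv; last exact: memvf.
apply: root_span => [|p al /andP[al0 _]]; apply/subvP => z hz; rewrite SP; apply/eqP.
  exact: hy.
move: hx; rewrite cartan_rootspace => hx.
by apply: (form_rootspace_orth hx hz); rewrite add0r; apply/eqP.
Qed.

End BasicStructure.

(** * The form on the dual of the Cartan subalgebra *)

Section DualForm.
Variables (K : fieldType) (g : superalgebra K) (form : g -> g -> K) (h : {vspace g}).
Hypothesis bs : basic_structure form h.
Local Notation br := (sa_br g).
Local Notation part := (sa_part g).
Local Notation dform := (@dual_form K g h form).

Lemma flatE (H H' : subvs_of h) : (flat h form H : weight h) H' = form (vsval H) (vsval H').
Proof.
have lin1 (G : subvs_of h) : linear (fun H' : subvs_of h => (form (vsval G) (vsval H') : K^o)).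
  by move=> a x y /=; rewrite (bs_form_linr bs).
rewrite /flat linfun_linearE ?linfun_linearE // => a x y.
apply/lfunP => z; rewrite lfunE /= lfunE /= !linfun_linearE //; first exact: (bs_form_linl bs).
exact: (lin1 (a *: x + y)).
Qed.

Lemma flat_inj : lker (flat h form : 'Hom(subvs_of h, weight h)) == 0%VS.
Proof.
rewrite -subv0; apply/subvP => H; rewrite memv_ker memv0 => /eqP E.
apply/eqP; apply: val_inj; apply: (form_cartan_nondeg bs) => [|y hy]; first exact: subvsP.
by have := flatE H (vsproj h y); rewrite E lfunE /= vsprojK //.
Qed.

Lemma flat_surj : limg (flat h form : 'Hom(subvs_of h, weight h)) = fullv.
Proof.
apply/eqP; rewrite eqEdim subvf limg_dim_eq; last by rewrite (eqP flat_inj) capv0.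
by rewrite !dimvf /dim /= muln1.
Qed.

(** The element of [h] that represents [la] through the form. It is not normalized by (la, la),
    which vanishes for isotropic odd roots. *)
Definition coroot (la : weight h) : subvs_of h := ((flat h form)^-1)%VF la.

Lemma form_coroot la (H : subvs_of h) : form (vsval (coroot la)) (vsval H) = la H.
Proof. by rewrite -flatE /coroot limg_lfunVK // flat_surj memvf. Qed.

Lemma dual_formE la mu : dform la mu = la (coroot mu).
Proof. by rewrite -form_coroot. Qed.

Lemma dual_formC la mu : dform la mu = dform mu la.
Proof. by rewrite /dual_form (form_cartanC bs) ?subvsP. Qed.

Lemma dual_formDl la la' mu : dform (la + la') mu = dform la mu + dform la' mu.
Proof. by rewrite !dual_formE lfunE. Qed.

Lemma dual_formZl a la mu : dform (a *: la) mu = a * dform la mu.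
Proof. by rewrite !dual_formE lfunE. Qed.

Lemma dual_form_suml (I : Type) (r : seq I) (F : I -> weight h) mu :
  dform (\sum_(i <- r) F i) mu = \sum_(i <- r) dform (F i) mu.
Proof.
elim: r => [|i r IH]; first by rewrite !big_nil dual_formE lfunE.
by rewrite !big_cons dual_formDl IH.
Qed.

(** The bracket commutes with [h], hence lies in [h], and there it is determined by its pairings,
    which invariance evaluates. *)
Lemma br_root_pair (al : weight h) e f : e \in rootspace al -> f \in rootspace (- al) ->
  form e f = 1 -> br e f = vsval (coroot al).
Proof.
move=> he hf ef; have hd : br e f \in h.
  rewrite (cartan_rootspace bs); apply/(rootspaceP bs) => H.
  rewrite (bs_cartan_der bs) ?subvsP //.
  have /(rootspaceP bs) -> := he; have /(rootspaceP bs) -> := hf.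
  by rewrite (brZl bs) (brZr bs) -scalerDl !lfunE /= subrr.
apply/eqP; rewrite -subr_eq0; apply/eqP; apply: (form_cartan_nondeg bs).
  by rewrite memvB ?subvsP.
move=> y hy; rewrite (formDl bs) -scaleN1r (formZl bs) (form_inv bs) mulN1r.
have -> : y = vsval (vsproj h y) by rewrite vsprojK.
rewrite form_coroot (br_cartanC bs) ?subvsP //.
have /(rootspaceP bs) -> := hf.
by rewrite -scaleN1r !(formZr bs) ef mulr1 lfunE /= mulN1r opprK subrr.
Qed.

Lemma root_linear_ext (F G : g -> g) : linear F -> linear G ->
  (forall x, x \in h -> F x = G x) ->
  (forall p (al : weight h) x, is_root p al -> x \in rootspace al -> F x = G x) ->
  F =1 G.
Proof.
move=> lF lG hE rE x; pose D := (linfun F - linfun G)%VF.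
have DP y : (y \in lker D) = (F y == G y).
  by rewrite memv_ker !lfunE /= lfunE /= !linfun_linearE // subr_eq0.
apply/eqP; rewrite -DP; have -> : lker D = fullv; last exact: memvf.
apply: (root_span bs) => [|p al ral]; apply/subvP => y hy; rewrite DP; apply/eqP.
  exact: hE.
exact: rE ral hy.
Qed.

(** Dual bases of [h]: the second components represent the coordinate functions of [vbasis h].
    Symmetry of the form on [h] turns the first expansion into the second. *)
Lemma cartan_dual_pairs : exists s : seq (g * g),
  [/\ forall xy, xy \in s -> xy.1 \in h /\ xy.2 \in h,
      forall z, z \in h -> z = \sum_(xy <- s) form z xy.2 *: xy.1
    & forall z, z \in h -> z = \sum_(xy <- s) form xy.1 z *: xy.2].
Proof.
have lin i : linear (fun H : subvs_of h => (coord (vbasis h) i (vsval H) : K^o)).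
  by move=> a x y /=; rewrite linearP.
pose c i : weight h := linfun (fun H : subvs_of h => (coord (vbasis h) i (vsval H) : K^o)).
pose x (i : 'I_(\dim h)) := (vbasis h)`_i.
have xh i : x i \in h by rewrite vbasis_mem // mem_nth // size_tuple.
have E z : z \in h -> z = \sum_i form z (vsval (coroot (c i))) *: x i.
  move=> hz; rewrite {1}(coord_vbasis hz); apply: eq_bigr => i _; congr (_ *: _).
  rewrite -(form_cartanC bs) ?subvsP //; have -> : z = vsval (vsproj h z) by rewrite vsprojK.
  by rewrite form_coroot linfun_linearE.
exists [seq (x i, vsval (coroot (c i))) | i <- index_enum 'I_(\dim h)]; split.
- by move=> xy /mapP [i _ ->]; rewrite xh subvsP.
- by move=> z hz; rewrite big_map -E.
move=> z hz; rewrite big_map /=; apply/eqP; rewrite -subr_eq0; apply/eqP.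
apply: (form_cartan_nondeg bs) => [|y hy].
  by rewrite memvB // memv_suml // => i _; rewrite memvZ ?subvsP.
rewrite (formDl bs) -scaleN1r (formZl bs) mulN1r -(form_cartanC bs y) //.
rewrite {1}(E y hy).
rewrite !(form_suml bs) -sumrB big1 // => i _.
by rewrite !(formZl bs) (form_cartanC bs) ?subvsP // mulrC subrr.
Qed.

End DualForm.

(** * The Casimir operator *)

Section PositiveRoots.
Variables (K : fieldType) (g : superalgebra K) (form : g -> g -> K) (h : {vspace g}).
Hypothesis bs : basic_structure form h.
Local Notation br := (sa_br g).
Local Notation part := (sa_part g).
Variables (pos : seq (weight h)) (par : weight h -> bool).
Hypothesis pos_uniq : uniq pos.
Hypothesis pos_root : forall al, al \in pos -> is_root (par al) al.
Hypothesis pos_total : forall p al, is_root p al -> al \in pos \/ - al \in pos.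
Hypothesis pos_add : forall al be, al \in pos -> be \in pos -> al + be <> 0.

(** The normalization is asymmetric for odd roots: [form (f al) (e al)] is then -1. *)
Definition root_vectors (e f : weight h -> g) := forall al, al \in pos ->
  [/\ e al \in part (par al), f al \in part (par al), rootspace al = <[e al]>%VS,
      rootspace (- al) = <[f al]>%VS & form (e al) (f al) = 1].

Lemma root_vectors_ex : exists e f, root_vectors e f.
Proof.
have /choice [ef hef] : forall al, exists ef : g * g, al \in pos ->
  [/\ ef.1 \in part (par al), ef.2 \in part (par al), rootspace al = <[ef.1]>%VS,
      rootspace (- al) = <[ef.2]>%VS & form ef.1 ef.2 = 1].
  move=> al; have [hal|] := boolP (al \in pos); last by exists (0, 0).
  by have [e [f H]] := root_pair bs (pos_root hal); exists (e, f).
by exists (fun al => (ef al).1), (fun al => (ef al).2) => al /hef.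
Qed.

Variables (e f : weight h -> g).
Hypothesis ef : root_vectors e f.

Lemma root_e al : al \in pos -> e al \in rootspace al.
Proof. by case/ef => _ _ -> _ _; apply: memv_line. Qed.
Lemma root_f al : al \in pos -> f al \in rootspace (- al).
Proof. by case/ef => _ _ _ -> _; apply: memv_line. Qed.

Lemma pos_neq0 al : al \in pos -> al <> 0.
Proof. by move=> h1 E; apply: (pos_add h1 h1); rewrite E addr0. Qed.

Lemma form_ee al be : al \in pos -> be \in pos -> form (e al) (e be) = 0.
Proof.
by move=> ha hb; apply: (form_rootspace_orth bs (root_e ha) (root_e hb)); apply: pos_add.
Qed.
Lemma form_ff al be : al \in pos -> be \in pos -> form (f al) (f be) = 0.
Proof.
move=> ha hb; apply: (form_rootspace_orth bs (root_f ha) (root_f hb)).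
by rewrite -opprD => /eqP; rewrite oppr_eq0 => /eqP; apply: pos_add.
Qed.
Lemma form_ef al be : al \in pos -> be \in pos -> form (e al) (f be) = (al == be)%:R.
Proof.
move=> ha hb; case: eqP => [<-|ne]; first by case: (ef ha).
apply: (form_rootspace_orth bs (root_e ha) (root_f hb)).
by move=> /eqP; rewrite subr_eq0 => /eqP.
Qed.
Lemma form_fe al be : al \in pos -> be \in pos ->
  form (f al) (e be) = (-1) ^+ par al * (al == be)%:R.
Proof.
move=> ha hb; have [_ fp _ _ _] := ef ha; have [ep _ _ _ _] := ef hb.
have [E|ne] := eqVneq al be.
  by rewrite (bs_formC bs fp ep) form_ef // E eqxx andbb.
rewrite mulr0; apply: (form_rootspace_orth bs (root_f ha) (root_e hb)).
by rewrite addrC => /eqP; rewrite subr_eq0 eq_sym => /eqP E; move/eqP: ne.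
Qed.

Lemma form_cartan_root x y (al : weight h) : x \in h -> y \in rootspace al -> al <> 0 ->
  form x y = 0.
Proof.
rewrite (cartan_rootspace bs) => hx hy al0.
by apply: (form_rootspace_orth bs hx hy); rewrite add0r.
Qed.

Lemma pos_neqN0 al : al \in pos -> - al <> 0.
Proof. by move=> /pos_neq0 n0 /eqP; rewrite oppr_eq0 => /eqP. Qed.

Lemma form_he x al : x \in h -> al \in pos -> form x (e al) = 0.
Proof. by move=> hx ha; apply: form_cartan_root hx (root_e ha) (pos_neq0 ha). Qed.
Lemma form_hf x al : x \in h -> al \in pos -> form x (f al) = 0.
Proof. by move=> hx ha; apply: form_cartan_root hx (root_f ha) (pos_neqN0 ha). Qed.
Lemma form_eh x al : x \in h -> al \in pos -> form (e al) x = 0.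
Proof. by move=> hx ha; rewrite (form_cartanC bs) // form_he. Qed.
Lemma form_fh x al : x \in h -> al \in pos -> form (f al) x = 0.
Proof. by move=> hx ha; rewrite (form_cartanC bs) // form_hf. Qed.

Lemma ef_linear_ext (F G : g -> g) : linear F -> linear G ->
  (forall x, x \in h -> F x = G x) ->
  (forall al, al \in pos -> F (e al) = G (e al) /\ F (f al) = G (f al)) -> F =1 G.
Proof.
move=> lF lG hE efE; apply: (root_linear_ext bs) => // p al x ral.
have ZE (H : g -> g) : linear H -> forall a y, H (a *: y) = a *: H y.
  move=> lH a y; have H0 : H 0 = 0.
    by have := lH 1 0 0; rewrite !scale1r addr0 => /eqP; rewrite -subr_eq0 opprD addNKr oppr_eq0 => /eqP.
  by rewrite -[a *: y]addr0 lH H0 addr0.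
have [ha|ha] := pos_total ral.
  have [_ _ -> _ _] := ef ha => /vlineP [k ->].
  by rewrite !ZE //; have [-> _] := efE _ ha.
have [_ _ _ + _] := ef ha; rewrite opprK => -> /vlineP [k ->].
by rewrite !ZE //; have [_ ->] := efE _ ha.
Qed.

Variable s : seq (g * g).
Hypothesis s_cartan : forall xy, xy \in s -> xy.1 \in h /\ xy.2 \in h.
Hypothesis s_l : forall z, z \in h -> z = \sum_(xy <- s) form z xy.2 *: xy.1.
Hypothesis s_r : forall z, z \in h -> z = \sum_(xy <- s) form xy.1 z *: xy.2.

(** A pair (x, y) of root vectors satisfies [form x y = 1]; the sign on [e al] makes up for
    [form (f al) (e al)] being -1 when [al] is odd. *)
Definition casimir_pairs : seq (g * g) :=
  s ++ [seq (e al, f al) | al <- pos] ++ [seq (f al, (-1) ^+ par al *: e al) | al <- pos].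

Lemma casimir_pairs_part xy : xy \in casimir_pairs ->
  exists p, xy.1 \in part p /\ xy.2 \in part p.
Proof.
rewrite !mem_cat => /or3P [/s_cartan [h1 h2]|/mapP [al ha ->]|/mapP [al ha ->]] /=.
- by exists false; split; apply: (cartan_part bs).
- by have [h1 h2 _ _ _] := ef ha; exists (par al).
- by have [h1 h2 _ _ _] := ef ha; exists (par al); split => //; apply: memvZ.
Qed.

Lemma sum_delta (F : weight h -> g) (c : weight h -> K) al : al \in pos ->
  \sum_(be <- pos) (c be * (al == be)%:R) *: F be = c al *: F al.
Proof.
move=> ha; rewrite (bigD1_seq al) //= eqxx mulr1 big1 ?addr0 // => be /negPf ne.
by rewrite eq_sym ne mulr0 scale0r.
Qed.

Lemma lin_sum (J : Type) (r : seq J) (c : J -> g -> K) (v : J -> g) :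
  (forall j a x y, c j (a *: x + y) = a * c j x + c j y) ->
  linear (fun z => \sum_(j <- r) c j z *: v j).
Proof.
move=> hc a x y; rewrite scaler_sumr -big_split /=; apply: eq_bigr => j _.
by rewrite hc scalerDl scalerA.
Qed.

Lemma casimir_l z : z = \sum_(xy <- casimir_pairs) form z xy.2 *: xy.1.
Proof.
pose G z := \sum_(xy <- casimir_pairs) form z xy.2 *: xy.1.
apply: (ef_linear_ext (F := id) (G := G)) => //.
- by apply: lin_sum => j a x y; apply: (bs_form_linl bs).
- move=> x hx; rewrite /G !big_cat !big_map -s_l //= 2?big1_seq ?addr0 //= => al /= ha.
    by rewrite (formZr bs) form_he // mulr0 scale0r.
  by rewrite form_hf // scale0r.
move=> al ha; split; rewrite /G !big_cat !big_map /=.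
  rewrite big1_seq ?add0r => [|xy /s_cartan [_ h2]]; last by rewrite form_eh // scale0r.
  rewrite [X in _ + X]big1_seq ?addr0 => [|be hb]; last by rewrite (formZr bs) form_ee // mulr0 scale0r.
  rewrite -[LHS]scale1r -(sum_delta e (fun=> 1)) //.
  by apply: eq_big_seq => be hb; rewrite form_ef // mul1r.
rewrite big1_seq ?add0r => [|xy /s_cartan [_ h2]]; last by rewrite form_fh // scale0r.
rewrite big1_seq ?add0r => [|be hb]; last by rewrite form_ff // scale0r.
rewrite -[LHS]scale1r -(sum_delta f (fun=> 1)) //.
apply: eq_big_seq => be hb; rewrite (formZr bs) form_fe //.
by case: eqP => [->|_]; rewrite ?mulr0 // !mulr1 -expr2 sqrr_sign.
Qed.

Lemma casimir_r z : z = \sum_(xy <- casimir_pairs) form xy.1 z *: xy.2.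
Proof.
pose G z := \sum_(xy <- casimir_pairs) form xy.1 z *: xy.2.
apply: (ef_linear_ext (F := id) (G := G)) => //.
- by apply: lin_sum => j a x y; apply: (bs_form_linr bs).
- move=> x hx; rewrite /G !big_cat !big_map -s_r //= 2?big1_seq ?addr0 //= => al /= ha.
    by rewrite form_fh // scale0r.
  by rewrite form_eh // scale0r.
move=> al ha; split; rewrite /G !big_cat !big_map /=.
  rewrite big1_seq ?add0r => [|xy /s_cartan [h1 _]]; last by rewrite form_he // scale0r.
  rewrite big1_seq ?add0r => [|be hb]; last by rewrite form_ee // scale0r.
  rewrite -[LHS]scale1r -(sum_delta e (fun=> 1)) //.
  apply: eq_big_seq => be hb; rewrite form_fe // scalerA eq_sym.
  by case: eqP => [->|_]; rewrite ?mulr0 ?mul0r // !mulr1 -expr2 sqrr_sign.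
rewrite big1_seq ?add0r => [|xy /s_cartan [h1 _]]; last by rewrite form_hf // scale0r.
rewrite [X in _ + X]big1_seq ?addr0 => [|be hb]; last by rewrite form_ff // scale0r.
rewrite -[LHS]scale1r -(sum_delta f (fun=> 1)) //.
by apply: eq_big_seq => be hb; rewrite form_ef // mul1r eq_sym.
Qed.

End PositiveRoots.

(** * Spans of finite lists *)

Section FiniteSpan.
Variables (K : fieldType) (V : lmodType K).

Fixpoint lspan (l : seq V) (u : V) : Prop :=
  if l is x :: l' then exists a w, lspan l' w /\ u = a *: x + w else u = 0.

Lemma lspan0 l : lspan l 0.
Proof. by elim: l => //= x l IH; exists 0, 0; rewrite scale0r addr0. Qed.

Lemma lspanP l a u w : lspan l u -> lspan l w -> lspan l (a *: u + w).
Proof.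
elim: l u w => [|x l IH] u w /=; first by move=> -> ->; rewrite scaler0 addr0.
move=> [b [u' [hu ->]]] [c [w' [hw ->]]]; exists (a * b + c), (a *: u' + w'); split.
  exact: IH.
by rewrite scalerDl scalerDr scalerA addrACA.
Qed.

Lemma lspan_mem (T : eqType) (F : T -> V) (l : seq T) x : x \in l -> lspan (map F l) (F x).
Proof.
elim: l => //= y l IH; rewrite in_cons => /orP [/eqP ->|/IH hx].
  by exists 1, 0; rewrite scale1r addr0; split=> //; apply: lspan0.
by exists 0, (F x); rewrite scale0r add0r.
Qed.

Lemma lspan_min l (W : set V) : W 0 -> (forall a u w, W u -> W w -> W (a *: u + w)) ->
  (forall i, (i < size l)%N -> W l`_i) -> forall u, lspan l u -> W u.
Proof.
move=> W0 WP; elim: l => [|x l IH] hl u /=; first by move=> ->.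
move=> [a [w [hw ->]]]; apply: WP; first exact: (hl 0%N).
by apply: IH hw => i hi; apply: (hl i.+1).
Qed.

(** The vectors are added one at a time: one that already lies in the span leaves the basis alone,
    any other one extends it. *)
Lemma lspan_has_dim l : exists n, has_dim [set u | lspan l u]%classic n.
Proof.
elim: l => [|x l [n [b [bs bi]]]] /=.
  exists 0%N, (fun=> 0); split=> [v /=|c _ []//].
  split=> [->|[c ->]]; last by rewrite big_ord0.
  by exists (fun=> 0); rewrite big_ord0.
have [xl|nxl] := pselect (lspan l x).
  exists n, b; split=> // v; rewrite -bs /=; split=> [[a [w [hw ->]]]|hv].
    exact: lspanP.
  by exists 0, v; rewrite scale0r add0r.
exists n.+1, (fun i => if unlift ord0 i is Some j then b j else x).
have E c : \sum_i c i *: (if unlift ord0 i is Some j then b j else x) =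
    c ord0 *: x + \sum_i c (lift ord0 i) *: b i.
  rewrite big_ord_recl unlift_none; congr (_ + _); apply: eq_bigr => i _.
  by rewrite liftK.
split=> [v /=|c].
  split=> [[a [w [hw ->]]]|[c ->]]; rewrite ?E.
    have [c ->] := (bs w).1 hw.
    exists (fun i => if unlift ord0 i is Some j then c j else a).
    rewrite E unlift_none; congr (_ + _); apply: eq_bigr => i _; by rewrite liftK.
  exists (c ord0), (\sum_i c (lift ord0 i) *: b i); split=> //.
  by apply/bs; exists (fun i => c (lift ord0 i)).
rewrite E => E0.
have c0 : c ord0 = 0.
  apply: contrapT => /eqP c0; apply: nxl.
  have -> : x = (- (c ord0)^-1) *: (\sum_i c (lift ord0 i) *: b i) + 0.
    rewrite addr0; apply: (scalerI c0); rewrite scalerA mulrN mulfV // scaleN1r.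
    by apply/eqP; rewrite -addr_eq0 E0.
  by apply: lspanP; [apply/bs; exists (fun i => c (lift ord0 i)) | exact: lspan0].
move: E0; rewrite c0 scale0r add0r => /bi ci i.
by case: (unliftP ord0 i) => [j ->|->].
Qed.

End FiniteSpan.

(** * The Casimir operator on a representation, and highest weight representations *)

Section Representation.
Variables (K : fieldType) (g : superalgebra K) (form : g -> g -> K) (h : {vspace g}).
Hypothesis bs : basic_structure form h.
Local Notation br := (sa_br g).
Local Notation part := (sa_part g).
Local Notation dform := (@dual_form K g h form).
Variable M : representation g.
Local Notation act := (rep_act M).

Lemma ract_lin x : linear (act x).
Proof. by move=> a u w; apply: rep_act_linr. Qed.
Lemma ractDr x u w : act x (u + w) = act x u + act x w.
Proof. by have := @rep_act_linr _ _ M 1 x u w; rewrite !scale1r. Qed.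
Lemma ract0r x : act x 0 = 0.
Proof. by apply: (addIr (act x 0)); rewrite -ractDr !add0r. Qed.
Lemma ractZr x a u : act x (a *: u) = a *: act x u.
Proof. by have := @rep_act_linr _ _ M a x u 0; rewrite ract0r !addr0. Qed.
Lemma ractNr x u : act x (- u) = - act x u.
Proof. by rewrite -!scaleN1r ractZr. Qed.
Lemma ract_sumr x (I : Type) (r : seq I) (F : I -> M) :
  act x (\sum_(i <- r) F i) = \sum_(i <- r) act x (F i).
Proof. by elim: r => [|i r IH]; rewrite ?big_nil ?ract0r // !big_cons ractDr IH. Qed.
Lemma ractDl x y u : act (x + y) u = act x u + act y u.
Proof. by have := @rep_act_linl _ _ M 1 x y u; rewrite !scale1r. Qed.
Lemma ract0l u : act 0 u = 0.
Proof. by apply: (addIr (act 0 u)); rewrite -ractDl !add0r. Qed.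
Lemma ractZl x a u : act (a *: x) u = a *: act x u.
Proof. by have := @rep_act_linl _ _ M a x 0 u; rewrite ract0l !addr0. Qed.
Lemma ract_suml u (I : Type) (r : seq I) (F : I -> g) :
  act (\sum_(i <- r) F i) u = \sum_(i <- r) act (F i) u.
Proof. by elim: r => [|i r IH]; rewrite ?big_nil ?ract0l // !big_cons ractDl IH. Qed.

Lemma ract_cartan H x u : H \in h -> act (br H x) u = act H (act x u) - act x (act H u).
Proof.
move=> hH; elim/(part_ind bs): x => [p x hx|x y hx hy].
  by rewrite (rep_act_br _ (cartan_part bs hH) hx) scale1r.
by rewrite (brDr bs) !ractDl hx hy ractDr opprD addrACA.
Qed.

Lemma weight_space0 (nu : weight h) : weight_space M nu 0.
Proof. by move=> H; rewrite ract0r scaler0. Qed.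

Lemma weight_spaceP (nu : weight h) a u w :
  weight_space M nu u -> weight_space M nu w -> weight_space M nu (a *: u + w).
Proof.
move=> hu hw H; rewrite rep_act_linr hu hw scalerDr !scalerA.
by rewrite mulrC.
Qed.

Lemma ract_weight (al nu : weight h) x u : x \in rootspace al -> weight_space M nu u ->
  weight_space M (nu + al) (act x u).
Proof.
move=> /(rootspaceP bs) hx hu H; have := ract_cartan x u (subvsP H).
rewrite hx ractZl hu ractZr => E.
by rewrite lfunE /= scalerDl E addrC subrK.
Qed.

Section Casimir.
Variable cas : seq (g * g).
Hypothesis cas_part : forall xy, xy \in cas -> exists p, xy.1 \in part p /\ xy.2 \in part p.
Hypothesis cas_l : forall z, z = \sum_(xy <- cas) form z xy.2 *: xy.1.
Hypothesis cas_r : forall z, z = \sum_(xy <- cas) form xy.1 z *: xy.2.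

(** The factor [xy.1] acts before [xy.2]; with this order each positive root contributes f e +
    (-1)^p e f. *)
Definition casimir u := \sum_(xy <- cas) act xy.2 (act xy.1 u).

Lemma casimir_lin : linear casimir.
Proof.
move=> a u w; rewrite /casimir scaler_sumr -big_split; apply: eq_bigr => xy _.
by rewrite !rep_act_linr.
Qed.

(** Commuting [x] past both factors leaves the brackets of [x] with [xy.2] and with [xy.1]. Expanded
    in the dual bases, the two double sums have opposite coefficients by skew symmetry and
    invariance. *)
Lemma casimir_comm x u : act x (casimir u) = casimir (act x u).
Proof.
elim/(part_ind bs): x => [p x hx|x y hx hy]; last first.
  rewrite ractDl hx hy ractDl -[casimir (act x u)]scale1r -casimir_lin scale1r //.
(* The members of a dual pair have the same parity, so one sign records the passage of [x] past
   either factor, and passing both costs no sign. *)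
have [q hq] : exists q, forall xy, xy \in cas -> xy.1 \in part (q xy) /\ xy.2 \in part (q xy).
  have /choice [q hq] : forall xy, exists q, xy \in cas -> xy.1 \in part q /\ xy.2 \in part q.
    move=> xy; have [/cas_part [q hq]|] := boolP (xy \in cas); first by exists q.
    by exists false.
  by exists q.
pose sg xy : K := (-1) ^+ (p && q xy).
have E xy : xy \in cas -> act x (act xy.2 (act xy.1 u)) =
    (act (br x xy.2) (act xy.1 u) + sg xy *: act xy.2 (act (br x xy.1) u)) +
    act xy.2 (act xy.1 (act x u)).
  move=> /hq [h1 h2].
  rewrite (rep_act_br (act xy.1 u) hx h2) (rep_act_br u hx h1) -/(sg xy).
  have D c y A B : act y (A - c *: B) = act y A - c *: act y B.
    by rewrite ractDr ractNr ractZr.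
  by rewrite D scalerBr scalerA -expr2 sqrr_sign scale1r addrA !subrK.
rewrite /casimir ract_sumr (eq_big_seq _ E) big_split /=.
suff -> : \sum_(xy <- cas) (act (br x xy.2) (act xy.1 u) + sg xy *: act xy.2 (act (br x xy.1) u)) = 0.
  by rewrite add0r.
have E1 xy : act (br x xy.2) (act xy.1 u) =
    \sum_(xy' <- cas) form xy'.1 (br x xy.2) *: act xy'.2 (act xy.1 u).
  by rewrite {1}(cas_r (br x xy.2)) ract_suml; apply: eq_bigr => j _; rewrite ractZl.
have E2 xy : sg xy *: act xy.2 (act (br x xy.1) u) =
    \sum_(xy' <- cas) (sg xy * form (br x xy.1) xy'.2) *: act xy.2 (act xy'.1 u).
  rewrite {1}(cas_l (br x xy.1)) ract_suml ract_sumr scaler_sumr; apply: eq_bigr => j _.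
  by rewrite ractZl ractZr scalerA.
rewrite big_split /= (eq_bigr _ (fun xy _ => E1 xy)) (eq_bigr _ (fun xy _ => E2 xy)).
(* After the exchange both sums run over the same products [act j.2 (act i.1 u)]. *)
rewrite [X in _ + X]exchange_big /= -big_split big1_seq //= => i _.
rewrite -big_split big1_seq //= => j /hq [j1 j2].
rewrite -scalerDl (bs_br_skew bs hx j1) -scaleN1r !(formZl bs) (form_inv bs) -/(sg j).
by rewrite mulN1r mulrN mulrA -expr2 sqrr_sign mul1r subrr scale0r.
Qed.

End Casimir.

Section HighestWeight.
Variables (pos : seq (weight h)) (par : weight h -> bool).
Hypothesis pos_uniq : uniq pos.
Hypothesis pos_total : forall p al, is_root p al -> al \in pos \/ - al \in pos.
Variables (F : archiRealFieldType) (ht : weight h -> F).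
Hypothesis htD : forall al be, ht (al + be) = ht al + ht be.
Hypothesis ht_pos : forall al, al \in pos -> 0 < ht al.
Variables (Lam : weight h) (v : M).
Hypothesis v_weight : weight_space M Lam v.
Hypothesis v_killed : forall al x, al \in pos -> x \in rootspace al -> act x v = 0.
Hypothesis v_gen : generates v.

Lemma ht0 : ht 0 = 0.
Proof. by apply: (addIr (ht 0)); rewrite -htD !add0r. Qed.

Lemma pos_add al be : al \in pos -> be \in pos -> al + be <> 0.
Proof.
move=> /ht_pos ha /ht_pos hb E; have := addr_gt0 ha hb.
by rewrite -htD E ht0 ltxx.
Qed.

Variables e f : weight h -> g.
Hypothesis ef : root_vectors form pos par e f.

Fixpoint word (s : seq (weight h)) : M := if s is al :: s' then act (f al) (word s') else v.
Fixpoint word_wt (s : seq (weight h)) : weight h :=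
  if s is al :: s' then word_wt s' - al else Lam.

Lemma word_weight s : all (mem pos) s -> weight_space M (word_wt s) (word s).
Proof.
elim: s => //= al s IH /andP [ha /IH hs]; apply: ract_weight hs.
exact: (root_f ef).
Qed.

(** Words in the [f al] in any order and with repetitions; they turn out to span [M], but are in
    general linearly dependent. *)
Definition wspan u := exists l : seq (K * seq (weight h)),
  (forall cs, cs \in l -> all (mem pos) cs.2) /\ u = \sum_(cs <- l) cs.1 *: word cs.2.

Lemma wspanP a u w : wspan u -> wspan w -> wspan (a *: u + w).
Proof.
move=> [l [hl ->]] [l' [hl' ->]].
exists ([seq (a * cs.1, cs.2) | cs <- l] ++ l'); split.
  by move=> cs; rewrite mem_cat => /orP [/mapP [cs' /hl hcs ->]|/hl'].
rewrite big_cat big_map /= scaler_sumr; congr (_ + _).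
by apply: eq_bigr => i _; rewrite scalerA.
Qed.

Lemma wspan0 : wspan 0.
Proof. by exists [::]; rewrite big_nil. Qed.

Lemma wspan_word s : all (mem pos) s -> wspan (word s).
Proof.
move=> hs; exists [:: (1, s)]; rewrite big_seq1 scale1r; split=> // cs.
by rewrite inE => /eqP ->.
Qed.

Lemma wspan_sum (I : eqType) (r : seq I) (G : I -> M) :
  (forall i, i \in r -> wspan (G i)) -> wspan (\sum_(i <- r) G i).
Proof.
elim: r => [|i r IH] hG; first by rewrite big_nil; apply: wspan0.
rewrite big_cons -[G i]scale1r; apply: wspanP; first by apply: hG; rewrite mem_head.
by apply: IH => j hj; apply: hG; rewrite in_cons hj orbT.
Qed.

Lemma wspanZ a u : wspan u -> wspan (a *: u).
Proof. by move=> hu; rewrite -[_ *: _]addr0; apply: wspanP => //; apply: wspan0. Qed.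

Lemma wspan_f al u : al \in pos -> wspan u -> wspan (act (f al) u).
Proof.
move=> ha [l [hl ->]]; rewrite ract_sumr; apply: wspan_sum => cs /hl hcs.
by rewrite ractZr; apply: wspanZ; apply: (@wspan_word (al :: cs.2)); rewrite /= ha.
Qed.

(** The expansion of [x] in the Casimir pairs serves as the triangular decomposition of [g]: the
    Cartan part scales [v], the [e al] kill it, the [f al] give words of length one. *)
Lemma wspan_act_hw x : wspan (act x v).
Proof.
have [s [sh sl sr]] := cartan_dual_pairs bs.
have padd : forall al be, al \in pos -> be \in pos -> al + be <> 0 by exact: pos_add.
rewrite (casimir_l bs pos_uniq pos_total padd ef sh sl x) ract_suml.
have v_span : wspan v by apply: (@wspan_word [::]).
apply: wspan_sum => xy; rewrite ractZl !mem_cat => hxy; apply: wspanZ.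
case/or3P: hxy => [/sh [hx _]|/mapP [al ha ->]|/mapP [al ha ->]].
- by rewrite -(vsprojK hx) v_weight; apply: wspanZ.
- by rewrite (v_killed ha (root_e ef ha)); apply: wspan0.
- by apply: wspan_f.
Qed.

(** Induction on the word with [x] arbitrary: moving [x] past the first letter produces the bracket
    of [x] with that letter, to which the induction hypothesis applies as well. *)
Lemma wspan_act_word s x : all (mem pos) s -> wspan (act x (word s)).
Proof.
elim: s x => [|al s IH] x /=; first by move=> _; apply: wspan_act_hw.
move=> /andP [ha hs].
elim/(part_ind bs): x => [p x hx|x y hx hy]; last first.
  by rewrite ractDl -[act x _]scale1r; apply: wspanP.
have [_ fp _ _ _] := ef ha.
have -> : act x (act (f al) (word s)) =
    (-1) ^+ (p && par al) *: act (f al) (act x (word s)) + act (br x (f al)) (word s).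
  by rewrite (rep_act_br _ hx fp) addrC subrK.
by apply: wspanP; [apply: wspan_f => //; apply: IH | apply: IH].
Qed.

Lemma wspan_all u : wspan u.
Proof.
apply: (v_gen (S := wspan)) u => [a u w|x u [l [hl ->]]|]; first exact: wspanP.
  rewrite ract_sumr; apply: wspan_sum => cs /hl hcs.
  by rewrite ractZr; apply: wspanZ; apply: wspan_act_word.
exact: (@wspan_word [::]).
Qed.

Fixpoint words (n : nat) : seq (seq (weight h)) :=
  if n is n'.+1 then [::] :: [seq al :: s | al <- pos, s <- words n'] else [:: [::]].

Lemma mem_words n s : all (mem pos) s -> (size s <= n)%N -> s \in words n.
Proof.
elim: n s => [|n IH] [|al s] //= /andP [ha hs] sn.
by rewrite in_cons /=; apply/allpairsP; exists (al, s); rewrite IH.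
Qed.

(** A common positive lower bound lets the weight of a word bound its length. *)
Lemma ht_lb : exists2 c : F, 0 < c & forall al, al \in pos -> c <= ht al.
Proof.
elim: pos ht_pos => [|al s IH] hp; first by exists 1.
have [be hbe|c c0 hc] := IH; first by apply: hp; rewrite in_cons hbe orbT.
exists (Num.min c (ht al)); first by rewrite lt_min c0 hp ?mem_head.
move=> be; rewrite in_cons ge_min => /orP [/eqP ->|/hc ->] //.
by rewrite lexx orbT.
Qed.

Lemma word_ht c s : (forall al, al \in pos -> c <= ht al) -> all (mem pos) s ->
  ht (word_wt s) <= ht Lam - c *+ size s.
Proof.
move=> hc; elim: s => [|al s IH] /=; first by rewrite subr0.
move=> /andP [ha /IH {}IH]; have -> : ht (word_wt s - al) = ht (word_wt s) - ht al.
  by apply/eqP; rewrite eq_sym subr_eq -htD subrK.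
by rewrite mulrS opprD addrCA addrC lerB // hc.
Qed.

Lemma weight_space_words (nu : weight h) u : weight_space M nu u -> exists l : seq (K * seq (weight h)),
  (forall cs, cs \in l -> all (mem pos) cs.2 /\ word_wt cs.2 = nu) /\
  u = \sum_(cs <- l) cs.1 *: word cs.2.
Proof.
move=> hu; have [l [hl Eu]] := wspan_all u.
exists [seq cs <- l | word_wt cs.2 == nu]; split.
  by move=> cs; rewrite mem_filter => /andP [/eqP -> /hl].
rewrite big_filter.
apply: (@eigen_component _ _ _ (fun H => act (vsval H)) _ _ l
  (fun cs => cs.1 *: word cs.2) (fun cs => word_wt cs.2)) => //.
  by move=> H; apply: ract_lin.
move=> cs /hl hcs H; rewrite ractZr (word_weight hcs) !scalerA.
by rewrite mulrC.
Qed.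

Lemma weight_space_ht (nu : weight h) u : weight_space M nu u -> u <> 0 -> ht nu <= ht Lam.
Proof.
move=> hu u0; have [l [hl Eu]] := weight_space_words hu.
case: l hl Eu => [|cs l] hl Eu; first by case: u0; rewrite Eu big_nil.
have [hcs <-] := hl cs (mem_head _ _).
(* With [c = 0] the estimate says that no word lies above [Lam]. *)
have := @word_ht 0 cs.2 _ hcs; rewrite mul0rn subr0; apply.
by move=> al /ht_pos /ltW.
Qed.

(** A word of weight [nu] has length at most [(ht Lam - ht nu) / c], so finitely many words span the
    weight space. Hence [wdim] is a genuine dimension here and not the default value. *)
Lemma weight_space_dim (nu : weight h) : has_dim (weight_space M nu) (wdim M nu).
Proof.
rewrite /wdim; apply: (@xgetPex _ 0%N [set n | has_dim (weight_space M nu) n]%classic).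
have [c c0 hc] := ht_lb.
(* The absolute value keeps the quotient nonnegative, as [archi_boundP] requires, also when [nu]
   lies above [Lam]. *)
pose N := Num.Def.archi_bound (`|ht Lam - ht nu| / c).
pose L := [seq word s | s <- [seq s <- words N | all (mem pos) s & word_wt s == nu]].
have [n hn] := lspan_has_dim L; exists n.
suff -> : weight_space M nu = [set u | lspan L u]%classic by [].
apply/seteqP; split=> u /=.
  move=> hu; have [l [hl ->]] := weight_space_words hu.
  rewrite big_seq; apply: big_ind; first exact: lspan0.
    by move=> x y hx hy; rewrite -[x]scale1r; apply: lspanP.
  move=> cs /hl [hcs hnu]; rewrite -[_ *: _]addr0; apply: lspanP; last exact: lspan0.
  apply: lspan_mem; rewrite mem_filter hcs hnu eqxx !andTb.
  apply: mem_words => //; have := word_ht hc hcs; rewrite hnu => hle.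
  have {}hle : c *+ size cs.2 <= `|ht Lam - ht nu|.
    by apply: le_trans (ler_norm _); rewrite lerBrDr addrC -lerBrDr.
  rewrite -(ler_nat F); apply: le_trans (ltW (archi_boundP _)); last by rewrite divr_ge0 // ltW.
  by rewrite ler_pdivlMr // mulrC mulr_natr.
apply: lspan_min => [|a x y|i]; [exact: weight_space0|exact: weight_spaceP|].
rewrite size_map => hi; rewrite (nth_map [::]) //.
have := mem_nth [::] hi; rewrite mem_filter => /andP [/andP [hs /eqP hnu] _].
by have := word_weight hs; rewrite hnu.
Qed.

Lemma wdim_eq0 (nu : weight h) : ht Lam < ht nu -> wdim M nu = 0%N.
Proof.
move=> hlt; have [b [hb bi]] := weight_space_dim nu.
case En: (wdim M nu) b hb bi => [|n] // b hb bi.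
have b0 : b ord0 = 0.
  apply: contrapT => /(weight_space_ht (nu := nu)) hw; move: hlt; rewrite ltNge hw //.
  apply/hb; exists (fun i => (i == ord0)%:R); rewrite (bigD1 ord0) //= scale1r.
  by rewrite big1 ?addr0 // => i /negPf ->; rewrite scale0r.
have := bi (fun i => (i == ord0)%:R); rewrite (bigD1 ord0) //= b0 scaler0 add0r big1.
  by move=> /(_ erefl ord0) /eqP; rewrite eqxx oner_eq0.
by move=> i /negPf ->; rewrite scale0r.
Qed.

End HighestWeight.
End Representation.

(** * Freudenthal's formula *)

Section Trace.
Variables (K : fieldType) (g : superalgebra K) (h : {vspace g}) (M : representation g).
Local Notation W := (@weight_space K g h M).
Local Notation d := (@wdim K g h M).
Hypothesis fin_dim : forall nu, has_dim (W nu) (d nu).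

Definition wbasis nu : 'I_(d nu) -> M := sval (cid (fin_dim nu)).

Lemma wbasis_free nu (c : 'I_(d nu) -> K) : \sum_i c i *: wbasis i = 0 -> forall i, c i = 0.
Proof. by rewrite /wbasis; case: cid => b [hb bi] /=; apply: bi. Qed.

Lemma wbasis_in nu (i : 'I_(d nu)) : W nu (wbasis i).
Proof.
rewrite /wbasis; case: cid => b [hb bi] /=; apply/hb; exists (fun j => (j == i)%:R).
by rewrite (bigD1 i) //= eqxx scale1r big1 ?addr0 // => j /negPf ->; rewrite scale0r.
Qed.

(** The membership hypothesis sits inside the existential so that the coordinates become a total
    function of [u]; outside [W nu] they are arbitrary. *)
Lemma wcoord_ex nu u : exists c : 'I_(d nu) -> K, W nu u -> u = \sum_i c i *: wbasis i.
Proof.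
have [hu|hu] := pselect (W nu u); last by exists (fun=> 0).
suff [c Ec] : exists c : 'I_(d nu) -> K, u = \sum_i c i *: wbasis i by exists c.
by move: hu; rewrite {1}/wbasis; case: cid => b [hb bi] /= /hb.
Qed.

Definition wcoord nu u : 'I_(d nu) -> K := sval (cid (wcoord_ex nu u)).
Arguments wcoord : clear implicits.

Lemma wcoordE nu u : W nu u -> u = \sum_i wcoord nu u i *: wbasis i.
Proof. by rewrite /wcoord; case: cid. Qed.

Lemma wcoord_uniq nu u (c : 'I_(d nu) -> K) : W nu u -> u = \sum_i c i *: wbasis i ->
  wcoord nu u =1 c.
Proof.
move=> hu Eu i; apply/eqP; rewrite -subr_eq0; apply/eqP.
apply: (wbasis_free (c := fun i => wcoord nu u i - c i)).
under eq_bigr do rewrite scalerBl.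
by rewrite sumrB -wcoordE // -Eu subrr.
Qed.

Lemma wcoordP nu a u w i : W nu u -> W nu w ->
  wcoord nu (a *: u + w) i = a * wcoord nu u i + wcoord nu w i.
Proof.
move=> hu hw.
rewrite (@wcoord_uniq nu _ (fun i => a * wcoord nu u i + wcoord nu w i)) //.
  exact: weight_spaceP.
rewrite {1}(wcoordE hu) {1}(wcoordE hw) scaler_sumr -big_split /=.
by apply: eq_bigr => j _; rewrite scalerDl scalerA.
Qed.

Lemma wcoord_basis nu (i j : 'I_(d nu)) : wcoord nu (wbasis i) j = (j == i)%:R.
Proof.
rewrite (@wcoord_uniq nu _ (fun j => (j == i)%:R)) //; first exact: wbasis_in.
by rewrite (bigD1 i) //= eqxx scale1r big1 ?addr0 // => k /negPf ->; rewrite scale0r.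
Qed.

(** Defined for any function [T]; it is the trace of [T] on [W nu] when [T] is linear and maps
    [W nu] to itself. *)
Definition wtrace nu (T : M -> M) : K := \sum_i wcoord nu (T (wbasis i)) i.

Lemma wtrace_ext nu T T' : (forall u, W nu u -> T u = T' u) -> wtrace nu T = wtrace nu T'.
Proof. by move=> E; apply: eq_bigr => i _; rewrite E //; apply: wbasis_in. Qed.

Lemma wtraceP nu a T T' : (forall u, W nu u -> W nu (T u)) -> (forall u, W nu u -> W nu (T' u)) ->
  wtrace nu (fun u => a *: T u + T' u) = a * wtrace nu T + wtrace nu T'.
Proof.
move=> hT hT'; rewrite /wtrace mulr_sumr -big_split; apply: eq_bigr => i _.
by apply: wcoordP; [apply: hT | apply: hT']; apply: wbasis_in.
Qed.

Lemma wtrace_id nu : wtrace nu id = (d nu)%:R.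
Proof.
rewrite /wtrace (eq_bigr (fun=> 1)); last by move=> i _; rewrite wcoord_basis eqxx.
by rewrite sumr_const card_ord.
Qed.

Lemma wtrace0 nu : wtrace nu (fun=> 0) = 0.
Proof.
have h0 : forall u, W nu u -> W nu ((fun=> 0) u) by move=> *; apply: weight_space0.
have := wtraceP (-1) h0 h0; rewrite mulN1r addNr => <-.
by apply: wtrace_ext => u _; rewrite scaler0 addr0.
Qed.

Lemma wtrace_scalar nu c : c * wtrace nu id = wtrace nu (fun u => c *: u).
Proof.
rewrite -[LHS]addr0 -[X in _ + X](wtrace0 nu) -wtraceP //.
  by apply: wtrace_ext => u _; rewrite addr0.
by move=> u _; apply: weight_space0.
Qed.

Lemma wtrace_sum nu (I : eqType) (r : seq I) (T : I -> M -> M) :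
  (forall i, i \in r -> forall u, W nu u -> W nu (T i u)) ->
  wtrace nu (fun u => \sum_(i <- r) T i u) = \sum_(i <- r) wtrace nu (T i).
Proof.
have WD (s : seq I) : (forall i, i \in s -> forall u, W nu u -> W nu (T i u)) ->
    forall u, W nu u -> W nu (\sum_(i <- s) T i u).
  move=> hs u hu; rewrite big_seq; apply: big_ind.
  - exact: weight_space0.
  - by move=> x y hx hy; rewrite -[x]scale1r; apply: weight_spaceP.
  - by move=> i /hs; apply.
elim: r => [|i r IH] hT.
  by rewrite big_nil -[RHS](wtrace0 nu); apply: wtrace_ext => u _; rewrite big_nil.
have hr : forall j, j \in r -> forall u, W nu u -> W nu (T j u).
  by move=> j hj; apply: hT; rewrite in_cons hj orbT.
rewrite big_cons -IH // -[wtrace nu (T i)]mul1r -wtraceP.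
- by apply: wtrace_ext => u _; rewrite big_cons scale1r.
- by apply: hT; rewrite mem_head.
- exact: WD.
Qed.

(** Both traces are the same double sum over the matrix entries of [S] and [T] between the two
    weight spaces. Odd maps bring in no sign because this is the trace and not the supertrace. *)
Lemma wtraceC nu nu' (S T : M -> M) : linear T -> linear S ->
  (forall u, W nu u -> W nu' (S u)) -> (forall u, W nu' u -> W nu (T u)) ->
  wtrace nu (T \o S) = wtrace nu' (S \o T).
Proof.
have E ka ka' (P Q : M -> M) : linear Q -> (forall u, W ka u -> W ka' (P u)) ->
    (forall u, W ka' u -> W ka (Q u)) ->
    wtrace ka (Q \o P) = \sum_i \sum_k wcoord ka' (P (wbasis i)) k * wcoord ka (Q (wbasis k)) i.
  move=> lQ hP hQ; apply: eq_bigr => i _; rewrite /=.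
  pose QL : {linear M -> M} := HB.pack Q (GRing.isLinear.Build K M M *:%R _ lQ).
  rewrite (@wcoord_uniq ka _ (fun j => \sum_k wcoord ka' (P (wbasis i)) k * wcoord ka (Q (wbasis k)) j)) //.
    by apply: hQ; apply: hP; apply: wbasis_in.
  rewrite {1}(wcoordE (hP _ (wbasis_in i))) -[Q _]/(QL _) linear_sum /=.
  rewrite (eq_bigr (fun k => \sum_j (wcoord ka' (P (wbasis i)) k * wcoord ka (Q (wbasis k)) j) *: wbasis j)).
    by rewrite exchange_big; apply: eq_bigr => j _; rewrite scaler_suml.
  move=> k _; rewrite -[Q _]/(QL _) linearZ_LR /= {1}(wcoordE (hQ _ (wbasis_in k))) scaler_sumr.
  by apply: eq_bigr => j _; rewrite scalerA.
move=> lT lS hS hT; rewrite (E nu nu' S T) // (E nu' nu T S) // exchange_big.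
by apply: eq_bigr => i _; apply: eq_bigr => k _; rewrite mulrC.
Qed.

End Trace.

(** * The Casimir eigenvalue and the recursion along root strings *)

Section Freudenthal.
Variables (K : fieldType) (g : superalgebra K) (form : g -> g -> K) (h : {vspace g}).
Hypothesis bs : basic_structure form h.
Local Notation br := (sa_br g).
Local Notation part := (sa_part g).
Local Notation dform := (@dual_form K g h form).
Variable M : representation g.
Local Notation act := (rep_act M).
Variables (pos : seq (weight h)) (par : weight h -> bool).
Hypothesis pos_uniq : uniq pos.
Hypothesis pos_root : forall al, al \in pos -> is_root (par al) al.
Hypothesis pos_total : forall p al, is_root p al -> al \in pos \/ - al \in pos.
Variables (F : archiRealFieldType) (ht : weight h -> F).
Hypothesis htD : forall al be, ht (al + be) = ht al + ht be.
Hypothesis ht_pos : forall al, al \in pos -> 0 < ht al.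
Variables (Lam : weight h) (v : M).
Hypothesis v_weight : weight_space M Lam v.
Hypothesis v_killed : forall al x, al \in pos -> x \in rootspace al -> act x v = 0.
Hypothesis v_gen : generates v.

Lemma ht_muln al k : ht (al *+ k) = ht al *+ k.
Proof. by elim: k => [|k IH]; rewrite ?(ht0 htD) // !mulrS htD IH. Qed.

(** Each step by [al] raises the height by a fixed positive amount, so the string eventually passes
    above [Lam]. *)
Lemma wdim_vanish (al mu : weight h) : al \in pos ->
  exists N, forall k, (N <= k)%N -> wdim M (mu + al *+ k) = 0%N.
Proof.
move=> ha; have [e [f ef]] := root_vectors_ex bs pos_root.
pose N := Num.Def.archi_bound (`|ht Lam - ht mu| / ht al); exists N => k hk.
apply: (wdim_eq0 bs pos_uniq pos_total htD ht_pos v_weight v_killed v_gen ef).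
have a0 := ht_pos ha.
rewrite htD ht_muln -ltrBlDl; apply: le_lt_trans (ler_norm _) _.
rewrite -mulr_natl -ltr_pdivrMr //; apply: lt_le_trans (archi_boundP _) _.
  by rewrite divr_ge0 // ltW.
by rewrite ler_nat.
Qed.

(** This is (nu + 2 rho, nu), as 2 rho is the sum of the positive roots with sign -1 at the odd
    ones. *)
Definition casimir_value (nu : weight h) : K :=
  dform nu nu + \sum_(al <- pos) (-1) ^+ par al * dform nu al.

Lemma super_freudenthal (mu : weight h) :
  casimir_value Lam * (wdim M mu)%:R = casimir_value mu * (wdim M mu)%:R +
  2%:R * \sum_(al <- pos) \sum_(k \in [set k : nat | (1 <= k)%N]%classic)
     (-1) ^+ ((k + 1) * par al) * dform (mu + al *+ k) al * (wdim M (mu + al *+ k))%:R.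
Proof.
have [e [f ef]] := root_vectors_ex bs pos_root.
have fin_dim := weight_space_dim bs pos_uniq pos_total htD ht_pos v_weight v_killed v_gen ef.
have padd := pos_add htD ht_pos.
have [s [sh sl sr]] := cartan_dual_pairs bs.
pose cas := casimir_pairs pos par e f s.
have casl := casimir_l bs pos_uniq pos_total padd ef sh sl.
have casr := casimir_r bs pos_uniq pos_total padd ef sh sr.
have casp := casimir_pairs_part bs ef sh.
have eW al nu u : al \in pos -> weight_space M nu u -> weight_space M (nu + al) (act (e al) u).
  by move=> ha; apply: (ract_weight bs (root_e ef ha)).
have fW al nu u : al \in pos -> weight_space M nu u -> weight_space M (nu - al) (act (f al) u).
  by move=> ha; apply: (ract_weight bs (root_f ef ha)).
have efE al nu u : al \in pos -> weight_space M nu u ->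
    act (e al) (act (f al) u) = (-1) ^+ par al *: act (f al) (act (e al) u) + dform nu al *: u.
  move=> ha hu; have [ep fp _ _ ef1] := ef al ha.
  have := rep_act_br u ep fp; rewrite andbb.
  rewrite (br_root_pair bs (root_e ef ha) (root_f ef ha) ef1) hu => E.
  by rewrite (dual_formE bs) E addrC subrK.
(* The pair (f al, (-1)^p e al) contributes (-1)^p e f = f e + (-1)^p (nu, al), whence the factor 2
   and the shift by 2 rho. *)
have casE nu u : weight_space M nu u -> casimir cas u = casimir_value nu *: u +
    2%:R *: \sum_(al <- pos) act (f al) (act (e al) u).
  move=> hu; rewrite /casimir /cas /casimir_pairs !big_cat !big_map /=.
  (* The Cartan part is the sum of nu(x) nu(y) over dual bases, which becomes (nu, nu) on expanding
     the element of [h] that represents [nu]. *)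
  have -> : \sum_(xy <- s) act xy.2 (act xy.1 u) = dform nu nu *: u.
    have hx x : x \in h -> act x u = form (vsval (coroot form nu)) x *: u.
      move=> xh; rewrite -(vsprojK xh) hu -(form_coroot bs).
      by [].
    rewrite (eq_big_seq (fun xy => (form (vsval (coroot form nu)) xy.2 *
        form (vsval (coroot form nu)) xy.1) *: u)); last first.
      by move=> xy /sh [h1 h2]; rewrite hx // ractZr hx // scalerA mulrC.
    rewrite -scaler_suml; congr (_ *: _); rewrite /dual_form -/(coroot form nu).
    rewrite [X in _ = form _ X](sl _ (subvsP _)) (form_sumr bs).
    by apply: eq_bigr => xy _; rewrite (formZr bs).
  rewrite -big_split /= /casimir_value scalerDl -addrA; congr (_ + _).
  rewrite scaler_suml scaler_sumr -big_split /=; apply: eq_big_seq => al ha.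
  rewrite ractZl (efE al nu) // scalerDr !scalerA -expr2 sqrr_sign scale1r.
  by rewrite scaler_nat mulr2n addrA addrC.
(* The vectors on which the Casimir operator has this eigenvalue form a submodule containing [v]. *)
have casLam (u : M) : casimir cas u = casimir_value Lam *: u.
  apply: (v_gen (S := fun u => casimir cas u = casimir_value Lam *: u)) u.
  - by move=> a u w hu hw; rewrite casimir_lin hu hw scalerDr !scalerA mulrC.
  - by move=> x u hu; rewrite -(casimir_comm bs casp casl casr) hu ractZr.
  rewrite (casE _ _ v_weight) big1_seq ?scaler0 ?addr0 // => al /= ha.
  by rewrite (v_killed ha (root_e ef ha)) ract0r.
pose tr := wtrace fin_dim.
have trE : casimir_value Lam * (wdim M mu)%:R = casimir_value mu * (wdim M mu)%:R +
    2%:R * \sum_(al <- pos) tr mu (act (f al) \o act (e al)).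
  have feW al u : al \in pos -> weight_space M mu u ->
      weight_space M mu ((act (f al) \o act (e al)) u).
    by move=> ha /(eW _ _ _ ha) /(fW _ _ _ ha); rewrite addrK.
  have sW u : weight_space M mu u ->
      weight_space M mu (\sum_(al <- pos) (act (f al) \o act (e al)) u).
    move=> hu; rewrite big_seq; apply: big_ind; first exact: weight_space0.
      by move=> x y hx hy; rewrite -[x]scale1r; apply: weight_spaceP.
    by move=> al ha; apply: feW.
  rewrite -wtrace_sum; last by move=> al ha u; apply: feW.
  rewrite -!(wtrace_id fin_dim).
  rewrite wtrace_scalar [RHS]addrC wtrace_scalar -wtraceP //; last first.
    by move=> u hu; rewrite -[_ *: _]addr0; apply: weight_spaceP => //; apply: weight_space0.
  by apply: wtrace_ext => u hu; rewrite -casLam (casE _ _ hu) addrC.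
rewrite trE; congr (_ + _ * _); apply: eq_big_seq => al ha.
have [N hN] := wdim_vanish mu ha.
pose T k := (-1) ^+ ((k + 1) * par al) * dform (mu + al *+ k) al * (wdim M (mu + al *+ k))%:R.
(* The trace of f e on M^(mu + k al) is that of e f on the next weight space, where the commutation
   relation applies with nu = mu + (k+1) al. *)
have step k : tr (mu + al *+ k) (act (f al) \o act (e al)) =
    (-1) ^+ par al * tr (mu + al *+ k.+1) (act (f al) \o act (e al)) +
    dform (mu + al *+ k.+1) al * (wdim M (mu + al *+ k.+1))%:R.
  have Ek : mu + al *+ k.+1 = mu + al *+ k + al by rewrite mulrSr addrA.
  rewrite /tr (@wtraceC _ _ _ _ fin_dim _ (mu + al *+ k.+1)) ?Ek.
  - rewrite -(wtrace_id fin_dim); set ka := _ + _ + al.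
    rewrite wtrace_scalar -wtraceP //; first by apply: wtrace_ext => u hu /=; apply: efE.
      by move=> u hu /=; have := fW _ _ _ ha (eW _ _ _ ha hu); rewrite addrK.
    by move=> u hu; rewrite -[_ *: _]addr0; apply: weight_spaceP => //; apply: weight_space0.
  - exact: ract_lin.
  - exact: ract_lin.
  - by move=> u; apply: eW.
  - by move=> u hu; have := fW _ _ _ ha hu; rewrite addrK.
(* The recursion unrolled [n] times, with its remainder. *)
have trS n : tr mu (act (f al) \o act (e al)) = \sum_(1 <= k < n.+1) T k +
    (-1) ^+ (n * par al) * tr (mu + al *+ n) (act (f al) \o act (e al)).
  elim: n => [|n IH]; first by rewrite big_geq // add0r mul1r mulr0n addr0.
  rewrite big_nat_recr //= IH step -addrA; congr (_ + _).
  (* Unrolling produces the exponent k - 1 where the formula has k + 1. *)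
  have E2 : (-1) ^+ ((n.+1 + 1) * par al) = (-1) ^+ (n * par al) :> K.
    by rewrite addn1 !mulSn !exprD mulrA -expr2 sqrr_sign mul1r.
  by rewrite /T E2 mulrDr addrC !mulrA -exprD -mulSnr.
(* The weight space at mu + N al is zero, so the trace in the remainder is an empty sum. *)
rewrite (trS N); have -> : tr (mu + al *+ N) (act (f al) \o act (e al)) = 0.
  rewrite /tr /wtrace big1 // => i; exfalso; have := ltn_ord i.
  by rewrite [X in (_ < X)%N](hN N (leqnn N)).
(* The sum over all k >= 1 is supported in 1, ..., N, since d vanishes from mu + N al onwards. *)
rewrite mulr0 addr0 (@fsbigE _ _ _ _ _ (index_iota 1 N.+1)) ?iota_uniq //.
- rewrite [RHS]big_seq_cond big_seq; apply: eq_bigl => k.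
  rewrite mem_index_iota; apply/idP/idP => [H|/andP [] //]; rewrite H /=.
  by case/andP: H => k1 _; apply: mem_set.
- by move=> k /=; rewrite mem_index_iota => /andP [].
move=> k /= k1; rewrite mem_index_iota k1 /= ltnS -ltnNge => Nk.
by rewrite hN ?mulr0 // ltnW.
Qed.

End Freudenthal.

(** * From a positive system to the abstract hypotheses *)

Section BasicData.
Variables (R : realType) (D : basic_data R).
Hypothesis bs : basic_structure (bd_form D) (bd_cartan D).
Hypothesis pos0_uniq : uniq (bd_pos0 D).
Local Notation h := (bd_cartan D).

(** The regular element that cuts out the positive system provides the height, and its sign on each
    root decides between [al] and [- al]. *)
Lemma freudenthal_basic_data (pos1 : seq (weight h)) (M : representation (bd_alg D))
    (Lam mu : weight h) :
  positive_system pos1 -> highest_weight_rep pos1 M Lam ->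
  let form := dual_form (bd_form D) in
  let d := wdim M in
  let rh := rho pos1 in
  let p := fun al : weight (bd_cartan D) => (al \in pos1 : nat) in
  (- form (Lam + rh *+ 2) Lam + form (mu + rh *+ 2) mu) * (d mu)%:R =
  - 2%:R * \sum_(al <- bd_pos0 D ++ pos1)
      \sum_(k \in [set k : nat | (1 <= k)%N]%classic)
        (-1) ^+ ((k + 1) * p al) * form (mu + al *+ k) al * (d (mu + al *+ k))%:R.
Proof.
move=> [pos1_uniq [H [Hreg Hpos]]] [v [v0 _ vwt vkill vgen]] /=.
pose pos := bd_pos0 D ++ pos1; pose par (al : weight h) := al \in pos1.
have pos0E (al : weight h) : (al \in bd_pos0 D) = is_root false al && ((0 : R[i]) < al H).
  exact: (Hpos false).
have pos1E (al : weight h) : (al \in pos1) = is_root true al && ((0 : R[i]) < al H).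
  exact: (Hpos true).
(* Root spaces are homogeneous lines, so no functional is both an even and an odd root; on positive
   roots, membership in [pos1] is therefore the parity. *)
have disj al : al \in bd_pos0 D -> al \in pos1 -> False.
  by rewrite pos0E pos1E => /andP [r0 _] /andP [r1 _]; apply: (root_parity_disj bs r0 r1).
have pos_uniq : uniq pos.
  rewrite cat_uniq pos0_uniq pos1_uniq /= andbT; apply/hasPn => al h1.
  by apply/negP => h0; apply: (disj al).
have pos_root al : al \in pos -> is_root (par al) al.
  rewrite mem_cat /par; case: (boolP (al \in pos1)) => [|n1].
    by rewrite pos1E => /andP [].
  by rewrite orbF pos0E => /andP [].
have root_pos p (al : weight h) : is_root p al -> (0 : R[i]) < al H -> al \in pos.
  by move=> ral aH; rewrite mem_cat pos0E pos1E aH !andbT; case: p ral => ->; rewrite ?orbT.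
have pos_total p (al : weight h) : is_root p al -> al \in pos \/ - al \in pos.
  move=> ral; case/orP: (Hreg p al ral) => aH; [left|right]; first exact: root_pos ral aH.
  by apply: root_pos (root_opp bs ral) _; rewrite lfunE /= oppr_gt0.
(* [H] is real on roots, but [Lam] and [mu] are arbitrary functionals; the real part is additive on
   all of them. *)
pose ht (al : weight h) : R := complex.Re (al H).
have htD (al be : weight h) : ht (al + be) = ht al + ht be.
  by rewrite /ht lfunE /=; case: (al H) (be H) => [a b] [c d].
have ht_pos al : al \in pos -> 0 < ht al.
  rewrite mem_cat pos0E pos1E /ht => /orP [] /andP [_]; by rewrite ltcE /= => /andP [].
have main := super_freudenthal bs pos_uniq pos_root pos_total htD ht_pos vwt vkill vgen mu.
have cE (nu : weight h) : dual_form (bd_form D) (nu + rho pos1 *+ 2) nu =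
    casimir_value (bd_form D) pos par nu.
  rewrite (dual_formDl bs) /casimir_value; congr (_ + _).
  have -> : rho pos1 *+ 2 = \sum_(al <- bd_pos0 D) al + (-1 : R[i]) *: \sum_(al <- pos1) al.
    have two : 2%:R * 2%:R^-1 = 1 :> R[i] by apply: mulfV; rewrite pnatr_eq0.
    rewrite /rho mulrnBl -[X in X - _ = _]scaler_nat -[X in _ - X = _]scaler_nat !scalerA two.
    by rewrite scale1r scale1r scaleN1r.
  rewrite (dual_formDl bs) (dual_formZl bs) !(dual_form_suml bs) big_cat /= mulr_sumr.
  congr (_ + _); apply: eq_big_seq => al ha; rewrite /par (dual_formC bs al nu).
    have -> : (al \in pos1) = false by apply/negP => h1; case: (disj al).
    by rewrite expr0 mul1r.
  by rewrite ha expr1.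
have fin (K : fieldType) (a b d S : K) :
    a * d = b * d + 2%:R * S -> (- a + b) * d = - 2%:R * S.
  move=> E; have -> : (- a + b) * d = b * d - a * d by ring.
  by rewrite E; ring.
by rewrite !cE; apply: fin.
Qed.

End BasicData.

(** * Matrix superalgebras *)

Section MatrixSuperalgebra.
Variable C : fieldType.
Variables m n : nat.
Local Notation mat := 'M[C]_(m + n).
Implicit Types X Y Z : mat.

(* Copies of the matrix constructions over an arbitrary field. Over R[i] the
   unifier unfolds the complex numbers whenever it compares 1 with -1, so all
   computations are done here and specialized to R[i] at the end. *)
Definition gmx_part (p : bool) (X : 'M[C]_(m + n)) : 'M[C]_(m + n) :=
  if p then block_mx 0 (ursubmx X) (dlsubmx X) 0
  else block_mx (ulsubmx X) 0 0 (drsubmx X).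
#[local] Arguments gmx_part : simpl never.

Definition gsupertrace (X : 'M[C]_(m + n)) : C := \tr (ulsubmx X) - \tr (drsubmx X).

Definition gsuperbracket (X Y : 'M[C]_(m + n)) : 'M[C]_(m + n) :=
  \sum_(p : bool) \sum_(q : bool)
    (gmx_part p X *m gmx_part q Y - (-1) ^+ (p && q) *: (gmx_part q Y *m gmx_part p X)).

Definition gmx_superalgebra (g : {vspace 'M[C]_(m + n)}) : superalgebra C :=
  @SuperAlgebra C (subvs_of g)
    (fun p => lker (linfun (fun X : subvs_of g => gmx_part (~~ p) (vsval X))))
    (fun X Y : subvs_of g => vsproj g (gsuperbracket (vsval X) (vsval Y))).

Definition gmx_cartan (g t : {vspace 'M[C]_(m + n)}) : {vspace gmx_superalgebra g} :=
  (linfun (vsval : subvs_of g -> _) @^-1: t)%VS.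

Definition gstr_form (c : C) (g : {vspace 'M[C]_(m + n)}) (X Y : gmx_superalgebra g) : C :=
  c * gsupertrace (vsval X *m vsval Y).

Definition mxhom (p : bool) X := gmx_part p X = X.

Lemma mx_part_lin p : linear (@gmx_part p).
Proof.
move=> a X Y; rewrite -{1}[X]submxK -{1}[Y]submxK scale_block_mx add_block_mx /gmx_part.
by case: p; rewrite ?block_mxKul ?block_mxKur ?block_mxKdl ?block_mxKdr scale_block_mx
  add_block_mx !scaler0 !addr0.
Qed.

Lemma mx_partD p X Y : gmx_part p (X + Y) = gmx_part p X + gmx_part p Y.
Proof. by have := mx_part_lin p 1 X Y; rewrite !scale1r. Qed.
Lemma mx_part0 p : gmx_part p (0 : mat) = 0.
Proof. by apply: (addIr (gmx_part p 0)); rewrite -mx_partD !add0r. Qed.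
Lemma mx_partZ p a X : gmx_part p (a *: X) = a *: gmx_part p X.
Proof. by have := mx_part_lin p a X 0; rewrite mx_part0 !addr0. Qed.

Lemma mx_part_sum X : gmx_part false X + gmx_part true X = X.
Proof.
by rewrite /gmx_part add_block_mx !addr0 !add0r submxK.
Qed.

Lemma mx_part_part p q X : gmx_part p (gmx_part q X) = if p == q then gmx_part p X else 0.
Proof.
by rewrite /gmx_part; case: p; case: q => /=;
  rewrite ?block_mxKul ?block_mxKur ?block_mxKdl ?block_mxKdr // block_mx_const.
Qed.

Lemma mxhom_part p X : mxhom p (gmx_part p X).
Proof. by rewrite /mxhom mx_part_part eqxx. Qed.

Lemma mxhomN p X : mxhom p X -> gmx_part (~~ p) X = 0.
Proof. by move=> <-; rewrite mx_part_part; case: p. Qed.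

Lemma mxhomE p X : gmx_part (~~ p) X = 0 <-> mxhom p X.
Proof.
split=> [E|/mxhomN //]; rewrite /mxhom -[RHS]mx_part_sum.
by case: p E => /= ->; rewrite ?addr0 ?add0r.
Qed.

Lemma mxhomP p a X Y : mxhom p X -> mxhom p Y -> mxhom p (a *: X + Y).
Proof. by rewrite /mxhom mx_part_lin => -> ->. Qed.

Lemma mxhom_block p X : mxhom p X -> X = if p then block_mx 0 (ursubmx X) (dlsubmx X) 0
  else block_mx (ulsubmx X) 0 0 (drsubmx X).
Proof. by []. Qed.

Lemma mxhomM p q X Y : mxhom p X -> mxhom q Y -> mxhom (p (+) q) (X *m Y).
Proof.
move=> /esym -> /esym ->; rewrite /mxhom /gmx_part; case: p; case: q => /=;
  by rewrite mulmx_block !mul0mx !mulmx0 ?addr0 ?add0r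
    ?block_mxKul ?block_mxKur ?block_mxKdl ?block_mxKdr.
Qed.

Lemma superbracket_hom p q X Y : mxhom p X -> mxhom q Y ->
  gsuperbracket X Y = X *m Y - (-1) ^+ (p && q) *: (Y *m X).
Proof.
move=> hX hY; have hX' := mxhomN hX; have hY' := mxhomN hY.
rewrite /gsuperbracket !big_bool /=.
case: p hX hX' => /= hX hX'; case: q hY hY' => /= hY hY'; rewrite hX hX' hY hY';
  by rewrite ?mul0mx ?mulmx0 ?scaler0 ?subr0 ?addr0 ?add0r.
Qed.

Lemma superbracket_linl Z : linear (fun X => gsuperbracket X Z).
Proof.
move=> a X Y; rewrite /gsuperbracket scaler_sumr -big_split /=; apply: eq_bigr => p _.
rewrite scaler_sumr -big_split /=; apply: eq_bigr => q _.
rewrite mx_part_lin mulmxDl mulmxDr -!scalemxAl -!scalemxAr scalerDr scalerBr.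
by rewrite opprD addrACA !scalerA mulrC.
Qed.

Lemma superbracket_linr Z : linear (gsuperbracket Z : mat -> mat).
Proof.
move=> a X Y; rewrite /gsuperbracket scaler_sumr -big_split /=; apply: eq_bigr => p _.
rewrite scaler_sumr -big_split /=; apply: eq_bigr => q _.
rewrite mx_part_lin mulmxDl mulmxDr -!scalemxAl -!scalemxAr scalerDr scalerBr.
by rewrite opprD addrACA !scalerA mulrC.
Qed.

Lemma superbracketDl X Y Z : gsuperbracket (X + Y) Z = gsuperbracket X Z + gsuperbracket Y Z.
Proof. by have := superbracket_linl Z 1 X Y; rewrite !scale1r. Qed.
Lemma superbracketDr X Y Z : gsuperbracket Z (X + Y) = gsuperbracket Z X + gsuperbracket Z Y.
Proof. by have := superbracket_linr Z 1 X Y; rewrite !scale1r. Qed.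

Lemma superbracketNl X Z : gsuperbracket (- X) Z = - gsuperbracket X Z.
Proof.
have z : gsuperbracket 0 Z = 0 by apply: (addIr (gsuperbracket 0 Z)); rewrite -superbracketDl !add0r.
by apply/eqP; rewrite -addr_eq0 -superbracketDl addNr z.
Qed.
Lemma superbracketNr X Z : gsuperbracket Z (- X) = - gsuperbracket Z X.
Proof.
have z : gsuperbracket Z 0 = 0 by apply: (addIr (gsuperbracket Z 0)); rewrite -superbracketDr !add0r.
by apply/eqP; rewrite -addr_eq0 -superbracketDr addNr z.
Qed.

Lemma mxpart_ind (P : mat -> Prop) : (forall p X, mxhom p X -> P X) ->
  (forall X Y, P X -> P Y -> P (X + Y)) -> forall X, P X.
Proof.
by move=> hP hD X; rewrite -(mx_part_sum X); apply: hD; apply: hP; apply: mxhom_part.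
Qed.

Lemma supertrace_lin : linear (gsupertrace : mat -> C^o).
Proof.
move=> a X Y; rewrite -{1}[X]submxK -{1}[Y]submxK scale_block_mx add_block_mx /gsupertrace.
by rewrite block_mxKul block_mxKdr !mxtraceD !mxtraceZ opprD addrACA -mulrBr.
Qed.
Lemma supertraceD X Y : gsupertrace (X + Y) = gsupertrace X + gsupertrace Y.
Proof. by have := supertrace_lin 1 X Y; rewrite !scale1r. Qed.
Lemma supertraceZ a X : gsupertrace (a *: X) = a * gsupertrace X.
Proof.
have s0 : gsupertrace (0 : mat) = 0 by apply: (addIr (gsupertrace (0 : mat))); rewrite -supertraceD !add0r.
by have := supertrace_lin a X 0; rewrite s0 !addr0.
Qed.

Lemma supertraceN X : gsupertrace (- X) = - gsupertrace X.
Proof. by rewrite -scaleN1r supertraceZ mulN1r. Qed.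

Lemma supertrace_odd X : mxhom true X -> gsupertrace X = 0.
Proof.
by move=> <-; rewrite /gsupertrace /gmx_part block_mxKul block_mxKdr !mxtrace0 subrr.
Qed.

(** A product of matrices of different parities is odd and has supertrace zero. For two odd matrices
    cyclicity exchanges the two diagonal blocks, which gives the sign; for two even ones it acts
    within each block. *)
Lemma supertraceC p q X Y : mxhom p X -> mxhom q Y ->
  gsupertrace (X *m Y) = (-1) ^+ (p && q) * gsupertrace (Y *m X).
Proof.
have [<-{q}|] := eqVneq p q; last first.
  move=> pq hX hY; rewrite !supertrace_odd ?mulr0 //.
    by have := mxhomM hY hX; case: (p) (q) pq => [] [].
  by have := mxhomM hX hY; case: (p) (q) pq => [] [].
move=> hX hY; rewrite (mxhom_block hX) (mxhom_block hY) andbb.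
case: p hX hY => hX hY; rewrite !mulmx_block !mul0mx !mulmx0 ?addr0 ?add0r /gsupertrace
    !block_mxKul !block_mxKdr.
  by rewrite mxtrace_mulC [X in _ - X]mxtrace_mulC expr1 mulN1r opprB.
by rewrite mxtrace_mulC [X in _ - X]mxtrace_mulC mul1r.
Qed.

(** Both sides contain the supertrace of XYZ; the remaining terms agree by moving Y cyclically. *)
Lemma supertrace_bracket X Y Z :
  gsupertrace (gsuperbracket X Y *m Z) = gsupertrace (X *m gsuperbracket Y Z).
Proof.
elim/mxpart_ind: X => [p X hX|X X' hX hX']; last by rewrite superbracketDl !mulmxDl !supertraceD hX hX'.
elim/mxpart_ind: Y => [q Y hY|Y Y' hY hY']; last first.
  by rewrite superbracketDr superbracketDl mulmxDl mulmxDr !supertraceD hY hY'.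
elim/mxpart_ind: Z => [r Z hZ|Z Z' hZ hZ']; last first.
  by rewrite superbracketDr !mulmxDr !supertraceD hZ hZ'.
rewrite (superbracket_hom hX hY) (superbracket_hom hY hZ) -!scaleNr.
rewrite mulmxDl mulmxDr !supertraceD -scalemxAl -scalemxAr !supertraceZ mulmxA; congr (_ + _).
rewrite -mulmxA (supertraceC hY (mxhomM hX hZ)) !mulNr mulrA -exprD mulmxA; congr (- (_ * _)).
by case: (p); case: (q); case: (r); rewrite /= ?expr0 ?expr1 // expr2 mulrNN mulr1.
Qed.

Variables (g t : {vspace 'M[C]_(m + n)}) (c : C).
Hypothesis c_neq0 : c != 0.
Hypothesis g_part : forall p X, X \in g -> gmx_part p X \in g.
Hypothesis g_bracket : forall X Y, X \in g -> Y \in g -> gsuperbracket X Y \in g.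
Hypothesis t_even : forall T, T \in t -> mxhom false T.
Hypothesis t_comm : forall T T', T \in t -> T' \in t -> T *m T' = T' *m T.
Hypothesis g_nondeg : forall X, X \in g ->
  (forall Y, Y \in g -> gsupertrace (X *m Y) = 0) -> X = 0.
Local Notation h := (gmx_cartan g t).
Local Notation gl := (gmx_superalgebra g).

Lemma vsval_bracket (x y : gl) : vsval (sa_br gl x y) = gsuperbracket (vsval x) (vsval y).
Proof. by rewrite /= vsprojK // g_bracket ?subvsP. Qed.

Lemma mem_mx_part p (x : gl) : (x \in sa_part gl p) <-> mxhom p (vsval x).
Proof.
rewrite memv_ker linfun_linearE; last by move=> a y z /=; rewrite mx_part_lin.
by rewrite -mxhomE; split=> [/eqP|->].
Qed.

Lemma mem_mx_cartan (x : gl) : (x \in h) = (vsval x \in t).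
Proof.
rewrite /gmx_cartan -memv_preim linfun_linearE //.
Qed.

Variables (I : finType) (w : I -> mat) (wt : I -> weight h) (par : I -> bool).
Hypothesis w_in : forall i, w i \in g.
Hypothesis w_par : forall i, mxhom (par i) (w i).
Hypothesis w_wt : forall i (T : subvs_of h), 
  vsval (vsval T) *m w i - w i *m vsval (vsval T) = (wt i T : C) *: w i.
Hypothesis w_zero : forall i, wt i = 0 -> w i \in t.
Hypothesis w_line : forall i j, wt i = wt j -> wt i <> 0 -> w i \in <[w j]>%VS.
Hypothesis w_span : forall S : {vspace mat}, (forall X, X \in g -> X \in t -> X \in S) ->
  (forall i, w i \in S) -> (g <= S)%VS.

Lemma even_bracket T X : mxhom false T -> gsuperbracket T X = T *m X - X *m T.
Proof.
move=> hT; elim/mxpart_ind: X => [p X hX|X Y hX hY].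
  by rewrite (superbracket_hom hT hX) scale1r.
by rewrite superbracketDr hX hY mulmxDl mulmxDr opprD addrACA.
Qed.

(** Reduces a graded subalgebra of gl(m|n) to what is specific to it: nondegeneracy of the
    supertrace form on [g], an even commuting torus [t], and a spanning family of weight vectors for
    [t]. *)
Lemma mx_basic_structure : basic_structure (gstr_form c (g := g)) h.
Proof.
have gbr := vsval_bracket.
have vinj (x y : gl) : vsval x = vsval y -> x = y by apply: val_inj.
have vD (x y : gl) : vsval (x + y) = vsval x + vsval y by apply: linearD.
have vZ a (x : gl) : vsval (a *: x) = a *: vsval x by apply: linearZ.
have vN (x : gl) : vsval (- x) = - vsval x by apply: linearN.
have v0 : vsval (0 : gl) = 0 by apply: linear0.
have linl z : linear (fun x => sa_br gl x z).
  by move=> a x y; apply: vinj; rewrite vD vZ !gbr vD vZ; apply: superbracket_linl.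
have linr z : linear (sa_br gl z).
  by move=> a x y; apply: vinj; rewrite vD vZ !gbr vD vZ; apply: superbracket_linr.
split=> //.
- have vpp p (x : gl) : vsval (vsproj g (gmx_part p (vsval x))) = gmx_part p (vsval x).
    by apply: vsprojK; apply: g_part; apply: subvsP.
  apply/eqP; rewrite eqEsubv subvf andTb; apply/subvP => x _.
  have -> : x = vsproj g (gmx_part false (vsval x)) + vsproj g (gmx_part true (vsval x)).
    by apply: vinj; rewrite vD !vpp mx_part_sum.
  by apply: memv_add; apply/mem_mx_part; rewrite vpp; apply: mxhom_part.
- apply/eqP; rewrite -subv0; apply/subvP => x; rewrite memv_cap => /andP [/mem_mx_part h0 /mem_mx_part h1].
  rewrite memv0; apply/eqP/vinj; rewrite v0.
  by rewrite -h0 -h1 mx_part_part.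
- move=> p q x y /mem_mx_part hx /mem_mx_part hy; apply/mem_mx_part; rewrite gbr.
  rewrite (superbracket_hom hx hy) addrC -scaleNr; apply: mxhomP; last exact: mxhomM.
  by rewrite addbC; apply: mxhomM.
- move=> p q x y /mem_mx_part hx /mem_mx_part hy; apply: vinj; rewrite vN vZ !gbr.
  rewrite (superbracket_hom hx hy) (superbracket_hom hy hx) scalerBr scalerA andbC -expr2.
  by rewrite sqrr_sign scale1r opprB.
- move=> z a x y; rewrite /gstr_form vD vZ mulmxDl -scalemxAl supertraceD supertraceZ.
  by rewrite mulrDr mulrCA.
- move=> z a x y; rewrite /gstr_form vD vZ mulmxDr -scalemxAr supertraceD supertraceZ.
  by rewrite mulrDr mulrCA.
- move=> p q x y /mem_mx_part hx /mem_mx_part hy; rewrite /gstr_form (supertraceC hx hy).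
  by rewrite mulrCA.
- move=> p x y /mem_mx_part hx /mem_mx_part hy; rewrite /gstr_form supertrace_odd ?mulr0 //.
  by have := mxhomM hx hy; case: (p).
- move=> p q r x y z _ _ _; rewrite /gstr_form !gbr; congr (_ * _).
  exact: supertrace_bracket.
- move=> x hx; apply: vinj; rewrite v0; apply: g_nondeg => [|Y hY]; first exact: subvsP.
  have := hx (vsproj g Y); rewrite /gstr_form vsprojK // => /eqP.
  by rewrite mulf_eq0 (negPf c_neq0) => /eqP.
- apply/subvP => x; rewrite mem_mx_cartan => /t_even hx.
  exact/mem_mx_part.
- move=> x y; rewrite !mem_mx_cartan => hx hy; apply: vinj; rewrite gbr v0.
  rewrite even_bracket; last exact: t_even.
  by rewrite (t_comm hx hy) subrr.
- move=> x y z; rewrite mem_mx_cartan => /t_even; set T := vsval x => hT.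
  apply: vinj; rewrite vD !gbr -/T; move: (vsval y) (vsval z) => {gbr} Y Z.
  elim/mxpart_ind: Y => [p Y hY|Y Y' hY hY']; last first.
    by rewrite superbracketDl !superbracketDr hY hY' !superbracketDl addrACA.
  elim/mxpart_ind: Z => [q Z hZ|Z Z' hZ hZ']; last first.
    by rewrite !superbracketDr hZ hZ' addrACA.
  have hTY : mxhom p (gsuperbracket T Y).
    by rewrite even_bracket // addrC -scaleN1r; apply: mxhomP; [have := mxhomM hY hT; rewrite addbF | have := mxhomM hT hY].
  have hTZ : mxhom q (gsuperbracket T Z).
    by rewrite even_bracket // addrC -scaleN1r; apply: mxhomP; [have := mxhomM hZ hT; rewrite addbF | have := mxhomM hT hZ].
  rewrite (superbracket_hom hY hZ) (superbracket_hom hTY hZ) (superbracket_hom hY hTZ) !even_bracket //.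
  move: ((-1) ^+ (p && q)) => s.
  (* The bracket with [T] is the ordinary commutator, whose derivation property comes down to this
     rearrangement of six products. *)
  have E (V : zmodType) (x1 x2 x3 x4 x5 x6 : V) :
      x1 - x2 - (x3 - x4) = x1 - x5 - (x6 - x4) + (x5 - x3 - (x2 - x6)).
    rewrite !opprB [RHS]addrACA !addrA !subrK -!addrA; congr (x1 + _).
    by rewrite addrCA [RHS]addrCA [- x2 - x3]addrC.
  rewrite !mulmxBl !mulmxBr -!scalemxAl -!scalemxAr !mulmxA !scalerBr.
  exact: E.
exists I, (fun i => vsproj g (w i)), wt, par; split.
- by move=> i; apply/mem_mx_part; rewrite vsprojK.
- move=> i; apply/(mem_rootspace _ _ linl linr) => T; apply: vinj.
  have hT : mxhom false (vsval (vsval T)) by apply: t_even; rewrite -mem_mx_cartan subvsP.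
  by rewrite gbr vZ vsprojK // even_bracket.
- by move=> i /w_zero; rewrite mem_mx_cartan vsprojK.
- move=> i j E ne _; have /vlineP [k Ek] := w_line E ne.
  by rewrite Ek linearZ /= memvZ ?memv_line.
move=> S hS wS; apply/eqP; rewrite eqEsubv subvf /=; apply/subvP => x _.
(* The spanning hypothesis speaks of matrices, so [S] is transported to its image there. *)
pose S' := (linfun (vsval : subvs_of g -> mat) @: S)%VS.
have memS' X : X \in g -> vsproj g X \in S -> X \in S'.
  move=> hX hS'; rewrite -(vsprojK hX) -(linfun_linearE (f := vsval : subvs_of g -> mat)) ?memv_img //.
have : vsval x \in S'.
  apply: (subvP (w_span (S := S') _ _)) => [X gX tX|i|]; last exact: subvsP.
    by apply: memS' => //; apply: (subvP hS); rewrite mem_mx_cartan vsprojK.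
  exact: memS'.
by case/memv_imgP => y hy; rewrite linfun_linearE // => /val_inj ->.
Qed.

End MatrixSuperalgebra.

(** * Nondegeneracy of the supertrace form on all matrices *)

Section MatrixAux.
Variables (C : fieldType) (m n : nat).
Local Notation mat := 'M[C]_(m + n).

Definition parity_mx : mat := block_mx 1%:M 0 0 (- 1%:M).

Lemma parity_mxK : parity_mx *m parity_mx = 1%:M.
Proof.
by rewrite mulmx_block !mul0mx !mulmx0 !addr0 !add0r mulmxN mulNmx opprK !mulmx1 -scalar_mx_block.
Qed.

Lemma gsupertraceE (X : mat) : gsupertrace X = \tr (parity_mx *m X).
Proof.
rewrite -[X in RHS]submxK mulmx_block !mul0mx !mul1mx !addr0 !add0r mxtrace_block.
by rewrite mulNmx mul1mx raddfN.
Qed.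

Lemma mxtrace_mul_delta (Z : mat) i j : \tr (Z *m delta_mx j i) = Z i j.
Proof.
rewrite /mxtrace (bigD1 i) //= big1 => [|k ki].
  rewrite addr0 mxE (bigD1 j) //= mxE !eqxx mulr1 big1 ?addr0 // => k kj.
  by rewrite mxE (negPf kj) mulr0.
by rewrite mxE big1 // => l _; rewrite mxE (negPf ki) andbF mulr0.
Qed.

(** Testing against matrix units reads off the entries of [parity_mx *m X], and [parity_mx] is
    invertible. *)
Lemma gsupertrace_nondeg (X : mat) : (forall Y, gsupertrace (X *m Y) = 0) -> X = 0.
Proof.
move=> hX; suff E : parity_mx *m X = 0 by rewrite -[X]mul1mx -parity_mxK -mulmxA E mulmx0.
apply/matrixP => i j; have := hX (delta_mx j i).
by rewrite gsupertraceE mulmxA mxtrace_mul_delta => ->; rewrite mxE.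
Qed.

Lemma mxhomP_entries (p : bool) (X : mat) :
  (forall i j : 'I_(m + n), (i < m)%N (+) (j < m)%N != p -> X i j = 0) -> mxhom p X.
Proof.
move=> hX; apply/mxhomE; apply/matrixP => i j; rewrite mxE.
rewrite /gmx_part; case: p hX => /= hX; rewrite !mxE; case: split_ordP => i' Ei; rewrite !mxE;
  case: split_ordP => j' Ej; rewrite !mxE //; apply: hX => /=;
  by rewrite ?ltn_ord ?ltnNge ?leq_addr ?ltn_ord.
Qed.

End MatrixAux.

(** * sl(m|n) and gl(m|n) *)

Section TypeA.
Variables (C : numFieldType) (m n : nat).
Local Notation mat := 'M[C]_(m + n).
Variable g : {vspace mat}.
Hypothesis g_part : forall p (X : mat), X \in g -> gmx_part p X \in g.
Hypothesis g_bracket : forall X Y : mat, X \in g -> Y \in g -> gsuperbracket X Y \in g.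
Hypothesis g_nondeg : forall X : mat, X \in g ->
  (forall Y, Y \in g -> gsupertrace (X *m Y) = 0) -> X = 0.
Hypothesis g_delta : forall i j, i != j -> delta_mx i j \in g.
Hypothesis g_diag : forall D : 'rV[C]_(m + n), exists c, diag_mx D + c%:M \in g.

Definition gA_cartan : {vspace gmx_superalgebra g} :=
  gmx_cartan g (limg (linfun (@diag_mx C (m + n)))).

Definition gA_coord (a : 'I_(m + n)) : weight gA_cartan :=
  linfun (fun H : subvs_of gA_cartan => (vsval (vsval H) a a : C^o)).

Lemma gA_coordE a (H : subvs_of gA_cartan) : gA_coord a H = vsval (vsval H) a a.
Proof. by rewrite linfun_linearE // => c x y; rewrite !linearP /= !mxE. Qed.

Lemma mem_diag (X : mat) : reflect (exists D, X = diag_mx D) (X \in limg (linfun (@diag_mx C (m + n)))).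
Proof.
apply: (iffP idP) => [/memv_imgP [D _ ->]|[D ->]].
  by exists D; rewrite lfunE.
by rewrite -[diag_mx D](lfunE (@diag_mx C (m + n))) memv_img ?memvf.
Qed.

(** The subalgebra need not contain every diagonal matrix, but it contains each up to a scalar one;
    the scalar cancels in all differences of coordinates. *)
Lemma gA_cartan_ex (D : 'rV[C]_(m + n)) : exists (H : subvs_of gA_cartan) c,
  forall a, gA_coord a H = D 0 a + c.
Proof.
have [c hc] := g_diag D.
have hH : vsproj g (diag_mx D + c%:M) \in gA_cartan.
  rewrite mem_mx_cartan vsprojK //; apply/mem_diag; exists (D + const_mx c).
  by rewrite linearD /= diag_const_mx.
exists (vsproj gA_cartan (vsproj g (diag_mx D + c%:M))), c => a.
by rewrite gA_coordE vsprojK // vsprojK // !mxE eqxx !mulr1n.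
Qed.

(** Evaluation at the diagonal units of [a] and of [b] determines [c] and [d], because 1 and -1
    differ. *)
Lemma gA_coord_inj a b c d : a != b -> gA_coord a - gA_coord b = gA_coord c - gA_coord d ->
  a = c /\ b = d.
Proof.
move=> ab E; have ev (D : 'rV[C]_(m + n)) : D 0 a - D 0 b = D 0 c - D 0 d :> C.
  have [H [k hH]] := gA_cartan_ex D; move/lfunP/(_ H): E; rewrite !lfunE /= !lfunE /= !hH.
  have K (x y : C) : x + k - (y + k) = x - y by ring.
  by rewrite !K.
have [E1 E2] := (ev (delta_mx 0 a), ev (delta_mx 0 b)); move: E1 E2; rewrite !mxE !eqxx /=.
have ba : b != a by rewrite eq_sym.
rewrite (negPf ab) (negPf ba) subr0 sub0r.
have n1 : (1 : C) != -1 by rewrite -subr_eq0 opprK -[1 + 1]/(2%:R) pnatr_eq0.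
move=> E1 E2; split; apply/eqP; rewrite eq_sym.
  case: (c == a) E1 => //; case: (d == a) => /eqP; rewrite ?sub0r ?subrr ?oppr0 ?oner_eq0 //.
  by rewrite (negPf n1).
case: (d == b) E2 => //; case: (c == b) => /eqP; rewrite ?subr0 ?oppr_eq0 ?oner_eq0 //.
by rewrite eq_sym (negPf n1).
Qed.

Definition gA_weight (ab : 'I_(m + n) * 'I_(m + n)) : weight gA_cartan :=
  gA_coord ab.1 - gA_coord ab.2.

Lemma gA_weight_inj ab cd : ab.1 != ab.2 -> gA_weight ab = gA_weight cd -> ab = cd.
Proof. by case: ab cd => [a b] [c d] nab E; have [/= -> ->] := gA_coord_inj nab E. Qed.

Lemma gA_basic_structure c : c != 0 -> basic_structure (gstr_form c (g := g)) gA_cartan.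
Proof.
move=> c0; pose t := limg (linfun (@diag_mx C (m + n))).
have diag_even D : mxhom false (diag_mx D : mat).
  apply: mxhomP_entries => i j; rewrite mxE; have [->|] := eqVneq i j; first by rewrite addbb.
  by rewrite mulr0n.
(* The weight vectors are the matrix units off the diagonal. Diagonal pairs are given the vector 0:
   their weight is 0, and the torus already accounts for the diagonal. *)
apply: (@mx_basic_structure _ _ _ g t c c0 g_part g_bracket _ _ g_nondeg _
  (fun ab : 'I_(m + n) * 'I_(m + n) => if ab.1 == ab.2 then 0 else delta_mx ab.1 ab.2)
  gA_weight (fun ab => (ab.1 < m)%N (+) (ab.2 < m)%N)).
- by move=> T /mem_diag [D ->].
- by move=> T T' /mem_diag [D ->] /mem_diag [D' ->]; rewrite diag_mxC.
- by move=> [a b] /=; case: eqVneq => // ab; [exact: mem0v | exact: g_delta].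
- move=> [a b] /=; case: eqVneq => [ab|ab]; first exact: mx_part0.
  apply: mxhomP_entries => i j; rewrite mxE.
  by have [->|_] := eqVneq i a; have [->|_] := eqVneq j b; rewrite ?eqxx.
- move=> [a b] T; rewrite /= /gA_weight lfunE /= lfunE /= !gA_coordE.
  case: eqVneq => [ab|ab]; first by rewrite mulmx0 mul0mx subrr scaler0.
  have : vsval (vsval T) \in t by rewrite -mem_mx_cartan subvsP.
  case/mem_diag => D ->; rewrite mul_diag_mx mul_mx_diag; apply/matrixP => i j; rewrite !mxE !eqxx !mulr1n.
  by case: eqP => [->|_]; case: eqP => [->|_]; rewrite ?mulr0 ?mul0r ?subrr // mulr1 mul1r mulr1.
- move=> [a b] /=; case: eqVneq => [_ _|ab]; first exact: mem0v.
  move=> E; have : gA_weight (a, b) = gA_weight (a, a) by rewrite E /gA_weight subrr.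
  by move/(@gA_weight_inj (a, b) (a, a) ab) => [Eb]; rewrite Eb eqxx in ab.
- move=> ab cd E ne; have -> : ab = cd; last exact: memv_line.
  apply: gA_weight_inj E; apply: contra_notN ne => /eqP E.
  by rewrite /gA_weight E subrr.
move=> S tS wS; apply/subvP => X gX.
have hO : \sum_i \sum_(j | i != j) X i j *: delta_mx i j \in g.
  by apply: memv_suml => i _; apply: memv_suml => j ij; rewrite memvZ ?g_delta.
have EX : X = diag_mx (\row_i X i i) + \sum_i \sum_(j | i != j) X i j *: delta_mx i j.
  rewrite {1}[X]matrix_sum_delta [diag_mx _]matrix_sum_delta -big_split; apply: eq_bigr => i _ /=.
  rewrite (bigD1 i) //= [X in _ = X + _](bigD1 i) //= !mxE eqxx mulr1n -addrA; congr (_ + _).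
  rewrite [X in _ = X + _]big1 ?add0r => [|j ji]; last by rewrite !mxE eq_sym (negPf ji) scale0r.
  by apply: eq_bigl => j; rewrite eq_sym.
rewrite EX; apply: memvD.
  apply: tS; last by apply/mem_diag; exists (\row_i X i i).
  (* The diagonal part lies in [g] as the difference of [X] and its off-diagonal part. *)
  by rewrite -(addrK (\sum_i \sum_(j | i != j) X i j *: delta_mx i j) (diag_mx _)) -EX memvB.
apply: memv_suml => i _; apply: memv_suml => j ij; apply: memvZ.
by have := wS (i, j); rewrite /= (negPf ij).
Qed.

End TypeA.

Lemma pos0_differences_uniq (V : zmodType) (m n : nat) (e : 'I_(m + n) -> V) :
  (forall a b c d, a != b -> e a - e b = e c - e d -> a = c /\ b = d) ->
  uniq ([seq e (lshift n ij.1) - e (lshift n ij.2) | ij <- ltpairs m]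
    ++ [seq e (rshift m ij.1) - e (rshift m ij.2) | ij <- ltpairs n]).
Proof.
move=> e_inj; have ltpP k (ij : 'I_k * 'I_k) : ij \in ltpairs k -> ij.1 != ij.2.
  by rewrite mem_enum inE => lt; apply: contraTneq lt => ->; rewrite ltnn.
rewrite cat_uniq; apply/and3P; split.
- rewrite map_inj_in_uniq ?enum_uniq // => [[i j] [k l]] /ltpP /= ij _ /e_inj [].
    by rewrite (inj_eq (@lshift_inj _ _)).
  by move=> /lshift_inj -> /lshift_inj ->.
- apply/hasPn => x /mapP [[i j] /ltpP /= ij ->]; apply/mapP => [[[k l] _ /= /e_inj []]].
    by rewrite (inj_eq (@rshift_inj _ _)).
  by move/eqP; rewrite eq_rlshift.
- rewrite map_inj_in_uniq ?enum_uniq // => [[i j] [k l]] /ltpP /= ij _ /e_inj [].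
    by rewrite (inj_eq (@rshift_inj _ _)).
  by move=> /rshift_inj -> /rshift_inj ->.
Qed.

Section SlGl.
Variables (C : numFieldType) (m n : nat).
Local Notation mat := 'M[C]_(m + n).

Lemma gl_basic_structure :
  basic_structure (gstr_form 1 (g := fullv : {vspace mat})) (gA_cartan fullv).
Proof.
apply: gA_basic_structure; rewrite ?oner_eq0 //; try by move=> *; apply: memvf.
- by move=> X _ hX; apply: gsupertrace_nondeg => Y; apply: hX; apply: memvf.
- by move=> D; exists 0; apply: memvf.
Qed.

Definition gsl : {vspace mat} := lker (linfun (fun X : mat => (gsupertrace X : C^o))).

Lemma mem_gsl X : (X \in gsl) = (gsupertrace X == 0).
Proof. by rewrite memv_ker linfun_linearE //; apply: supertrace_lin. Qed.

Hypothesis mn : m != n.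

Lemma gsupertrace1 : gsupertrace (1%:M : mat) != 0.
Proof.
rewrite /gsupertrace scalar_mx_block block_mxKul block_mxKdr !mxtrace1.
by rewrite subr_eq0 eqr_nat.
Qed.

(** The identity has supertrace m - n, nonzero by hypothesis, so a multiple of it corrects any
    supertrace. *)
Lemma gsupertrace_diag_shift (X : mat) : X + (- (gsupertrace X / gsupertrace (1%:M : mat)))%:M \in gsl.
Proof.
rewrite mem_gsl supertraceD -[(- _)%:M]scalemx1 supertraceZ mulNr mulfVK ?subrr //.
exact: gsupertrace1.
Qed.

Lemma gsl_diag (D : 'rV[C]_(m + n)) : exists c, diag_mx D + c%:M \in gsl.
Proof. by eexists; apply: gsupertrace_diag_shift. Qed.

Lemma scalar_even (c : C) : mxhom false (c%:M : mat).
Proof.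
apply: mxhomP_entries => i j; rewrite mxE; have [->|] := eqVneq i j; first by rewrite addbb.
by rewrite mulr0n.
Qed.

(** For X of supertrace zero, str(XY) is unchanged when a scalar matrix is added to Y, so
    nondegeneracy is inherited from gl(m|n). *)
Lemma sl_basic_structure : basic_structure (gstr_form 1 (g := gsl)) (gA_cartan gsl).
Proof.
apply: gA_basic_structure; rewrite ?oner_eq0 //; last exact: gsl_diag.
- move=> p X; rewrite !mem_gsl => /eqP hX; apply/eqP.
  have todd := supertrace_odd (mxhom_part true X).
  by case: p => //; move: hX; rewrite -{1}(mx_part_sum X) supertraceD todd addr0.
(* The supertrace of [X, Y] is str([X, Y] 1) = str(X [Y, 1]), and the identity is central. *)
- move=> X Y _ _; rewrite mem_gsl -[gsuperbracket X Y]mulmx1 supertrace_bracket.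
  elim/mxpart_ind: Y => [p Y hY|Y Z hY hZ]; last first.
    by rewrite superbracketDl mulmxDr supertraceD (eqP hY) (eqP hZ) addr0.
  rewrite (superbracket_hom hY (scalar_even 1)) mulmx1 mul1mx andbF scale1r subrr mulmx0.
  by rewrite -(scale0r (0 : mat)) supertraceZ mul0r.
- move=> X gX hX; apply: gsupertrace_nondeg => Y; have := hX _ (gsupertrace_diag_shift Y).
  rewrite mulmxDr supertraceD mul_mx_scalar supertraceZ.
  by move: gX; rewrite mem_gsl => /eqP ->; rewrite mulr0 addr0.
move=> i j ij; rewrite mem_gsl gsupertraceE mxtrace_mul_delta.
rewrite /parity_mx; case: (split_ordP i) ij => i' ->; case: (split_ordP j) => j' ->.
- by rewrite block_mxEul mxE (inj_eq (@lshift_inj _ _)) eq_sym => /negPf ->.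
- by rewrite block_mxEdl mxE.
- by rewrite block_mxEur mxE.
- by rewrite block_mxEdr !mxE (inj_eq (@rshift_inj _ _)) eq_sym => /negPf ->; rewrite oppr0.
Qed.

End SlGl.

Lemma sl_data_basic (R : realType) (m n : nat) : m != n ->
  basic_structure (bd_form (sl_data R m n)) (bd_cartan (sl_data R m n)).
Proof. by move=> mn; exact: (sl_basic_structure R[i] mn). Qed.

Lemma gl_data_basic (R : realType) (m n : nat) :
  basic_structure (bd_form (gl_data R m n)) (bd_cartan (gl_data R m n)).
Proof. exact: (gl_basic_structure R[i] m n). Qed.

Lemma A_pos0_uniq (R : realType) (m n : nat) (g : {vspace 'M[R[i]]_(m + n)}) :
  (forall D : 'rV_(m + n), exists c, diag_mx D + c%:M \in g) -> uniq (A_pos0 g).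
Proof.
move=> gD; pose e : 'I_(m + n) -> weight (A_cartan g) := gA_coord g.
have e_inj a b c d : a != b -> e a - e b = e c - e d -> a = c /\ b = d.
  exact: (gA_coord_inj gD).
exact: (pos0_differences_uniq e_inj).
Qed.

Lemma sl_pos0_uniq (R : realType) (m n : nat) : m != n -> uniq (bd_pos0 (sl_data R m n)).
Proof. by move=> mn; apply: A_pos0_uniq; exact: (@gsl_diag R[i] m n mn). Qed.

Lemma gl_pos0_uniq (R : realType) (m n : nat) : uniq (bd_pos0 (gl_data R m n)).
Proof. by apply: A_pos0_uniq => D; exists 0; exact: memvf. Qed.

(** * osp(m|2n) *)

(* option (Q * bool) indexes the weights e_q, - e_q (false, true) and 0 (None). *)
Definition sflip (Q : Type) (x : option (Q * bool)) :=
  if x is Some (q, s) then Some (q, ~~ s) else None.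

Lemma sflipK (Q : Type) : involutive (@sflip Q).
Proof. by case=> [[q s]|] //=; rewrite negbK. Qed.

(** * Weight vectors of a torus of plane rotations *)

Section RotationTorus.
Variables (C : numClosedFieldType) (N : nat) (Q : finType).
Variables (ev od : Q -> 'cV[C]_N) (z : 'cV[C]_N).
Hypothesis ev_ev : forall p q, (ev p)^T *m ev q = ((p == q)%:R)%:M.
Hypothesis od_od : forall p q, (od p)^T *m od q = ((p == q)%:R)%:M.
Hypothesis ev_od : forall p q, (ev p)^T *m od q = 0.
Hypothesis ev_z : forall q, (ev q)^T *m z = 0.
Hypothesis od_z : forall q, (od q)^T *m z = 0.
Hypothesis complete :
  \sum_q (ev q *m (ev q)^T + od q *m (od q)^T) + z *m z^T = 1%:M.

Lemma od_ev p q : (od p)^T *m ev q = 0.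
Proof. by rewrite -[LHS]trmxK trmx_mul trmxK ev_od trmx0. Qed.

(** The matrix K of the torus, on the plane with orthonormal basis [ev q], [od q]. *)
Definition plane (q : Q) : 'M[C]_N := 'i *: (ev q *m (od q)^T - od q *m (ev q)^T).
Definition rotation (a : Q -> C) : 'M[C]_N := \sum_q a q *: plane q.

(** Joint eigenvectors of all rotations. Those in a plane are isotropic for the bilinear form u^T v,
    and [wvec x] is paired with [wvec (sflip x)]. *)
Definition wvec (x : option (Q * bool)) : 'cV[C]_N :=
  if x is Some (q, s) then ev q - ((-1) ^+ s * 'i) *: od q else z.
Definition wcoef (a : Q -> C) (x : option (Q * bool)) : C :=
  if x is Some (q, s) then (-1) ^+ s * a q else 0.

Lemma plane_ev p q : plane p *m ev q = - ((p == q)%:R * 'i) *: od q.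
Proof.
rewrite /plane -scalemxAl mulmxBl -!mulmxA od_ev mulmx0 sub0r ev_ev.
have [->|_] := eqVneq p q; last by rewrite mul0r oppr0 scale0r mul_mx_scalar scale0r oppr0 scaler0.
by rewrite mul1r mulmx1 scalerN scaleNr.
Qed.

Lemma plane_od p q : plane p *m od q = ((p == q)%:R * 'i) *: ev q.
Proof.
rewrite /plane -scalemxAl mulmxBl -!mulmxA ev_od mulmx0 subr0 od_od.
have [->|_] := eqVneq p q; last by rewrite mul0r scale0r mul_mx_scalar scale0r scaler0.
by rewrite mul1r mulmx1.
Qed.

Lemma plane_z q : plane q *m z = 0.
Proof. by rewrite /plane -scalemxAl mulmxBl -!mulmxA ev_z od_z !mulmx0 subr0 scaler0. Qed.

Lemma rotation_ev a q : rotation a *m ev q = - (a q * 'i) *: od q.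
Proof.
rewrite /rotation mulmx_suml (bigD1 q) //= big1 => [|p pq].
  by rewrite addr0 -scalemxAl plane_ev eqxx mul1r scalerA mulrN.
by rewrite -scalemxAl plane_ev (negPf pq) mul0r oppr0 scale0r scaler0.
Qed.

Lemma rotation_od a q : rotation a *m od q = (a q * 'i) *: ev q.
Proof.
rewrite /rotation mulmx_suml (bigD1 q) //= big1 => [|p pq].
  by rewrite addr0 -scalemxAl plane_od eqxx mul1r scalerA.
by rewrite -scalemxAl plane_od (negPf pq) mul0r scale0r scaler0.
Qed.

Lemma rotation_z a : rotation a *m z = 0.
Proof. by rewrite /rotation mulmx_suml big1 // => q _; rewrite -scalemxAl plane_z scaler0. Qed.

Lemma rotation_wvec a x : rotation a *m wvec x = wcoef a x *: wvec x.
Proof.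
case: x => [[q s]|] /=; last by rewrite rotation_z scale0r.
rewrite mulmxBr -scalemxAr rotation_ev rotation_od scalerBr !scalerA addrC.
have ii : 'i * 'i = -1 :> C by rewrite -expr2 sqrCi.
have ss : (-1) ^+ s * (-1) ^+ s = 1 :> C by rewrite -expr2 sqrr_sign.
move: ((-1) ^+ s) ss => e ss; congr (_ + _).
  rewrite -scaleNr; congr (_ *: _).
  have -> : - (e * 'i * (a q * 'i)) = - ('i * 'i) * (e * a q) by ring.
  by rewrite ii opprK mul1r.
rewrite scaleNr; congr (- (_ *: _)).
have -> : e * a q * (e * 'i) = (e * e) * (a q * 'i) by ring.
by rewrite ss mul1r.
Qed.

Lemma rotation_tr a : (rotation a)^T = - rotation a.
Proof.
rewrite /rotation linear_sum -sumrN; apply: eq_bigr => q _.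
by rewrite linearZ /= /plane linearZ /= linearB /= !trmx_mul !trmxK -scalerN -scalerN opprB.
Qed.

Lemma rotation_inj a : rotation a = 0 -> forall q, a q = 0.
Proof.
move=> E q; have := rotation_od a q; rewrite E mul0mx => /esym E2.
have : (ev q)^T *m ((a q * 'i) *: ev q) = 0 by rewrite E2 mulmx0.
rewrite -scalemxAr ev_ev eqxx scalemx1 => /matrixP /(_ 0 0); rewrite !mxE eqxx mulr1n => /eqP.
by rewrite mulf_eq0 (negPf (neq0Ci C)) orbF => /eqP.
Qed.

Lemma rotation_comm a b : rotation a *m rotation b = rotation b *m rotation a.
Proof.
have E a' b' : rotation a' *m rotation b' =
    \sum_q (a' q * b' q) *: (ev q *m (ev q)^T + od q *m (od q)^T).
  rewrite {2}/rotation mulmx_sumr; apply: eq_bigr => q _.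
  rewrite /plane -!scalemxAr mulmxBr !mulmxA rotation_ev rotation_od -!scalemxAl.
  have ii : 'i * 'i = -1 :> C by rewrite -expr2 sqrCi.
  rewrite -[- (_ *: (ev q *m _))]scaleNr -scalerDr [od q *m _ + _]addrC !scalerA; congr (_ *: _).
  have -> : b' q * 'i * - (a' q * 'i) = - ('i * 'i) * (a' q * b' q) by ring.
  by rewrite ii opprK mul1r.
by rewrite !E; apply: eq_bigr => q _; rewrite mulrC.
Qed.

(** Inside a plane the pairing of [wvec x] with [wvec (sflip x)] is 1 + 1 = 2, whence the factor
    1/2. *)
Definition wscale (x : option (Q * bool)) : C := if x is Some _ then 2%:R^-1 else 1.

Lemma wvec_complete : \sum_x wscale x *: (wvec x *m (wvec (sflip x))^T) = 1%:M.
Proof.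
have -> : \sum_x wscale x *: (wvec x *m (wvec (sflip x))^T) =
    z *m z^T + \sum_(x : Q * bool) 2%:R^-1 *: (wvec (Some x) *m (wvec (sflip (Some x)))^T).
  rewrite (bigD1 None) //= scale1r; congr (_ + _).
  rewrite (reindex_omap Some id) /=; last by case.
  by apply: eq_big => // x; rewrite eqxx.
rewrite -complete addrC; congr (_ + _).
pose G q s := 2%:R^-1 *: (wvec (Some (q, s)) *m (wvec (Some (q, ~~ s)))^T).
rewrite (eq_bigr (fun p => G p.1 p.2)); last by case.
rewrite -pair_bigA; apply: eq_bigr => q _; rewrite big_bool /G /= -scalerDr.
have ii : 'i * 'i = -1 :> C by rewrite -expr2 sqrCi.
have E (c : C) : (ev q - c *: od q) *m (ev q + c *: od q)^T + (ev q + c *: od q) *m (ev q - c *: od q)^T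
    = (ev q *m (ev q)^T - (c * c) *: (od q *m (od q)^T)) *+ 2.
  by apply/matrixP => i j; rewrite !mxE !big_ord1 !mxE; ring.
rewrite expr1 expr0 mulN1r mul1r scaleNr opprK addrC E ii scaleN1r opprK.
by rewrite -[X in _ *: X = _]scaler_nat scalerA mulVf ?pnatr_eq0 // scale1r.
Qed.

(** Inserts the resolution of the identity on both sides of [Z]; the second index is flipped so that
    the right factor becomes [wvec y]. *)
Lemma wvec_span (Z : 'M[C]_N) : exists c : option (Q * bool) -> option (Q * bool) -> C,
  Z = \sum_x \sum_y c x y *: (wvec x *m (wvec y)^T).
Proof.
exists (fun x y => wscale x * wscale (sflip y) * ((wvec (sflip x))^T *m Z *m wvec (sflip y)) 0 0).
rewrite -{1}[Z]mul1mx -{1}[_ *m Z]mulmx1 -{1}wvec_complete -[in X in _ *m X]wvec_complete.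
rewrite !mulmx_suml; apply: eq_bigr => x _.
rewrite mulmx_sumr (reindex_inj (inv_inj (@sflipK _))); apply: eq_bigr => y _.
rewrite sflipK -!scalemxAl -!scalemxAr.
set a := wvec x; set b := (wvec (sflip x))^T; set d := wvec (sflip y).
have -> : a *m b *m Z *m (d *m (wvec y)^T) = ((b *m Z *m d) 0 0) *: (a *m (wvec y)^T).
  rewrite (_ : _ *m _ = a *m (b *m Z *m d) *m (wvec y)^T); last by rewrite !mulmxA.
  by rewrite {1}[b *m Z *m d]mx11_scalar mul_mx_scalar -scalemxAl.
by rewrite !scalerA; congr (_ *: _); ring.
Qed.

End RotationTorus.

(** * The torus of so(m) *)

Section OrthogonalTorus.
Variables (C : numClosedFieldType) (m : nat).

Lemma even_bound (k : 'I_(m./2)) : (k.*2 < m)%N.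
Proof. by have := ltn_ord k; lia. Qed.

Lemma odd_bound (k : 'I_(m./2)) : (k.*2.+1 < m)%N.
Proof. by have := ltn_ord k; lia. Qed.

Definition so_ev (k : 'I_(m./2)) : 'cV[C]_m := delta_mx (Ordinal (even_bound k)) 0.
Definition so_od (k : 'I_(m./2)) : 'cV[C]_m := delta_mx (Ordinal (odd_bound k)) 0.
(* The vector fixed by the torus; it is 0 for even m. *)
Definition so_z : 'cV[C]_m := \col_i (odd m && (i == m.-1 :> nat))%:R.

Lemma delta_col_tr N (i j : 'I_N) : (delta_mx i 0 : 'cV[C]_N)^T *m delta_mx j 0 = ((i == j)%:R)%:M.
Proof.
rewrite trmx_delta mul_delta_mx_cond; apply/matrixP => a b; rewrite !mxE !ord1 !eqxx.
by case: (i == j); rewrite ?mxE.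
Qed.

Lemma delta_col_mul N (i : 'I_N) (u : 'cV[C]_N) : (delta_mx i 0 : 'cV[C]_N)^T *m u = (u i 0)%:M.
Proof. by rewrite trmx_delta -rowE; apply/matrixP => a b; rewrite !mxE !ord1 eqxx. Qed.

Lemma so_ev_ev p q : (so_ev p)^T *m so_ev q = ((p == q)%:R)%:M.
Proof. by rewrite delta_col_tr -val_eqE /= (inj_eq double_inj). Qed.
Lemma so_od_od p q : (so_od p)^T *m so_od q = ((p == q)%:R)%:M.
Proof. by rewrite delta_col_tr -val_eqE /= eqSS (inj_eq double_inj). Qed.
Lemma so_ev_od p q : (so_ev p)^T *m so_od q = 0.
Proof.
rewrite delta_col_tr -val_eqE /=; case: eqP => [E|_]; last by rewrite raddf0.
by have := congr1 odd E; rewrite /= !odd_double.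
Qed.
Lemma so_ev_z q : (so_ev q)^T *m so_z = 0.
Proof.
rewrite delta_col_mul mxE /=; case: andP => [[om /eqP E]|_]; last by rewrite raddf0.
by exfalso; move: om E (ltn_ord q); lia.
Qed.
Lemma so_od_z q : (so_od q)^T *m so_z = 0.
Proof.
rewrite delta_col_mul mxE /=; case: andP => [[om /eqP E]|_]; last by rewrite raddf0.
by exfalso; move: om E (ltn_ord q); lia.
Qed.

(** The standard basis vector at [i] is [so_ev k] or [so_od k] with k = i/2, except for the last one
    when [m] is odd, which is [so_z]. *)
Lemma so_complete :
  \sum_q (so_ev q *m (so_ev q)^T + so_od q *m (so_od q)^T) + so_z *m so_z^T = 1%:M.
Proof.
apply/matrixP => i j; rewrite !mxE summxE big_ord1 !mxE.
under eq_bigr => q _ do rewrite !trmx_delta !mul_delta_mx !mxE -!val_eqE /=.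
have [<-|ij] := eqVneq i j; last first.
  rewrite mulr0n big1 ?add0r => [|q _].
    case: andP => [[_ /eqP Ei]|_]; last by rewrite mul0r.
    case: andP => [[_ /eqP Ej]|_]; last by rewrite mulr0.
    by move: ij; rewrite -val_eqE /= Ei Ej eqxx.
  have -> : (i == q.*2 :> nat) && (j == q.*2 :> nat) = false.
    by apply: contraNF ij => /andP [/eqP E1 /eqP E2]; rewrite -val_eqE /= E1 E2.
  have -> : (i == q.*2.+1 :> nat) && (j == q.*2.+1 :> nat) = false.
    by apply: contraNF ij => /andP [/eqP E1 /eqP E2]; rewrite -val_eqE /= E1 E2.
  by rewrite addr0.
have [hi|hi] := ltnP i./2 m./2.
  rewrite (bigD1 (Ordinal hi)) //= big1 ?addr0 => [|q].
    have -> : odd m && (i == m.-1 :> nat) = false.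
      by apply/negbTE/negP => /andP [om /eqP E]; move: hi om E; lia.
    rewrite mul0r addr0 !andbb.
    have [oi|oi] := boolP (odd i).
      have [-> ->] : (i == i./2.*2 :> nat) = false /\ (i == i./2.*2.+1 :> nat) by move: oi => /=; lia.
      by rewrite add0r.
    have [-> ->] : (i == i./2.*2 :> nat) /\ (i == i./2.*2.+1 :> nat) = false by move: oi => /=; lia.
    by rewrite addr0.
  rewrite -val_eqE /= !andbb => qi.
  have -> : (i == q.*2 :> nat) = false.
    by apply: contraNF qi => /eqP ->; rewrite doubleK.
  have -> : (i == q.*2.+1 :> nat) = false.
    by apply: contraNF qi => /eqP ->; rewrite /= uphalf_double.
  by rewrite addr0.
have Ei : odd m && (i == m.-1 :> nat).
  have := ltn_ord i; move: hi => /=; lia.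
rewrite Ei mulr1 big1 ?add0r // => q _; rewrite !andbb.
have -> : (i == q.*2 :> nat) = false.
  by apply: contraTF hi => /eqP ->; rewrite doubleK -ltnNge.
have -> : (i == q.*2.+1 :> nat) = false.
  by apply: contraTF hi => /eqP ->; rewrite /= uphalf_double -ltnNge.
by rewrite addr0.
Qed.

Definition gso_torus (t : 'rV[C]_(m./2)) : 'M[C]_m :=
  \matrix_(i, j) \sum_(k < m./2) t ord0 k *
    ('i *+ ((i == k.*2 :> nat) && (j == k.*2.+1 :> nat))
     - 'i *+ ((i == k.*2.+1 :> nat) && (j == k.*2 :> nat))).

Lemma gso_torusE t : gso_torus t = rotation so_ev so_od (fun k => t 0 k).
Proof.
apply/matrixP => i j; rewrite !mxE summxE; apply: eq_bigr => k _.
rewrite mxE /plane !trmx_delta !mul_delta_mx !mxE -!val_eqE /=; congr (_ * _).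
by rewrite mulrBr !mulr_natr.
Qed.

End OrthogonalTorus.

(** * Sums of two signed basis weights *)

Section SignedPairs.
Variables (K : numFieldType) (V : lmodType K) (Q : eqType) (b : Q -> V) (phi : Q -> V -> K).
Hypothesis phiD : forall q u v, phi q (u + v) = phi q u + phi q v.
Hypothesis phiZ : forall q a u, phi q (a *: u) = a * phi q u.
Hypothesis phi_b : forall p q, phi q (b p) = (p == q)%:R.

Definition signed_weight (x : option (Q * bool)) : V :=
  if x is Some (q, s) then (-1) ^+ s *: b q else 0.

Lemma signed_weight_flip x : signed_weight (sflip x) = - signed_weight x.
Proof. by case: x => [[q []]|] /=; rewrite ?expr0 ?expr1 ?scale1r ?scaleN1r ?opprK ?oppr0. Qed.

(** The coordinate of [signed_weight x] along that of [z], as an integer so that comparisons are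
    left to [lia]. *)
Let cnt (z : Q * bool) (x : option (Q * bool)) : int :=
  if x == Some z then 1 else if x == Some (z.1, ~~ z.2) then -1 else 0.

Lemma signed_weight_cnt (z : Q * bool) x : (-1) ^+ z.2 * phi z.1 (signed_weight x) = (cnt z x)%:~R.
Proof.
have phi0 q : phi q 0 = 0 by rewrite -(scale0r 0) phiZ mul0r.
case: z => q s; case: x => [[p r]|] /=; last by rewrite phi0 mulr0.
have oE t r' : (Some (p, r) == Some (t, r')) = (p == t) && (r == r').
  by rewrite (inj_eq Some_inj) xpair_eqE.
rewrite phiZ phi_b /cnt /= !oE; case: eqVneq => _; last by rewrite !mulr0.
by rewrite mulr1; case: (s); case: (r); rewrite /= ?expr0 ?expr1 ?mulr1 ?mul1r ?mulrNN ?mulr1.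
Qed.

Lemma signed_weight_inj x y : signed_weight x = signed_weight y -> x = y.
Proof.
have half z w : signed_weight (Some z) = signed_weight w -> w = Some z.
  move=> E; have := signed_weight_cnt z w; rewrite -E signed_weight_cnt => /intr_inj.
  by rewrite /cnt eqxx; case: (w =P Some z) => // _; case: ifP.
by case: x => [z|] E; [rewrite (half _ _ E) | case: y E => [z|] // /esym /half].
Qed.

(** A nonzero sum has no cancelling pair, so each nonzero term on the right has positive total
    coordinate and must occur on the left. The sum 0 is excluded because every x cancels against its
    opposite. *)
Lemma signed_pair_inj x y x' y' :
  signed_weight x + signed_weight y = signed_weight x' + signed_weight y' ->
  signed_weight x + signed_weight y <> 0 -> (x = x' /\ y = y') \/ (x = y' /\ y = x').
Proof.
have half z w : signed_weight x + signed_weight y = signed_weight (Some z) + signed_weight w ->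
    signed_weight x + signed_weight y <> 0 -> x = Some z \/ y = Some z.
  move=> E nz; have wz : w != Some (z.1, ~~ z.2).
    apply/eqP => Ew; apply: nz; rewrite E Ew -[Some (z.1, _)]/(sflip (Some (z.1, z.2))).
    by rewrite signed_weight_flip; case: (z) => q s; rewrite subrr.
  have : (cnt z x + cnt z y)%:~R = (1 + cnt z w)%:~R :> K.
    rewrite !rmorphD /= -!signed_weight_cnt -mulrDr -phiD E phiD mulrDr; congr (_ + _).
    by rewrite signed_weight_cnt /cnt eqxx.
  move/intr_inj; rewrite /cnt (negPf wz).
  case: (x =P Some z) => [->|_]; first by left.
  case: (y =P Some z) => [->|_]; first by right.
  by case: ifP => _; case: ifP => _; case: ifP => _; lia.
move=> E nz; case: x' E => [z|] E.
  case: (half z y' E nz) => Ez; [left|right]; split=> //; apply: signed_weight_inj.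
    by move: E; rewrite Ez; apply: addrI.
  by move: E; rewrite Ez addrC; apply: addrI.
case: y' E => [z|] E; last by case: nz; rewrite E /= addr0.
rewrite addrC in E; move: (E); rewrite addrC [RHS]addrC => E'.
case: (half z None E' nz) => Ez; [right|left]; split=> //; apply: signed_weight_inj.
  by move: E'; rewrite Ez; apply: addrI.
by move: E'; rewrite Ez addrC; apply: addrI.
Qed.

End SignedPairs.

(** * osp(m|2n) as the fixed points of an automorphism of gl(m|2n) *)

Section SuperAdjoint.
Variables (C : numClosedFieldType) (m n : nat).
Local Notation mat := 'M[C]_(m + (n + n)).

Definition gOmega : 'M[C]_(n + n) := block_mx 0 1%:M (- 1%:M) 0.
Local Notation Om := gOmega.

Lemma Omega_tr : Om^T = - Om.
Proof. by rewrite tr_block_mx !trmx0 linearN /= trmx1 opp_block_mx !oppr0 opprK. Qed.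

Lemma Omega_sq : Om *m Om = - 1%:M.
Proof.
rewrite mulmx_block !mul0mx !mulmx0 !addr0 !add0r mul1mx mulmx1 (scalar_mx_block n n).
by rewrite opp_block_mx oppr0.
Qed.

Lemma mulmx_OmegaK k (X : 'M[C]_(k, n + n)) : X *m Om *m Om = - X.
Proof. by rewrite -mulmxA Omega_sq mulmxN mulmx1. Qed.

Lemma mul_OmegaK_mx k (X : 'M[C]_(n + n, k)) : Om *m (Om *m X) = - X.
Proof. by rewrite mulmxA Omega_sq mulNmx mul1mx. Qed.

(* The adjoint for the orthosymplectic form, an anti-automorphism up to sign. *)
Definition tau (X : mat) : mat :=
  block_mx (ulsubmx X)^T ((dlsubmx X)^T *m Om)
           (Om *m (ursubmx X)^T) (- (Om *m (drsubmx X)^T *m Om)).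

Lemma tau_block A B D E : tau (block_mx A B D E) =
  block_mx A^T (D^T *m Om) (Om *m B^T) (- (Om *m E^T *m Om)).
Proof. by rewrite /tau block_mxKul block_mxKur block_mxKdl block_mxKdr. Qed.

Lemma tau_lin : linear tau.
Proof.
move=> a X Y; rewrite -[X]submxK -[Y]submxK scale_block_mx add_block_mx !tau_block scale_block_mx add_block_mx.
have tP k l c (U W : 'M[C]_(k, l)) : (c *: U + W)^T = c *: U^T + W^T by rewrite linearP.
by rewrite !tP !mulmxDl !mulmxDr !mulmxDl -!scalemxAr -!scalemxAl opprD scalerN.
Qed.

Lemma tauD X Y : tau (X + Y) = tau X + tau Y.
Proof. by have := tau_lin 1 X Y; rewrite !scale1r. Qed.
Lemma tauZ a X : tau (a *: X) = a *: tau X.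
Proof.
have t0 : tau 0 = 0 by apply: (addIr (tau 0)); rewrite -tauD !add0r.
by have := tau_lin a X 0; rewrite t0 !addr0.
Qed.
Lemma tauN X : tau (- X) = - tau X.
Proof. by rewrite -!scaleN1r tauZ. Qed.

Lemma tauK X : tau (tau X) = X.
Proof.
rewrite -[X]submxK !tau_block; congr block_mx; first by rewrite trmxK.
- by rewrite trmx_mul trmxK Omega_tr mulmxN mulNmx mulmx_OmegaK opprK.
- by rewrite trmx_mul trmxK Omega_tr mulNmx mulmxN mul_OmegaK_mx opprK.
- rewrite linearN /= !trmx_mul trmxK Omega_tr !mulmxN !mulNmx !mulmxN !mulNmx !opprK.
  by rewrite !mulmxA Omega_sq !mulNmx mul1mx mulmx_OmegaK opprK.
Qed.

Lemma tau_part p X : gmx_part p (tau X) = tau (gmx_part p X).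
Proof.
rewrite -[X]submxK; case: p; rewrite /gmx_part !tau_block ?block_mxKul ?block_mxKur ?block_mxKdl ?block_mxKdr;
  by rewrite ?trmx0 ?mulmx0 ?mul0mx ?oppr0.
Qed.

Lemma tau_hom p X : mxhom p X -> mxhom p (tau X).
Proof. by move=> hX; rewrite /mxhom tau_part hX. Qed.

Lemma tauM p q X Y : mxhom p X -> mxhom q Y ->
  tau (X *m Y) = (-1) ^+ (p && q) *: (tau Y *m tau X).
Proof.
move=> /mxhom_block -> /mxhom_block ->.
case: p; case: q; rewrite /= ?expr0 ?expr1 ?scale1r ?scaleN1r;
  rewrite !(mulmx_block, tau_block, mul0mx, mulmx0, addr0, add0r, trmx0, oppr0, opp_block_mx,
    trmx_mul, mulmxA, mulmxN, mulNmx, opprK, mulmx_OmegaK) //.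
Qed.

(** The signs in [tauM] and in the superbracket combine, so that [- tau] is an automorphism of
    gl(m|2n); osp(m|2n) is its fixed subalgebra. *)
Lemma tau_bracket X Y : tau (gsuperbracket X Y) = - gsuperbracket (tau X) (tau Y).
Proof.
elim/mxpart_ind: X => [p X hX|X X' hX hX']; last by rewrite superbracketDl !tauD hX hX' superbracketDl opprD.
elim/mxpart_ind: Y => [q Y hY|Y Y' hY hY']; last by rewrite superbracketDr !tauD hY hY' superbracketDr opprD.
rewrite (superbracket_hom hX hY) (superbracket_hom (tau_hom hX) (tau_hom hY)).
rewrite tauD tauN tauZ (tauM hX hY) (tauM hY hX) scalerA [q && p]andbC -expr2 sqrr_sign scale1r.
by rewrite opprB.
Qed.

Lemma supertrace_tau X : gsupertrace (tau X) = gsupertrace X.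
Proof.
rewrite -[X]submxK tau_block /gsupertrace !block_mxKul !block_mxKdr mxtrace_tr; congr (_ - _).
by rewrite linearN /= mxtrace_mulC mul_OmegaK_mx linearN /= opprK mxtrace_tr.
Qed.

Lemma supertrace_tauM X Y : gsupertrace (tau X *m tau Y) = gsupertrace (X *m Y).
Proof.
elim/mxpart_ind: X => [p X hX|X X' hX hX']; last by rewrite tauD !mulmxDl !supertraceD hX hX'.
elim/mxpart_ind: Y => [q Y hY|Y Y' hY hY']; last by rewrite tauD !mulmxDr !supertraceD hY hY'.
rewrite (supertraceC hX hY) -[in RHS]supertrace_tau (tauM hY hX) supertraceZ andbC mulrA.
by rewrite -expr2 sqrr_sign mul1r.
Qed.

Definition gosp : {vspace mat} :=
  lker (linfun (fun X : mat =>
    block_mx (ulsubmx X + (ulsubmx X)^T) 0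
             (dlsubmx X + Om *m (ursubmx X)^T)
             (drsubmx X - Om *m (drsubmx X)^T *m Om))).

(** The condition on the upper right block is equivalent to that on the lower left one, which is why
    three equations describe four blocks. *)
Lemma mem_gosp X : (X \in gosp) <-> tau X = - X.
Proof.
rewrite memv_ker linfun_linearE; last first.
  move=> a U W; rewrite -[U]submxK -[W]submxK scale_block_mx add_block_mx.
  rewrite !block_mxKul !block_mxKur !block_mxKdl !block_mxKdr scale_block_mx add_block_mx.
  have tP k l c (U' W' : 'M[C]_(k, l)) : (c *: U' + W')^T = c *: U'^T + W'^T by rewrite linearP.
  rewrite !tP !mulmxDr !mulmxDl -!scalemxAr -!scalemxAl !scaler0 addr0.
  by congr block_mx; rewrite ?scalerDr ?scalerN ?opprD // addrACA.
have [A [B [D [E ->]]]] : exists A B D E, X = block_mx A B D E.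
  by exists (ulsubmx X), (ursubmx X), (dlsubmx X), (drsubmx X); rewrite submxK.
rewrite tau_block block_mxKul block_mxKur block_mxKdl block_mxKdr opp_block_mx.
have z : 0 = block_mx 0 0 0 0 :> mat by rewrite -[LHS]submxK; congr block_mx; apply/matrixP => i j; rewrite !mxE.
split=> [/eqP|/eq_block_mx [h1 _ h3 h4]].
  rewrite z => /eq_block_mx [h1 _ h3 h4].
  have hD : D = - (Om *m B^T) by apply/eqP; rewrite -addr_eq0 h3.
  congr block_mx.
  - by apply/eqP; rewrite eq_sym -subr_eq0 -opprD oppr_eq0 h1.
  - by rewrite hD linearN /= trmx_mul trmxK Omega_tr mulmxN opprK mulmx_OmegaK.
  - by rewrite hD opprK.
  - by congr (- _); apply/esym/eqP; rewrite -subr_eq0 h4.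
rewrite z; apply/eqP; congr block_mx.
- by rewrite h1 subrr.
- by rewrite h3 subrr.
- by rewrite (oppr_inj h4) subrr.
Qed.

Lemma gosp_part p X : X \in gosp -> gmx_part p X \in gosp.
Proof. by move=> /mem_gosp hX; apply/mem_gosp; rewrite -tau_part hX -!scaleN1r mx_partZ. Qed.

Lemma gosp_bracket X Y : X \in gosp -> Y \in gosp -> gsuperbracket X Y \in gosp.
Proof.
move=> /mem_gosp hX /mem_gosp hY; apply/mem_gosp; rewrite tau_bracket hX hY.
by rewrite superbracketNl superbracketNr opprK.
Qed.

(** [Y - tau Y] lies in osp, and str(X tau Y) = - str(XY) for [X] in osp, so testing against it
    gives 2 str(XY) for arbitrary [Y]. *)
Lemma gosp_nondeg X : X \in gosp ->
  (forall Y, Y \in gosp -> gsupertrace (X *m Y) = 0) -> X = 0.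
Proof.
move=> /mem_gosp hX hY; apply: gsupertrace_nondeg => Y.
have := hY (Y - tau Y); rewrite mulmxBr supertraceD supertraceN.
have -> : gsupertrace (X *m tau Y) = - gsupertrace (X *m Y).
  rewrite -[X in LHS]opprK -hX mulNmx supertraceN supertrace_tauM.
  by [].
rewrite opprK => E; have {}E : gsupertrace (X *m Y) *+ 2 = 0.
  by rewrite mulr2n; apply: E; apply/mem_gosp; rewrite tauD tauN tauK opprB addrC.
by apply/eqP; move/eqP: E; rewrite mulrn_eq0.
Qed.

(** The Gram matrix of the orthosymplectic form on the natural module. *)
Definition gram : mat := block_mx 1%:M 0 0 Om.
(* For weight vectors u, v of the natural module, phi (u v^T) is a weight vector
   of osp whose weight is the sum of those of u and v. *)
Definition phi (Z : mat) : mat := Z *m gram - tau (Z *m gram).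

Lemma phi_lin : linear phi.
Proof.
move=> a X Y; rewrite /phi mulmxDl -scalemxAl tau_lin scalerBr opprD addrACA.
by [].
Qed.

Lemma phi_block A B D E : phi (block_mx A B D E) =
  block_mx (A - A^T) ((B - D^T) *m Om) (D - B^T) ((E + E^T) *m Om).
Proof.
rewrite /phi /gram mulmx_block !mulmx0 !mulmx1 !addr0 !add0r tau_block opp_block_mx add_block_mx.
rewrite !trmx_mul Omega_tr !mulNmx !mulmxN !mul_OmegaK_mx mulNmx !opprK mulmxBl mulmxDl.
by rewrite mulNmx opprK.
Qed.

Lemma phi_gosp Z : phi Z \in gosp.
Proof. by apply/mem_gosp; rewrite /phi tauD tauN tauK opprB addrC. Qed.

Lemma gram_even : mxhom false gram.
Proof. by rewrite /mxhom /gmx_part block_mxKul block_mxKdr. Qed.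

Lemma phi_hom p Z : mxhom p Z -> mxhom p (phi Z).
Proof.
move=> hZ; have hG : mxhom p (Z *m gram) by rewrite -[p]addbF; apply: mxhomM hZ gram_even.
by rewrite /phi addrC -scaleN1r; apply: mxhomP => //; apply: tau_hom.
Qed.

(** On osp the difference [X - tau X] is 2X, which explains the factor 1/2; [gi] inverts [gram]. *)
Lemma phi_surj X : X \in gosp -> exists Z, X = phi Z.
Proof.
move=> /mem_gosp hX; pose gi : mat := block_mx 1%:M 0 0 (- Om).
have gK : gi *m gram = 1%:M.
  rewrite mulmx_block !mulmx0 !mul0mx !addr0 !add0r mulmx1 mulNmx Omega_sq opprK.
  by rewrite -scalar_mx_block.
exists (2%:R^-1 *: (X *m gi)); rewrite /phi -scalemxAl -mulmxA gK mulmx1 tauZ hX scalerN opprK.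
rewrite -scalerDr -mulr2n -scaler_nat scalerA mulVf ?scale1r //.
by rewrite pnatr_eq0.
Qed.

(** [phi] intertwines the action on the tensor square of the natural module, sending u v^T to (Hu)
    v^T + u (Hv)^T, with the adjoint action. *)
Lemma phi_bracket H Z : mxhom false H -> tau H = - H -> H *m gram = gram *m H -> H^T = - H ->
  H *m phi Z - phi Z *m H = phi (H *m Z + Z *m H^T).
Proof.
move=> hH tH Hg Ht; rewrite -!(even_bracket _ hH).
rewrite /phi superbracketDr superbracketNr.
have -> : gsuperbracket H (tau (Z *m gram)) = tau (gsuperbracket H (Z *m gram)).
  by rewrite tau_bracket tH superbracketNl opprK.
have -> : gsuperbracket H (Z *m gram) = (H *m Z + Z *m H^T) *m gram.
  by rewrite even_bracket // Ht mulmxDl mulmxN mulNmx -!mulmxA Hg.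
by [].
Qed.

End SuperAdjoint.

(** * The torus of osp(m|2n) *)

Section OspTorus.
Variables (C : numClosedFieldType) (m n : nat).
Local Notation mat := 'M[C]_(m + (n + n)).
Local Notation Om := (gOmega C n).
Local Notation Q := ('I_(m./2) + 'I_n)%type.

Definition sp_ev (a : 'I_n) : 'cV[C]_(n + n) := delta_mx (lshift n a) 0.
Definition sp_od (a : 'I_n) : 'cV[C]_(n + n) := delta_mx (rshift n a) 0.

Definition osp_ev (q : Q) : 'cV[C]_(m + (n + n)) :=
  match q with inl k => col_mx (so_ev C k) 0 | inr a => col_mx 0 (sp_ev a) end.
Definition osp_od (q : Q) : 'cV[C]_(m + (n + n)) :=
  match q with inl k => col_mx (so_od C k) 0 | inr a => col_mx 0 (sp_od a) end.
Definition osp_z : 'cV[C]_(m + (n + n)) := col_mx (so_z C m) 0.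

Lemma sp_ev_ev p q : (sp_ev p)^T *m sp_ev q = ((p == q)%:R)%:M.
Proof. by rewrite delta_col_tr (inj_eq (@lshift_inj _ _)). Qed.
Lemma sp_od_od p q : (sp_od p)^T *m sp_od q = ((p == q)%:R)%:M.
Proof. by rewrite delta_col_tr (inj_eq (@rshift_inj _ _)). Qed.
Lemma sp_ev_od p q : (sp_ev p)^T *m sp_od q = 0.
Proof. by rewrite delta_col_tr eq_lrshift raddf0. Qed.

Let dot (a c : 'cV[C]_m) (b d : 'cV[C]_(n + n)) :
  (col_mx a b)^T *m col_mx c d = a^T *m c + b^T *m d.
Proof. by rewrite tr_col_mx mul_row_col. Qed.

Lemma osp_ev_ev p q : (osp_ev p)^T *m osp_ev q = ((p == q)%:R)%:M.
Proof.
by case: p q => [k|a] [l|b]; rewrite dot ?trmx0 ?mul0mx ?mulmx0 ?addr0 ?add0r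
  ?so_ev_ev ?sp_ev_ev ?raddf0.
Qed.
Lemma osp_od_od p q : (osp_od p)^T *m osp_od q = ((p == q)%:R)%:M.
Proof.
by case: p q => [k|a] [l|b]; rewrite dot ?trmx0 ?mul0mx ?mulmx0 ?addr0 ?add0r
  ?so_od_od ?sp_od_od ?raddf0.
Qed.
Lemma osp_ev_od p q : (osp_ev p)^T *m osp_od q = 0.
Proof.
by case: p q => [k|a] [l|b]; rewrite dot ?trmx0 ?mul0mx ?mulmx0 ?addr0 ?add0r
  ?so_ev_od ?sp_ev_od.
Qed.
Lemma osp_ev_z q : (osp_ev q)^T *m osp_z = 0.
Proof. by case: q => [k|a]; rewrite dot ?trmx0 ?mul0mx ?mulmx0 ?addr0 ?so_ev_z. Qed.
Lemma osp_od_z q : (osp_od q)^T *m osp_z = 0.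
Proof. by case: q => [k|a]; rewrite dot ?trmx0 ?mul0mx ?mulmx0 ?addr0 ?so_od_z. Qed.

Let ul (A : 'M[C]_m) : mat := block_mx A 0 0 0.
Let dr (D : 'M[C]_(n + n)) : mat := block_mx 0 0 0 D.

Lemma ul_lin : linear ul.
Proof. by move=> a X Y; rewrite /ul scale_block_mx add_block_mx !scaler0 !addr0. Qed.
Lemma dr_lin : linear dr.
Proof. by move=> a X Y; rewrite /dr scale_block_mx add_block_mx !scaler0 !addr0. Qed.

Lemma col_ul (a b : 'cV[C]_m) :
  col_mx a 0 *m (col_mx b 0)^T = ul (a *m b^T) :> mat.
Proof. by rewrite tr_col_mx mul_col_row trmx0 !mulmx0 !mul0mx. Qed.
Lemma col_dr (a b : 'cV[C]_(n + n)) :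
  col_mx 0 a *m (col_mx 0 b)^T = dr (a *m b^T) :> mat.
Proof. by rewrite tr_col_mx mul_col_row trmx0 !mulmx0 !mul0mx. Qed.

Lemma sp_complete : \sum_a (sp_ev a *m (sp_ev a)^T + sp_od a *m (sp_od a)^T) = 1%:M.
Proof.
rewrite mx1_sum_delta big_split_ord big_split /=; congr (_ + _); apply: eq_bigr => a _;
  by rewrite trmx_delta mul_delta_mx.
Qed.

Lemma osp_complete :
  \sum_q (osp_ev q *m (osp_ev q)^T + osp_od q *m (osp_od q)^T) + osp_z *m osp_z^T = 1%:M.
Proof.
rewrite big_sumType /= col_ul.
under eq_bigr => k _ do rewrite !col_ul -[ul _]scale1r -ul_lin scale1r.
under [X in _ + X + _]eq_bigr => a _ do rewrite !col_dr -[dr _]scale1r -dr_lin scale1r.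
rewrite -(linear_prop_sum _ _ _ ul_lin) -(linear_prop_sum _ _ _ dr_lin) sp_complete.
rewrite addrAC -[ul (\sum_(_ <- _ | _) _)]scale1r -ul_lin scale1r so_complete.
by rewrite /ul /dr add_block_mx !addr0 !add0r -scalar_mx_block.
Qed.

Local Notation rot := (rotation osp_ev osp_od).
Local Notation wv := (wvec osp_ev osp_od osp_z).

Definition gosp_torus (td : 'rV[C]_(m./2) * 'rV[C]_n) : mat :=
  block_mx (gso_torus td.1) 0
    0 ('i *: (Om *m block_mx (diag_mx td.2) 0 0 (diag_mx td.2))).

Definition torus_coef (td : 'rV[C]_(m./2) * 'rV[C]_n) (q : Q) : C :=
  match q with inl k => td.1 0 k | inr a => td.2 0 a end.

(** The symplectic torus also rotates planes, those of the basis vectors a and n + a, so orthogonal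
    and symplectic weights are treated by one construction. *)
Lemma sp_torusE (d : 'rV[C]_n) :
  'i *: (Om *m block_mx (diag_mx d) 0 0 (diag_mx d)) = rotation sp_ev sp_od (fun a => d 0 a).
Proof.
rewrite mulmx_block !mul0mx !mulmx0 !mul1mx mulNmx mul1mx !addr0 !add0r.
rewrite /rotation (eq_bigr (fun a => 'i *: (d 0 a *: (sp_ev a *m (sp_od a)^T - sp_od a *m (sp_ev a)^T))));
  last by move=> a _; rewrite /plane !scalerA mulrC.
rewrite -scaler_sumr; congr (_ *: _).
have E (a : 'I_n) : sp_ev a *m (sp_od a)^T - sp_od a *m (sp_ev a)^T =
    block_mx 0 (delta_mx a a) (- delta_mx a a) 0.
  rewrite !trmx_delta !mul_delta_mx; apply/matrixP => i j; rewrite !mxE.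
  by case: split_ordP => i' ->; rewrite !mxE; case: split_ordP => j' ->; rewrite !mxE
    ?(inj_eq (@lshift_inj _ _)) ?(inj_eq (@rshift_inj _ _)) ?eq_lrshift ?eq_rlshift /= ?andbF /=
    ?subr0 ?sub0r ?oppr0.
under eq_bigr => a _ do rewrite E.
apply/matrixP => i j; rewrite summxE !mxE.
case: split_ordP => i' Ei; rewrite !mxE; case: split_ordP => j' Ej.
- by rewrite mxE big1 // => a _; rewrite mxE Ei Ej block_mxEul mxE mulr0.
- by rewrite diag_mx_sum_delta summxE; apply: eq_bigr => a _; rewrite Ei Ej [RHS]mxE block_mxEur mxE.
- rewrite mxE diag_mx_sum_delta summxE -sumrN; apply: eq_bigr => a _.
  by rewrite Ei Ej [RHS]mxE block_mxEdl !mxE mulrN.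
- by rewrite mxE big1 // => a _; rewrite mxE Ei Ej block_mxEdr mxE mulr0.
Qed.

Lemma ul_scaleB a A B : a *: (ul A - ul B) = ul (a *: (A - B)).
Proof. by rewrite /ul opp_block_mx add_block_mx scale_block_mx !oppr0 !addr0 !scaler0. Qed.
Lemma dr_scaleB a A B : a *: (dr A - dr B) = dr (a *: (A - B)).
Proof. by rewrite /dr opp_block_mx add_block_mx scale_block_mx !oppr0 !addr0 !scaler0. Qed.

Lemma plane_inl k : plane osp_ev osp_od (inl k) = ul (plane (so_ev C (m := m)) (so_od C (m := m)) k).
Proof. by rewrite /plane /= !col_ul ul_scaleB. Qed.
Lemma plane_inr a : plane osp_ev osp_od (inr a) = dr (plane sp_ev sp_od a).
Proof. by rewrite /plane /= !col_dr dr_scaleB. Qed.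

Lemma gosp_torusE td : gosp_torus td = rot (torus_coef td).
Proof.
rewrite /gosp_torus gso_torusE sp_torusE /rotation big_sumType /=.
rewrite (eq_bigr (fun k => ul (td.1 0 k *: plane (so_ev C (m := m)) (so_od C (m := m)) k))); last first.
  by move=> k _; rewrite plane_inl /ul scale_block_mx !scaler0.
rewrite [X in _ + X](eq_bigr (fun a => dr (td.2 0 a *: plane sp_ev sp_od a))); last first.
  by move=> a _; rewrite plane_inr /dr scale_block_mx !scaler0.
rewrite -(linear_prop_sum _ _ _ ul_lin) -(linear_prop_sum _ _ _ dr_lin).
by rewrite /ul /dr add_block_mx !addr0 !add0r.
Qed.

Lemma gosp_torus_lin : linear gosp_torus.
Proof.
move=> a x y; rewrite !gosp_torusE /rotation scaler_sumr -big_split; apply: eq_bigr => q _ /=.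
by rewrite scalerA -scalerDl; congr (_ *: _); case: q => k /=; rewrite !mxE.
Qed.

Lemma gosp_torus_inj : lker (linfun gosp_torus) == 0%VS.
Proof.
rewrite -subv0; apply/subvP => td; rewrite memv_ker linfun_linearE; last exact: gosp_torus_lin.
rewrite gosp_torusE memv0 => /eqP E.
have E0 := rotation_inj osp_ev_ev osp_od_od osp_ev_od E.
case: td E0 {E} => t d E0; apply/eqP; congr (_, _); apply/rowP => k; rewrite mxE.
  exact: (E0 (inl k)).
exact: (E0 (inr k)).
Qed.

Lemma gosp_torus_even td : mxhom false (gosp_torus td).
Proof. by rewrite /mxhom /gmx_part block_mxKul block_mxKdr. Qed.

Lemma gosp_torus_tr td : (gosp_torus td)^T = - gosp_torus td.
Proof. by rewrite gosp_torusE rotation_tr. Qed.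

Lemma gosp_torus_comm x y : gosp_torus x *m gosp_torus y = gosp_torus y *m gosp_torus x.
Proof. by rewrite !gosp_torusE (rotation_comm osp_ev_ev osp_od_od osp_ev_od). Qed.

Lemma gosp_torus_gram td : gosp_torus td *m gram C m n = gram C m n *m gosp_torus td.
Proof.
rewrite /gosp_torus /gram !mulmx_block !mul0mx !mulmx0 !addr0 !add0r mulmx1 mul1mx; congr block_mx.
by rewrite -scalemxAl -scalemxAr !mulmx_block !mul0mx !mulmx0 !addr0 !add0r !mulmx1 !mul1mx ?mulNmx ?mulmxN ?mul1mx ?mulmx1.
Qed.

Lemma gosp_torus_tau td : tau (gosp_torus td) = - gosp_torus td.
Proof.
have := gosp_torus_tr td; rewrite /gosp_torus tau_block tr_block_mx opp_block_mx.
move=> /eq_block_mx [-> _ _ E]; rewrite E !trmx0 !mulmx0 !mul0mx !oppr0; congr block_mx.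
have := gosp_torus_gram td; rewrite /gosp_torus /gram !mulmx_block !mul0mx !mulmx0 !addr0 !add0r.
move=> /eq_block_mx [_ _ _ E2]; rewrite mulmxN mulNmx opprK -E2 mulmx_OmegaK.
by [].
Qed.

Lemma gosp_torus_gosp td : gosp_torus td \in gosp C m n.
Proof. by apply/mem_gosp; apply: gosp_torus_tau. Qed.

End OspTorus.

(** * Root vectors of osp(m|2n) *)

Section OspRoots.
Variables (C : numClosedFieldType) (m n : nat).
Local Notation mat := 'M[C]_(m + (n + n)).
Local Notation Q := ('I_(m./2) + 'I_n)%type.
Local Notation P := (option (Q * bool)).
Local Notation osp := (gosp C m n).
Local Notation ev := (@osp_ev C m n).
Local Notation od := (@osp_od C m n).
Local Notation wv := (wvec ev od (osp_z C m n)).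
Local Notation torus := (@gosp_torus C m n).

Definition gosp_cartan : {vspace gmx_superalgebra osp} := gmx_cartan osp (limg (linfun torus)).

Definition gosp_coord (H : subvs_of gosp_cartan) : 'rV[C]_(m./2) * 'rV[C]_n :=
  ((linfun torus)^-1)%VF (vsval (vsval H)).
Definition gosp_eps (i : 'I_(m./2)) : weight gosp_cartan :=
  linfun (fun H => ((gosp_coord H).1 ord0 i : C^o)).
Definition gosp_delta (a : 'I_n) : weight gosp_cartan :=
  linfun (fun H => ((gosp_coord H).2 ord0 a : C^o)).
Definition gosp_basic (q : Q) : weight gosp_cartan :=
  match q with inl k => gosp_eps k | inr a => gosp_delta a end.

Lemma mem_torus X : reflect (exists td, X = torus td) (X \in limg (linfun torus)).
Proof.
apply: (iffP idP) => [/memv_imgP [td _ ->]|[td ->]].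
  by exists td; rewrite linfun_linearE //; apply: gosp_torus_lin.
rewrite -(linfun_linearE (f := torus)); last exact: gosp_torus_lin.
by rewrite memv_img ?memvf.
Qed.

Lemma gosp_coordE (H : subvs_of gosp_cartan) td :
  vsval (vsval H) = torus td -> gosp_coord H = td.
Proof.
move=> E; rewrite /gosp_coord E -(linfun_linearE (f := torus)); last exact: gosp_torus_lin.
exact: (lker0_lfunK (gosp_torus_inj C m n)).
Qed.

Lemma cartan_torus (H : subvs_of gosp_cartan) : exists td, vsval (vsval H) = torus td.
Proof. by apply/mem_torus; rewrite -mem_mx_cartan subvsP. Qed.

Lemma gosp_coord_lin : linear gosp_coord.
Proof. by move=> a x y; rewrite /gosp_coord !linearP. Qed.

Lemma gosp_basicE (H : subvs_of gosp_cartan) td q :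
  vsval (vsval H) = torus td -> gosp_basic q H = torus_coef td q.
Proof.
move=> E; case: q => k /=; rewrite linfun_linearE ?(gosp_coordE E) //;
  by move=> a x y; rewrite gosp_coord_lin !mxE.
Qed.

Lemma cartan_ex td : exists H : subvs_of gosp_cartan, vsval (vsval H) = torus td.
Proof.
have gT : torus td \in osp by apply: gosp_torus_gosp.
have hT : vsproj osp (torus td) \in gosp_cartan.
  by rewrite mem_mx_cartan vsprojK //; apply/mem_torus; exists td.
by exists (vsproj gosp_cartan (vsproj osp (torus td))); rewrite vsprojK ?vsprojK.
Qed.

Lemma coef_delta q : exists td, forall p, torus_coef (C := C) (m := m) (n := n) td p = (p == q)%:R.
Proof.
case: q => k; first by exists (delta_mx 0 k, 0) => [[l|a]] /=; rewrite mxE.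
by exists (0, delta_mx 0 k) => [[l|a]] /=; rewrite mxE.
Qed.

Lemma gosp_dual q : exists H : subvs_of gosp_cartan, forall p, gosp_basic p H = (p == q)%:R.
Proof.
have [td htd] := coef_delta q; have [H EH] := cartan_ex td.
by exists H => p; rewrite (gosp_basicE p EH).
Qed.

Local Notation sw := (signed_weight gosp_basic).

Lemma gosp_weight_inj x y x' y' : sw x + sw y = sw x' + sw y' -> sw x + sw y <> 0 ->
  (x = x' /\ y = y') \/ (x = y' /\ y = x').
Proof.
have /choice [hh Hh] := gosp_dual.
apply: (@signed_pair_inj _ _ _ _ (fun q (w : weight gosp_cartan) => w (hh q) : C)).
- by move=> q u v; rewrite lfunE.
- by move=> q a u; rewrite lfunE.
- by move=> p q; apply: Hh.
Qed.

Lemma sw_eval x (H : subvs_of gosp_cartan) td : vsval (vsval H) = torus td ->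
  sw x H = wcoef (torus_coef td) x.
Proof. by move=> E; case: x => [[q s]|] /=; rewrite lfunE //= (gosp_basicE q E). Qed.

Lemma sw_eq0 x y : sw x + sw y = 0 -> y = sflip x.
Proof.
move=> /eqP; rewrite addrC addr_eq0 -signed_weight_flip => /eqP.
have /choice [hh Hh] := gosp_dual.
apply: (@signed_weight_inj _ _ _ _ (fun q (w : weight gosp_cartan) => w (hh q) : C)).
- by move=> q a u; rewrite lfunE.
- by move=> p q; apply: Hh.
Qed.

Definition osp_outer (xy : P * P) : mat := wv xy.1 *m (wv xy.2)^T.
Definition vec_parity (x : P) : bool := if x is Some (inr _, _) then true else false.

Lemma wv_col x : wv x = if vec_parity x then col_mx 0 (dsubmx (wv x)) else col_mx (usubmx (wv x)) 0.
Proof.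
case: x => [[[k|a] s]|] /=; rewrite ?scale_col_mx ?opp_col_mx ?add_col_mx ?scaler0 ?oppr0 ?addr0;
  by rewrite ?col_mxKu ?col_mxKd.
Qed.

Lemma osp_outer_block xy : exists A B D E,
  [/\ osp_outer xy = block_mx A B D E,
      vec_parity xy.1 && vec_parity xy.2 -> [/\ A = 0, B = 0 & D = 0],
      ~~ (vec_parity xy.1 && vec_parity xy.2) -> E = 0
    & if vec_parity xy.1 (+) vec_parity xy.2 then A = 0 /\ E = 0 else B = 0 /\ D = 0].
Proof.
case: xy => x y; rewrite /osp_outer /= (wv_col x) (wv_col y).
by case: (vec_parity x); case: (vec_parity y); do 4!eexists;
  rewrite /= tr_col_mx mul_col_row ?trmx0 ?mulmx0 ?mul0mx; split.
Qed.

Lemma osp_outer_hom xy : mxhom (vec_parity xy.1 (+) vec_parity xy.2) (osp_outer xy).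
Proof.
have [A [B [D [E [-> _ _]]]]] := osp_outer_block xy.
rewrite /mxhom /gmx_part; case: (_ (+) _) => [] [-> ->];
  by rewrite ?block_mxKul ?block_mxKur ?block_mxKdl ?block_mxKdr.
Qed.

(** [phi] factors through the super exterior square: it is symmetric on two symplectic vectors and
    antisymmetric otherwise. *)
Lemma osp_outer_swap x y : phi (osp_outer (y, x)) \in <[phi (osp_outer (x, y))]>%VS.
Proof.
have -> : osp_outer (y, x) = (osp_outer (x, y))^T by rewrite /osp_outer trmx_mul trmxK.
have [A [B [D [E [-> h1 h2 _]]]]] := osp_outer_block (x, y).
rewrite tr_block_mx !phi_block !trmxK; case: (boolP (_ && _)) h1 h2 => _ h1 h2.
  have [-> -> ->] := h1 isT; rewrite !trmx0 !subrr mul0mx [E^T + E]addrC.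
  exact: memv_line.
rewrite (h2 isT) trmx0 addr0 mul0mx.
rewrite -[A^T - A]opprB -[D^T - B]opprB -[B^T - D]opprB mulNmx.
rewrite -[X in block_mx _ _ _ X]oppr0 -opp_block_mx -scaleN1r memvZ ?memv_line //.
Qed.

Lemma plane_torus c q : c *: plane ev od q \in limg (linfun torus).
Proof.
have [td htd] := coef_delta q; apply: memvZ; apply/mem_torus; exists td.
rewrite gosp_torusE /rotation (bigD1 q) //= htd eqxx scale1r big1 ?addr0 // => p pq.
by rewrite htd (negPf pq) scale0r.
Qed.

Lemma sp_ev_Omega a : (sp_ev C a)^T *m gOmega C n = (sp_od C a)^T.
Proof.
rewrite !trmx_delta -rowE; apply/rowP => j; rewrite [LHS]mxE /gOmega.
case: (split_ordP j) => b ->; rewrite ?block_mxEul ?block_mxEur !mxE.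
  by rewrite eq_lrshift.
by rewrite (inj_eq (@rshift_inj _ _)) eq_sym.
Qed.
Lemma sp_od_Omega a : (sp_od C a)^T *m gOmega C n = - (sp_ev C a)^T.
Proof. by rewrite -sp_ev_Omega mulmx_OmegaK. Qed.

(** Opposite weights belong to one plane, and [phi] of the product of their vectors is a multiple of
    the generator of rotations there; for the fixed vector it is 0. *)
Lemma osp_outer_zero x y : sw x + sw y = 0 -> phi (osp_outer (x, y)) \in limg (linfun torus).
Proof.
move=> /sw_eq0 ->; case: x => [[q s]|] /=; last first.
  rewrite /osp_outer /= /osp_z col_ul phi_block trmx_mul trmxK subrr !trmx0 subrr addr0 !mul0mx.
  by rewrite subrr block_mx_const mem0v.
have ii : 'i * 'i = -1 :> C by rewrite -expr2 sqrCi.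
have ss : (-1) ^+ (~~ s) = - (-1) ^+ s :> C by case: (s); rewrite ?expr0 ?expr1 ?opprK.
have s2 : (-1) ^+ s * (-1) ^+ s = 1 :> C by rewrite -expr2 sqrr_sign.
rewrite /osp_outer /= ss; move: ((-1) ^+ s) s2 => e s2.
case: q => k /=; rewrite !scale_col_mx !opp_col_mx !add_col_mx !scaler0 !oppr0 !addr0.
  rewrite col_ul phi_block !trmx0 !subr0 addr0 !mul0mx.
  suff -> : block_mx ((so_ev C k - (e * 'i) *: so_od C k) *m (so_ev C k - (- e * 'i) *: so_od C k)^T -
      ((so_ev C k - (e * 'i) *: so_od C k) *m (so_ev C k - (- e * 'i) *: so_od C k)^T)^T) 0 0 0 =
      (2%:R * e) *: plane ev od (inl k) by exact: plane_torus.
  rewrite plane_inl scale_block_mx !scaler0; congr block_mx.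
  by apply/matrixP => i j; rewrite !mxE !big_ord1 !mxE; ring.
rewrite col_dr phi_block !trmx0 !subr0 !mul0mx.
suff -> : ((sp_ev C k - (e * 'i) *: sp_od C k) *m (sp_ev C k - (- e * 'i) *: sp_od C k)^T +
    ((sp_ev C k - (e * 'i) *: sp_od C k) *m (sp_ev C k - (- e * 'i) *: sp_od C k)^T)^T) *m gOmega C n =
    (- (2%:R * 'i)) *: plane (@sp_ev C n) (@sp_od C n) k.
  have -> : block_mx 0 0 0 (- (2%:R * 'i) *: plane (@sp_ev C n) (@sp_od C n) k) =
      (- (2%:R * 'i)) *: plane ev od (inr k) by rewrite plane_inr scale_block_mx !scaler0.
  exact: plane_torus.
(* Symmetrizing leaves a multiple of ev ev^T + od od^T, and right multiplication by Omega turns this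
   into ev od^T - od ev^T. *)
have -> : (sp_ev C k - (e * 'i) *: sp_od C k) *m (sp_ev C k - (- e * 'i) *: sp_od C k)^T +
    ((sp_ev C k - (e * 'i) *: sp_od C k) *m (sp_ev C k - (- e * 'i) *: sp_od C k)^T)^T =
    2%:R *: (sp_ev C k *m (sp_ev C k)^T - ((e * e) * ('i * 'i)) *: (sp_od C k *m (sp_od C k)^T)).
  by apply/matrixP => i j; rewrite !mxE !big_ord1 !mxE; ring.
rewrite s2 mul1r ii scaleN1r opprK -scalemxAl mulmxDl -!mulmxA sp_ev_Omega sp_od_Omega mulmxN.
rewrite /plane scalerA; congr (_ *: _).
have -> : - (2%:R * 'i) * 'i = - ('i * 'i) * 2%:R :> C by ring.
by rewrite ii opprK mul1r.
Qed.

Lemma phiZ a (Z : mat) : phi (a *: Z) = a *: phi Z.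
Proof.
have z0 : phi (0 : mat) = 0.
  by apply: (addIr (phi (0 : mat))); rewrite -{1}[phi 0]scale1r -phi_lin scale1r !add0r.
by have := phi_lin a Z 0; rewrite z0 !addr0.
Qed.

(** All ordered pairs of weights of the natural module serve as indices, so a root vector with two
    distinct factors appears twice; [osp_outer_swap] makes the two copies proportional. *)
Lemma gosp_basic_structure c : c != 0 -> basic_structure (gstr_form c (g := osp)) gosp_cartan.
Proof.
move=> c0; pose t := limg (linfun torus).
have hpart := @gosp_part C m n; have hbr := @gosp_bracket C m n; have hnd := @gosp_nondeg C m n.
apply: (@mx_basic_structure _ _ _ osp t c c0 hpart hbr _ _ hnd _
  (fun xy : P * P => phi (osp_outer xy)) (fun xy => sw xy.1 + sw xy.2)
  (fun xy => vec_parity xy.1 (+) vec_parity xy.2)).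
- by move=> T /mem_torus [td ->]; apply: gosp_torus_even.
- by move=> T T' /mem_torus [td ->] /mem_torus [td' ->]; apply: gosp_torus_comm.
- by move=> xy; apply: phi_gosp.
- by move=> xy; apply: phi_hom; apply: osp_outer_hom.
- move=> [x y] T /=; have [td E] := cartan_torus T.
  rewrite lfunE /= (sw_eval x E) (sw_eval y E) E.
  rewrite (phi_bracket _ (gosp_torus_even td) (gosp_torus_tau td) (gosp_torus_gram td) (gosp_torus_tr td)).
  have hw z : torus td *m wv z = wcoef (torus_coef td) z *: wv z.
    rewrite gosp_torusE; apply: rotation_wvec.
    - exact: osp_ev_ev.
    - exact: osp_od_od.
    - exact: osp_ev_od.
    - exact: osp_ev_z.
    - exact: osp_od_z.
  rewrite -phiZ /osp_outer /= mulmxA hw -scalemxAl -mulmxA -trmx_mul hw linearZ /= -scalemxAr.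
  by rewrite scalerDl.
- by move=> [x y] /= /osp_outer_zero.
- move=> [x y] [x' y'] /= E nz; case: (gosp_weight_inj E nz) => [[-> ->]|[-> ->]]; first exact: memv_line.
  exact: osp_outer_swap.
move=> S tS wS; apply/subvP => X /phi_surj [Z ->].
have [k ->] : exists k : P -> P -> C, Z = \sum_x \sum_y k x y *: (wv x *m (wv y)^T).
  apply: wvec_span; exact: osp_complete.
pose ph := linfun (@phi C m n).
have phE : ph =1 @phi C m n by apply: linfun_linearE; apply: phi_lin.
rewrite -phE linear_sum; apply: memv_suml => x _; rewrite linear_sum; apply: memv_suml => y _.
by rewrite linearZ /= phE; apply: memvZ; apply: (wS (x, y)).
Qed.

End OspRoots.

(** * Distinctness of the listed positive even roots *)

Section SignedPairList.
Variables (V : zmodType) (Q : eqType) (b : Q -> V).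
Local Notation P := (option (Q * bool)).

(** [signed_weight] without scalars, so that the sums are convertible, up to a summand 0, to the
    entries of the lists of positive roots. *)
Definition signed (x : P) : V := if x is Some (q, s) then if s then - b q else b q else 0.

Hypothesis signed_inj : forall x y x' y', signed x + signed y = signed x' + signed y' ->
  signed x + signed y <> 0 -> (x = x' /\ y = y') \/ (x = y' /\ y = x').
Hypothesis signed_eq0 : forall x y, signed x + signed y = 0 -> y = sflip x.

Variable code : P -> nat.
Hypothesis code_inj : injective code.

(** A nonzero sum determines an unordered pair, and the order of the codes singles out one of its
    two orderings. *)
Lemma signed_sums_uniq (l : seq (P * P)) : uniq l ->
  (forall xy, xy \in l -> (code xy.1 <= code xy.2)%N /\ xy.2 != sflip xy.1) ->
  uniq [seq signed xy.1 + signed xy.2 | xy <- l].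
Proof.
move=> ul hl; rewrite map_inj_in_uniq // => [[x y] [x' y']] /hl /= [c1 n1] /hl /= [c2 _] E.
have nz : signed x + signed y <> 0 by move=> /signed_eq0 E0; rewrite E0 eqxx in n1.
case: (signed_inj E nz) => [[-> ->] //|[Ex Ey]]; subst.
by have -> : x' = y' by apply: code_inj; apply/eqP; rewrite eqn_leq c2 c1.
Qed.

End SignedPairList.

Lemma signedE (K : numFieldType) (V : lmodType K) (Q : eqType) (b : Q -> V) x :
  signed b x = signed_weight b x.
Proof. by case: x => [[q []]|] /=; rewrite ?expr0 ?expr1 ?scale1r ?scaleN1r. Qed.

Section OspPositive.
Variables (V : zmodType) (r n : nat) (o : bool) (b : ('I_r + 'I_n)%type -> V).
Local Notation P := (option (('I_r + 'I_n) * bool)).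

(* Numbers the signed weights so that both components of each pair in osp_pairs
   are in nondecreasing order: the unordered pair then determines the pair. *)
Definition osp_code (x : P) : nat := match x with
  | Some (inr a, s) => a + (s : nat) * n
  | Some (inl i, s) => (n + n) + (i + (s : nat) * r)
  | None => (n + n) + (r + r) end.

Lemma osp_code_inj : injective osp_code.
Proof.
have ordE k (i j : 'I_k) : (i : nat) = j -> i = j by apply: val_inj.
move=> [[[i|i] s]|] [[[j|j] t]|] //; try (have hi := ltn_ord i); try (have hj := ltn_ord j);
  try (case: s); try (case: t); rewrite /osp_code /= => E;
  try (by exfalso; move: hi E; lia); try (by exfalso; move: hj E; lia);
  try (by exfalso; move: hi hj E; lia);
  by (have -> : i = j by (apply: ordE; move: hi hj E; lia)).
Qed.

(** Twice delta_a is the pair of delta_a with itself, and eps_i is paired with the weight 0. *)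
Definition osp_pairs : seq (P * P) :=
  [seq (Some (inr ij.1, false), Some (inr ij.2, false)) | ij <- ltpairs n]
  ++ [seq (Some (inr ij.1, false), Some (inr ij.2, true)) | ij <- ltpairs n]
  ++ [seq (Some (inr a, false), Some (inr a, false)) | a <- enum 'I_n]
  ++ [seq (Some (inl ij.1, false), Some (inl ij.2, false)) | ij <- ltpairs r]
  ++ [seq (Some (inl ij.1, false), Some (inl ij.2, true)) | ij <- ltpairs r]
  ++ (if o then [seq (Some (inl i, false), None) | i <- enum 'I_r] else [::]).

(** The number of the block of [osp_pairs] that contains the pair, so that disjointness of the
    blocks is a comparison of numbers. *)
Definition osp_tag (xy : P * P) : nat := match xy with
  | (Some (inr a, _), Some (inr c, s)) => if s then 1 else if a == c then 2 else 0
  | (Some (inl _, _), Some (inl _, s)) => if s then 4 else 3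
  | _ => 5 end.

Lemma mem_ltpairs k (ij : 'I_k * 'I_k) : (ij \in ltpairs k) = (ij.1 < ij.2)%N.
Proof. by rewrite mem_enum. Qed.

Lemma uniq_cat_tag (T : eqType) (tag : T -> nat) k (l1 l2 : seq T) :
  uniq l1 -> all (fun x => tag x == k) l1 -> uniq l2 -> all (fun x => (k < tag x)%N) l2 ->
  uniq (l1 ++ l2).
Proof.
move=> u1 /allP t1 u2 /allP t2; rewrite cat_uniq u1 u2 andbT; apply/hasPn => x /t2 lt.
by apply/negP => /t1 /eqP E; rewrite E ltnn in lt.
Qed.

Let ne_lt k (ij : 'I_k * 'I_k) : ij \in ltpairs k -> (ij.1 == ij.2) = false.
Proof. by rewrite mem_ltpairs; apply: contraTF => /eqP ->; rewrite ltnn. Qed.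

Lemma osp_pairs_uniq : uniq osp_pairs.
Proof.
rewrite /osp_pairs.
have u1 : uniq (ltpairs n) by apply: enum_uniq.
have u2 : uniq (ltpairs r) by apply: enum_uniq.
apply: (@uniq_cat_tag _ osp_tag 0).
- by rewrite map_inj_uniq // => [[i j] [k l]] /= [-> ->].
- by rewrite all_map; apply/allP => ij hij /=; rewrite ne_lt.
- apply: (@uniq_cat_tag _ osp_tag 1).
  + by rewrite map_inj_uniq // => [[i j] [k l]] /= [-> ->].
  + by rewrite all_map; apply/allP => ij hij /=.
  + apply: (@uniq_cat_tag _ osp_tag 2).
    * by rewrite map_inj_uniq ?enum_uniq // => i j [->].
    * by rewrite all_map; apply/allP => i hi /=; rewrite eqxx.
    * apply: (@uniq_cat_tag _ osp_tag 3).
      -- by rewrite map_inj_uniq // => [[i j] [k l]] /= [-> ->].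
      -- by rewrite all_map; apply/allP => ij hij /=.
      -- apply: (@uniq_cat_tag _ osp_tag 4).
         ++ by rewrite map_inj_uniq // => [[i j] [k l]] /= [-> ->].
         ++ by rewrite all_map; apply/allP => ij hij /=.
         ++ by case: o => //; rewrite map_inj_uniq ?enum_uniq // => i j [->].
         ++ by case: o => //; rewrite all_map; apply/allP.
      -- by rewrite all_cat all_map; apply/andP; split; [apply/allP | case: o => //; rewrite all_map; apply/allP].
    * rewrite !all_cat !all_map; apply/andP; split; first exact/allP.
      by apply/andP; split; [apply/allP | case: o => //; rewrite all_map; apply/allP].
  + rewrite !all_cat !all_map; apply/andP; split; first by apply/allP => i _ /=; rewrite eqxx.
    apply/andP; split; first exact/allP.
    by apply/andP; split; [apply/allP | case: o => //; rewrite all_map; apply/allP].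
- rewrite !all_cat !all_map; apply/andP; split; first exact/allP.
  apply/andP; split; first by apply/allP => i _ /=; rewrite eqxx.
  apply/andP; split; first exact/allP.
  by apply/andP; split; [apply/allP | case: o => //; rewrite all_map; apply/allP].
Qed.

Lemma osp_pairs_code xy : xy \in osp_pairs ->
  (osp_code xy.1 <= osp_code xy.2)%N /\ xy.2 != sflip xy.1.
Proof.
rewrite /osp_pairs !mem_cat => /or4P [| | |/or3P []].
- by move=> /mapP [ij]; rewrite mem_ltpairs => lt -> /=; split; [rewrite /= !mul0n !addn0 ltnW | apply/eqP; case].
- move=> /mapP [ij]; rewrite mem_ltpairs => lt -> /=; split.
    by have := ltn_ord ij.1; rewrite mul0n mul1n; lia.
  by apply/eqP => -[E]; rewrite E ltnn in lt.
- by move=> /mapP [a _ ->] /=; split=> //; apply/eqP; case.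
- by move=> /mapP [ij]; rewrite mem_ltpairs => lt -> /=; split; [rewrite !mul0n !addn0 leq_add2l ltnW | apply/eqP; case].
- move=> /mapP [ij]; rewrite mem_ltpairs => lt -> /=; split.
    by have := ltn_ord ij.1; rewrite mul0n mul1n; lia.
  by apply/eqP => -[E]; rewrite E ltnn in lt.
- case: o => // /mapP [i _ ->] /=; split=> //.
  by have := ltn_ord i; rewrite mul0n; lia.
Qed.

Hypothesis signed_inj : forall x y x' y',
  signed b x + signed b y = signed b x' + signed b y' ->
  signed b x + signed b y <> 0 -> (x = x' /\ y = y') \/ (x = y' /\ y = x').
Hypothesis signed_eq0 : forall x y, signed b x + signed b y = 0 -> y = sflip x.

Lemma osp_positive_uniq :
  uniq ([seq b (inr ij.1) + b (inr ij.2) | ij <- ltpairs n]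
  ++ [seq b (inr ij.1) - b (inr ij.2) | ij <- ltpairs n]
  ++ [seq b (inr a) *+ 2 | a <- enum 'I_n]
  ++ [seq b (inl ij.1) + b (inl ij.2) | ij <- ltpairs r]
  ++ [seq b (inl ij.1) - b (inl ij.2) | ij <- ltpairs r]
  ++ (if o then [seq b (inl i) | i <- enum 'I_r] else [::])).
Proof.
have := signed_sums_uniq signed_inj signed_eq0 osp_code_inj osp_pairs_uniq osp_pairs_code.
rewrite /osp_pairs !map_cat -!map_comp.
case: (o) => //; rewrite -map_comp.
(* The roots eps_i are the one block where the sum is not convertible to the listed root, because of
   the summand 0. *)
rewrite [X in uniq (_ ++ _ ++ _ ++ _ ++ _ ++ X)](eq_map (g := fun i => b (inl i))) //.
by move=> i /=; rewrite addr0.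
Qed.

End OspPositive.

Lemma osp_data_basic (R : realType) (m n : nat) :
  basic_structure (bd_form (osp_data R m n)) (bd_cartan (osp_data R m n)).
Proof.
have two : (2%:R^-1 : R[i]) != 0 by rewrite invr_eq0 pnatr_eq0.
exact: (gosp_basic_structure m n two).
Qed.

Lemma osp_data_pos0_uniq (R : realType) (m n : nat) : uniq (bd_pos0 (osp_data R m n)).
Proof.
pose b (q : 'I_(m./2) + 'I_n) : weight (osp_cartan R m n) :=
  match q with inl k => osp_eps R n k | inr a => osp_delta R m a end.
have /choice [hh Hh] : forall q, exists H : subvs_of (osp_cartan R m n), forall p, b p H = (p == q)%:R.
  exact_no_check (@gosp_dual R[i] m n).
pose ev q (w : weight (osp_cartan R m n)) := w (hh q) : R[i].
have evD q u v : ev q (u + v) = ev q u + ev q v by rewrite /ev lfunE.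
have evZ q a u : ev q (a *: u) = a * ev q u by rewrite /ev lfunE.
have evb p q : ev q (b p) = (p == q)%:R by apply: Hh.
have sE x : signed b x = signed_weight b x by apply: signedE.
have inj x y x' y' : signed b x + signed b y = signed b x' + signed b y' ->
    signed b x + signed b y <> 0 -> (x = x' /\ y = y') \/ (x = y' /\ y = x').
  rewrite !sE; exact: (signed_pair_inj evD evZ evb).
have eq0 x y : signed b x + signed b y = 0 -> y = sflip x.
  move=> /eqP; rewrite !sE addrC addr_eq0 -signed_weight_flip => /eqP.
  exact: (signed_weight_inj evZ evb).
have := @osp_positive_uniq _ (m./2) n (odd m) b inj eq0.
by [].
Qed.

(** * The Killing form *)

Section EndoTrace.
Variable K : fieldType.

Definition etr (V : vectType K) (f : 'End(V)) : K :=
  \sum_(i < \dim {:V}) coord (vbasis {:V}) i (f (vbasis {:V})`_i).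

Lemma etrC (U V : vectType K) (f : 'Hom(U, V)) (k : 'Hom(V, U)) :
  etr (k \o f)%VF = etr (f \o k)%VF.
Proof.
have E (U' V' : vectType K) (f' : 'Hom(U', V')) (k' : 'Hom(V', U')) : etr (k' \o f')%VF =
    \sum_(i < \dim {:U'}) \sum_(j < \dim {:V'}) coord (vbasis {:V'}) j (f' (vbasis {:U'})`_i) * coord (vbasis {:U'}) i (k' (vbasis {:V'})`_j).
  apply: eq_bigr => i _; rewrite lfunE /= {1}(coord_vbasis (memvf (f' (vbasis {:U'})`_i))).
  by rewrite !linear_sum /=; apply: eq_bigr => j _; rewrite !linearZ.
by rewrite !E exchange_big; apply: eq_bigr => j _; apply: eq_bigr => i _; rewrite mulrC.
Qed.

Lemma etrP (V : vectType K) a (f k : 'End(V)) : etr (a *: f + k) = a * etr f + etr k.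
Proof.
rewrite /etr mulr_sumr -big_split; apply: eq_bigr => i _ /=.
by rewrite lfunE /= lfunE /= linearP.
Qed.

Lemma etr_id (V : vectType K) : etr (\1%VF : 'End(V)) = (\dim {:V})%:R.
Proof.
rewrite /etr (eq_bigr (fun=> 1)) => [|i _]; first by rewrite sumr_const card_ord.
by rewrite lfunE /= coord_free ?eqxx // (basis_free (vbasisP _)).
Qed.

End EndoTrace.

Section KillingForm.
Variables (K : numFieldType) (g : superalgebra K).
Hypothesis lie : is_lie_superalgebra g.
Local Notation br := (sa_br g).
Local Notation part := (sa_part g).
Local Notation ad x := (linfun (br x)).

Lemma lie_linl z : linear (fun x => br x z).
Proof. by have [[h1 h2] _ _ _ _] := lie; move=> a x y; apply: h1. Qed.
Lemma lie_linr z : linear (br z).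
Proof. by have [[h1 h2] _ _ _ _] := lie; move=> a x y; apply: h2. Qed.

Definition parity_end : 'End(g) :=
  (daddv_pi (part false) (part true) - daddv_pi (part true) (part false))%R.

Lemma supertraceE (f : 'End(g)) : supertrace_end f = etr (parity_end \o f)%VF.
Proof. by apply: eq_bigr => i _; rewrite [in RHS]lfunE. Qed.

Lemma parity_endE p x : x \in part p -> parity_end x = (-1) ^+ p *: x.
Proof.
have [_ [hsum hcap] _ _ _] := lie; move=> hx.
have hcap' : (part true :&: part false)%VS = 0%VS by rewrite capvC.
rewrite /parity_end !lfunE /= lfunE /=; case: p hx => hx.
  have E := daddv_pi_add hcap' (subvP (addvSl _ _) _ hx).
  have E1 := daddv_pi_id hcap' hx; move: E; rewrite E1 => /eqP; rewrite -subr_eq0 addrAC subrr add0r => /eqP ->.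
  by rewrite sub0r expr1 scaleN1r.
have E := daddv_pi_add hcap (subvP (addvSl _ _) _ hx).
have E1 := daddv_pi_id hcap hx; move: E; rewrite E1 => /eqP; rewrite -subr_eq0 addrAC subrr add0r => /eqP ->.
by rewrite subr0 expr0 scale1r.
Qed.

Lemma lie_decomp x : exists x0 x1, [/\ x0 \in part false, x1 \in part true & x = x0 + x1].
Proof.
have [_ [hsum _] _ _ _] := lie.
have : x \in (part false + part true)%VS by rewrite hsum memvf.
by case/memv_addP => x0 h0 [x1 h1 ->]; exists x0, x1.
Qed.

Lemma lie_part_ind (P : g -> Prop) : (forall p x, x \in part p -> P x) ->
  (forall x y, P x -> P y -> P (x + y)) -> forall x, P x.
Proof.
by move=> hp hD x; have [x0 [x1 [h0 h1 ->]]] := lie_decomp x; apply: hD; apply: hp; eassumption.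
Qed.

Definition ehom p (f : 'End(g)) := forall q x, x \in part q -> f x \in part (p (+) q).

Lemma ehom_comp p q f k : ehom p f -> ehom q k -> ehom (p (+) q) (f \o k)%VF.
Proof. by move=> hf hk r x hx; rewrite lfunE /= -addbA; apply: hf; apply: hk. Qed.

Lemma ehom_parity p f : ehom p f -> (parity_end \o f = (-1) ^+ p *: (f \o parity_end))%VF.
Proof.
move=> hf; apply/lfunP => x; rewrite comp_lfunE scale_lfunE comp_lfunE.
elim/lie_part_ind: x => [q x hx|x y hx hy]; last by rewrite !linearD /= hx hy.
rewrite (parity_endE (hf _ _ hx)) (parity_endE hx) linearZ /= scalerA; congr (_ *: _).
by case: (p); case: (q); rewrite /= ?expr0 ?expr1 ?mulr1 ?mul1r ?mulrNN ?mulr1.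
Qed.

Lemma etrZ (f : 'End(g)) a : etr (a *: f) = a * etr f.
Proof.
have e0 : etr (0 : 'End(g)) = 0 by rewrite /etr big1 // => i _; rewrite lfunE /= linear0.
by have := etrP a f 0; rewrite e0 !addr0.
Qed.

Lemma supertrace_endZ a f : supertrace_end (a *: f : 'End(g)) = a * supertrace_end f.
Proof. by rewrite !supertraceE -etrZ comp_lfunZr. Qed.
Lemma supertrace_endD f k : supertrace_end (f + k : 'End(g)) = supertrace_end f + supertrace_end k.
Proof. by rewrite !supertraceE comp_lfunDr -[X in etr (X + _)]scale1r etrP mul1r. Qed.

(** Cyclicity moves the parity operator around [f] at the price of a sign, so the supertrace is its
    own negative. *)
Lemma supertrace_end_odd f : ehom true f -> supertrace_end f = 0.
Proof.
move=> hf; have : supertrace_end f = - supertrace_end f.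
  by rewrite {1}supertraceE (ehom_parity hf) etrZ etrC -supertraceE expr1 mulN1r.
by move=> /eqP; rewrite -addr_eq0 -mulr2n mulrn_eq0 /= => /eqP.
Qed.

(** For equal parities the sign comes from moving the parity operator past [f], and the ordinary
    trace is cyclic; for different parities both sides are supertraces of odd maps. *)
Lemma supertrace_endC p q f k : ehom p f -> ehom q k ->
  supertrace_end (f \o k)%VF = (-1) ^+ (p && q) * supertrace_end (k \o f)%VF.
Proof.
move=> hf hk; have [pq|pq] := eqVneq p q; last first.
  rewrite !supertrace_end_odd ?mulr0 //.
    by have := ehom_comp hk hf; case: (p) (q) pq => [] [].
  by have := ehom_comp hf hk; case: (p) (q) pq => [] [].
rewrite -pq andbb !supertraceE comp_lfunA (ehom_parity hf) -comp_lfunZl etrZ.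
by rewrite -comp_lfunA [in LHS]etrC -comp_lfunA.
Qed.

Lemma ad_hom p x : x \in part p -> ehom p (ad x).
Proof.
have [_ _ hp _ _] := lie; move=> hx q y hy; rewrite linfun_linearE; first exact: hp.
exact: lie_linr.
Qed.

Lemma adE x y : ad x y = br x y.
Proof. by rewrite linfun_linearE //; apply: lie_linr. Qed.

Lemma adP a x y : ad (a *: x + y) = a *: ad x + ad y.
Proof. by apply/lfunP => z; rewrite lfunE /= lfunE /= !adE lie_linl. Qed.

Lemma ad_br p q x y : x \in part p -> y \in part q ->
  ad (br x y) = (ad x \o ad y - (-1) ^+ (p && q) *: (ad y \o ad x))%VF.
Proof.
have [_ _ _ _ jac] := lie; move=> hx hy; apply/lfunP => z.
rewrite add_lfunE opp_lfunE scale_lfunE !comp_lfunE !adE.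
by rewrite (jac p q x y z hx hy) addrK.
Qed.

Local Notation kil := (@super_killing K g).

Lemma killing_linl z (a : K) x y : kil (a *: x + y) z = a * kil x z + kil y z.
Proof. by rewrite /super_killing adP comp_lfunDl -comp_lfunZl supertrace_endD supertrace_endZ. Qed.
Lemma killing_linr z (a : K) x y : kil z (a *: x + y) = a * kil z x + kil z y.
Proof. by rewrite /super_killing adP comp_lfunDr -comp_lfunZr supertrace_endD supertrace_endZ. Qed.

Lemma killingC p q x y : x \in part p -> y \in part q -> kil x y = (-1) ^+ (p && q) * kil y x.
Proof. by move=> hx hy; apply: supertrace_endC; apply: ad_hom. Qed.

Lemma killing_even p x y : x \in part p -> y \in part (~~ p) -> kil x y = 0.
Proof.
move=> hx hy; apply: supertrace_end_odd; have := ehom_comp (ad_hom hx) (ad_hom hy).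
by case: (p).
Qed.

Lemma killing_inv_hom p q r x y z : x \in part p -> y \in part q -> z \in part r ->
  kil (br x y) z = kil x (br y z).
Proof.
move=> hx hy hz; rewrite /super_killing (ad_br hx hy) (ad_br hy hz) -!scaleNr.
rewrite comp_lfunDl comp_lfunDr !supertrace_endD -comp_lfunZl -comp_lfunZr !supertrace_endZ.
rewrite comp_lfunA; congr (_ + _).
rewrite -[in LHS]comp_lfunA (supertrace_endC (ad_hom hy) (ehom_comp (ad_hom hx) (ad_hom hz))).
rewrite comp_lfunA !mulNr mulrA -exprD; congr (- (_ * _)).
by case: (p); case: (q); case: (r); rewrite /= ?expr0 ?expr1 // expr2 mulrNN mulr1.
Qed.

Lemma killingDl x y z : kil (x + y) z = kil x z + kil y z.
Proof. by have := killing_linl z 1 x y; rewrite scale1r mul1r. Qed.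
Lemma killingDr x y z : kil z (x + y) = kil z x + kil z y.
Proof. by have := killing_linr z 1 x y; rewrite scale1r mul1r. Qed.

Lemma killing_inv x y z : kil (br x y) z = kil x (br y z).
Proof.
have brDl u v t : br (u + v) t = br u t + br v t by have := lie_linl t 1 u v; rewrite !scale1r.
have brDr u v t : br t (u + v) = br t u + br t v by have := lie_linr t 1 u v; rewrite !scale1r.
elim/lie_part_ind: x => [p x hx|x x' hx hx']; last by rewrite brDl !killingDl hx hx'.
elim/lie_part_ind: y => [q y hy|y y' hy hy']; last by rewrite brDr brDl killingDl killingDr hy hy'.
elim/lie_part_ind: z => [r z hz|z z' hz hz']; last by rewrite brDr !killingDr hz hz'.
exact: (killing_inv_hom hx hy hz).
Qed.

Definition killing_radical : {vspace g} :=
  lker (linfun (fun x : g => linfun (fun y : g => (kil x y : K^o)) : 'Hom(g, K^o))).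

Lemma mem_radical x : (x \in killing_radical) <-> forall y, kil x y = 0.
Proof.
have lin2 u : linear (fun y : g => (kil u y : K^o)) by move=> a v w; apply: killing_linr.
rewrite memv_ker linfun_linearE; last first.
  move=> a u v; apply/lfunP => y; rewrite lfunE /= lfunE /= !linfun_linearE //.
  exact: killing_linl.
split=> [/eqP E y|E]; first by move/lfunP/(_ y): E; rewrite linfun_linearE // lfunE.
by apply/eqP/lfunP => y; rewrite linfun_linearE // E lfunE.
Qed.

(** The form pairs even with even and odd with odd, so the radical is graded, as [is_simple] demands
    of an ideal. *)
Lemma radical_part x x0 x1 : x \in killing_radical -> x0 \in part false -> x1 \in part true ->
  x = x0 + x1 -> x0 \in killing_radical /\ x1 \in killing_radical.
Proof.
move=> /mem_radical hx h0 h1 Ex.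
have E y : kil x0 y = 0.
  elim/lie_part_ind: y => [q y hy|y y' hy hy']; last by rewrite killingDr hy hy' addr0.
  case: q hy => hy; first exact: (killing_even h0 hy).
  by have := hx y; rewrite Ex killingDl (killing_even h1 hy) addr0.
split; apply/mem_radical => // y.
by have := hx y; rewrite Ex killingDl E add0r.
Qed.

(** The radical is a graded ideal, and it is not everything because the form is not identically
    zero. *)
Lemma killing_nondeg : is_simple g -> (exists x y, kil x y != 0) ->
  forall x, (forall y, kil x y = 0) -> x = 0.
Proof.
move=> [_ simple] [a [b ab]] x hx.
have := simple killing_radical; case.
- apply/eqP; rewrite eqEsubv; apply/andP; split; last first.
    by rewrite subv_add !capvSl.
  apply/subvP => y hy; have [y0 [y1 [h0 h1 Ey]]] := lie_decomp y.
  have [r0 r1] := radical_part hy h0 h1 Ey.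
  by rewrite Ey; apply: memv_add; rewrite memv_cap ?r0 ?r1.
- move=> u y hy; have [y0 [y1 [h0 h1 Ey]]] := lie_decomp y.
  have [r0 r1] := radical_part hy h0 h1 Ey.
  (* Invariance applies when the radical element is the left factor of the bracket, so the factors
     are first exchanged by skew symmetry. *)
  have key q z : z \in part q -> z \in killing_radical -> br u z \in killing_radical.
    move=> hz /mem_radical hr; apply/mem_radical => t.
    elim/lie_part_ind: u => [p u hu|u u' hu hu'].
      have [_ _ _ skew _] := lie; rewrite (skew p q u z hu hz) -scaleNr.
      have := killing_linl t (- (-1) ^+ (p && q)) (br z u) 0; rewrite addr0 => ->.
      rewrite killing_inv hr mulr0 add0r.
      by have := killing_linl t (-1) 0 0; rewrite scaler0 addr0 mulN1r addNr.
    have := lie_linl z 1 u u'; rewrite !scale1r => ->.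
    by rewrite killingDl hu hu' addr0.
  have := lie_linr u 1 y0 y1; rewrite !scale1r Ey => ->.
  by apply: memvD; [apply: key h0 r0 | apply: key h1 r1].
- by move=> E; move/mem_radical: hx; rewrite E memv0 => /eqP.
move=> E; have /mem_radical/(_ b) E0 : a \in killing_radical by rewrite E memvf.
by rewrite E0 eqxx in ab.
Qed.

Lemma lie_even_der x y z : x \in part false -> br x (br y z) = br (br x y) z + br y (br x z).
Proof.
have [_ _ _ _ jac] := lie; move=> hx.
have brDl u v t : br (u + v) t = br u t + br v t by have := lie_linl t 1 u v; rewrite !scale1r.
have brDr u v t : br t (u + v) = br t u + br t v by have := lie_linr t 1 u v; rewrite !scale1r.
elim/lie_part_ind: y => [q y hy|y y' hy hy'].
  by rewrite (jac false q x y z hx hy) scale1r.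
by rewrite !brDl !brDr hy hy' brDl addrACA.
Qed.

Lemma killing_basic_structure (c : K) (h : {vspace g}) : is_simple g -> c != 0 ->
  (exists x y, kil x y != 0) -> (h <= part false)%VS ->
  (forall x y, x \in h -> y \in h -> br x y = 0) ->
  (exists (I : finType) (w : I -> g) (wt : I -> weight h) (par : I -> bool),
    [/\ forall i, w i \in part (par i),
        forall i, w i \in rootspace (wt i),
        forall i, wt i = 0 -> w i \in h,
        forall i j, wt i = wt j -> wt i <> 0 -> w j <> 0 -> w i \in <[w j]>%VS
      & forall S : {vspace g}, (h <= S)%VS -> (forall i, w i \in S) -> S = fullv]) ->
  basic_structure (fun x y => c * kil x y) h.
Proof.
move=> simple c0 nz heven habel hw; have [_ [hsum hcap] hpart hskew jac] := lie.
split=> //.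
- exact: lie_linl.
- exact: lie_linr.
- by move=> z a x y; rewrite killing_linl mulrDr mulrCA.
- by move=> z a x y; rewrite killing_linr mulrDr mulrCA.
- by move=> p q x y hx hy; rewrite (killingC hx hy) mulrCA.
- by move=> p x y hx hy; rewrite (killing_even hx hy) mulr0.
- by move=> p q r x y z _ _ _; rewrite killing_inv.
- move=> x hx; apply: killing_nondeg => // y; have /eqP := hx y.
  by rewrite mulf_eq0 (negPf c0) => /eqP.
- by move=> x y z /(subvP heven) hx; apply: lie_even_der.
Qed.

End KillingForm.

(** * F(4) *)

Section Spinors.
Variables (C : numClosedFieldType) (r N : nat) (a c : 'I_r -> 'M[C]_N.+1).
Hypothesis a_sq : forall k, a k *m a k = 1%:M.
Hypothesis c_sq : forall k, c k *m c k = 1%:M.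
Hypothesis ac : forall k l, c l *m a k = - (a k *m c l).
Hypothesis aa : forall k l, k != l -> a l *m a k = - (a k *m a l).
Hypothesis cc : forall k l, k != l -> c l *m c k = - (c k *m c l).

(** For paired gamma matrices this is twice the action of the k-th torus generator of so(7) on
    spinors; these operators are commuting involutions. *)
Definition spin_op (k : 'I_r) : 'M[C]_N.+1 := 'i *: (a k *m c k).
Local Notation T := spin_op.

Lemma spin_op_sq k : T k *m T k = 1%:M.
Proof.
have ii : 'i * 'i = -1 :> C by rewrite -expr2 sqrCi.
rewrite /T -scalemxAl -scalemxAr scalerA ii scaleN1r mulmxA -(mulmxA (a k)) ac mulmxN mulmxA a_sq mul1mx.
by rewrite mulNmx c_sq opprK.
Qed.

Lemma spin_op_a k : T k *m a k = - (a k *m T k).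
Proof. by rewrite /T -scalemxAl -scalemxAr -mulmxA ac mulmxN scalerN. Qed.

Lemma spin_op_a_comm k l : k != l -> T k *m a l = a l *m T k.
Proof.
move=> kl; rewrite /T -scalemxAl -scalemxAr -mulmxA ac mulmxN !mulmxA (aa kl).
by rewrite mulNmx.
Qed.

Lemma spin_op_c_comm k l : k != l -> T k *m c l = c l *m T k.
Proof.
move=> kl; have lk : l != k by rewrite eq_sym.
rewrite /T -scalemxAl -scalemxAr -mulmxA (cc lk) mulmxN !mulmxA ac.
by rewrite mulNmx.
Qed.

Lemma spin_op_comm k l : T k *m T l = T l *m T k.
Proof.
have [->|kl] := eqVneq k l; first by [].
by rewrite {2 3}/T -scalemxAr mulmxA (spin_op_a_comm kl) -mulmxA (spin_op_c_comm kl) mulmxA -scalemxAl.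
Qed.

(** The signs are imposed one at a time. If v + s T v is nonzero, it has sign s for the new [T] and
    keeps the earlier signs; if it is zero, [v] has the opposite sign, which must be flipped. *)
Lemma spinor_ex (f : 'I_r -> bool) : exists v : 'cV[C]_N.+1,
  v != 0 /\ forall k, T k *m v = (-1) ^+ f k *: v.
Proof.
suff H j : (j <= r)%N -> exists v : 'cV[C]_N.+1,
    v != 0 /\ forall k : 'I_r, (k < j)%N -> T k *m v = (-1) ^+ f k *: v.
  by have [v [v0 hv]] := H r (leqnn r); exists v; split=> // k; apply: hv; apply: ltn_ord.
elim: j => [_|j IH jr].
  exists (const_mx 1); split=> //; apply/negP => /eqP /matrixP /(_ 0 0) /eqP.
  by rewrite !mxE oner_eq0.
have [v [v0 hv]] := IH (ltnW jr); pose k0 := Ordinal jr.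
have ss : (-1) ^+ f k0 * (-1) ^+ f k0 = 1 :> C by rewrite -expr2 sqrr_sign.
have [E|ne] := eqVneq (v + (-1) ^+ f k0 *: (T k0 *m v)) 0; last first.
  exists (v + (-1) ^+ f k0 *: (T k0 *m v)); split=> // k; rewrite ltnS leq_eqVlt => /orP [/eqP kj|kj].
    have -> : k = k0 by apply: val_inj.
    rewrite mulmxDr -scalemxAr mulmxA spin_op_sq mul1mx scalerDr scalerA ss scale1r.
    by rewrite addrC.
  by rewrite mulmxDr -scalemxAr mulmxA spin_op_comm -mulmxA (hv k kj) -scalemxAr scalerDr !scalerA mulrC.
(* a k0 flips the sign of the eigenvalue of T k0 and of no other T k. *)
exists (a k0 *m v); split=> [|k].
  by apply: contraNneq v0 => E0; rewrite -[v]mul1mx -(a_sq k0) -mulmxA E0 mulmx0.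
have Tv : T k0 *m v = - ((-1) ^+ f k0 *: v).
  have E2 : (-1) ^+ f k0 *: (v + (-1) ^+ f k0 *: (T k0 *m v)) = 0 by rewrite E scaler0.
  by move: E2; rewrite scalerDr scalerA ss scale1r addrC => /eqP; rewrite addr_eq0 => /eqP.
rewrite ltnS leq_eqVlt => /orP [/eqP kj|kj].
  have -> : k = k0 by apply: val_inj.
  by rewrite mulmxA spin_op_a mulNmx -mulmxA Tv mulmxN opprK scalemxAr.
have kk0 : k != k0 by rewrite -val_eqE /= neq_ltn kj.
by rewrite mulmxA (spin_op_a_comm kk0) -mulmxA (hv k kj) scalemxAr.
Qed.

(** The product of the commuting projectors (1 + s_k T_k) / 2, hence the projector onto the joint
    eigenspace with sign pattern [f]. *)
Definition spin_proj (f : 'I_r -> bool) (u : 'cV[C]_N.+1) : 'cV[C]_N.+1 :=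
  foldr (fun k w => 2%:R^-1 *: (w + (-1) ^+ f k *: (T k *m w))) u (enum 'I_r).

Lemma spin_proj_lin f : linear (spin_proj f).
Proof.
rewrite /spin_proj; elim: (enum _) => [|k s IH] x u w //=.
rewrite IH mulmxDr -scalemxAr !scalerDr !scalerA ![_ * x]mulrC -!addrA; congr (_ + _).
rewrite addrCA; congr (_ + _); rewrite !mulrA.
by rewrite [x * _]mulrC -!mulrA [x * _]mulrC.
Qed.

Lemma spin_proj_eigen f (e : 'I_r -> bool) v : (forall k, T k *m v = (-1) ^+ e k *: v) ->
  spin_proj f v = ([forall k, f k == e k])%:R *: v.
Proof.
move=> hv; rewrite /spin_proj.
have -> : [forall k, f k == e k] = all (fun k => f k == e k) (enum 'I_r).
  by apply/forallP/allP => [h k _|h k]; [apply: h | apply: h; rewrite mem_enum].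
elim: (enum _) => [|k s IH] /=; first by rewrite scale1r.
rewrite IH -scalemxAr hv !scalerA -scalerDl scalerA; congr (_ *: _).
have [->|ne] := eqVneq (f k) (e k); rewrite /=; move: (all _ s)%:R => A.
  have -> : (-1) ^+ e k * A * (-1) ^+ e k = A.
    by case: (e k); rewrite ?expr0 ?expr1 ?mulN1r ?mulrN1 ?opprK ?mul1r ?mulr1.
  by rewrite -mulr2n -[A *+ 2]mulr_natl mulrA mulVf ?mul1r ?pnatr_eq0.
have -> : (-1) ^+ f k * A * (-1) ^+ e k = - A.
  by case: (f k) (e k) ne => [] [] // _; rewrite ?expr0 ?expr1 ?mulN1r ?mulrN1 ?mul1r ?mulr1.
by rewrite subrr mulr0 ?mul0r.
Qed.

Hypothesis dimN : N.+1 = (2 ^ r)%N.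

(** Eigenvectors for the 2^r sign patterns are independent, because [spin_proj f] isolates the
    coefficient at [f], and their number is the dimension. *)
Lemma spinor_basis : exists v : {ffun 'I_r -> bool} -> 'cV[C]_N.+1,
  (forall f k, T k *m v f = (-1) ^+ f k *: v f) /\
  (forall u, exists x : {ffun 'I_r -> bool} -> C, u = \sum_f x f *: v f).
Proof.
pose F := {ffun 'I_r -> bool}.
have /choice [v hv] : forall f : F, exists v : 'cV[C]_N.+1,
    v != 0 /\ forall k, T k *m v = (-1) ^+ f k *: v by move=> f; apply: spinor_ex.
exists v; split=> [f k|u]; first by have [_ ->] := hv f.
pose L (x : 'rV[C]_#|F|) : 'cV[C]_N.+1 := \sum_j x 0 j *: v (enum_val j).
have Llin : linear L.
  move=> b x y; rewrite /L scaler_sumr -big_split; apply: eq_bigr => j _ /=.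
  by rewrite !mxE scalerDl scalerA.
have Linj : lker (linfun L) == 0%VS.
  rewrite -subv0; apply/subvP => x; rewrite memv_ker linfun_linearE // memv0 => /eqP E.
  apply/eqP/rowP => j; rewrite mxE; pose f : F := enum_val j.
  have : spin_proj f (L x) = x 0 j *: v f.
    rewrite /L (linear_prop_sum _ _ _ (spin_proj_lin f)) (bigD1 j) //= big1 => [|k kj].
      rewrite addr0 (linear_propZ _ _ (spin_proj_lin f)) (spin_proj_eigen f (hv _).2).
      have -> : [forall k, f k == (enum_val j : F) k] by apply/forallP => k.
      by rewrite scale1r.
    rewrite (linear_propZ _ _ (spin_proj_lin f)) (spin_proj_eigen f (hv _).2).
    have -> : [forall k', f k' == (enum_val k : F) k'] = false.
      apply: contraNF kj => /forallP fk; apply/eqP; apply: enum_val_inj; apply/ffunP => k'.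
      by rewrite -(eqP (fk k')).
    by rewrite scale0r scaler0.
  rewrite E (linear_prop0 (spin_proj_lin f)).
  move=> /esym /eqP; rewrite scaler_eq0 => /orP [/eqP //|].
  by rewrite (negPf (hv f).1).
have Lfull : limg (linfun L) = fullv.
  apply/eqP; rewrite eqEdim subvf limg_dim_eq; last by rewrite (eqP Linj) capv0.
  by rewrite !dimvf /dim /= mul1n muln1 card_ffun card_bool card_ord dimN.
have : u \in limg (linfun L) by rewrite Lfull memvf.
case/memv_imgP => x _ ->; exists (fun f => x 0 (enum_rank f)).
rewrite linfun_linearE // /L (reindex _ (onW_bij _ (@enum_rank_bij F))) /=.
by apply: eq_bigr => f _; rewrite enum_rankK.
Qed.

End Spinors.

(** * The spin representation and brackets with even elements of F(4) *)

Section F4Algebra.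
Variable C : numClosedFieldType.

Definition gso7 : {vspace 'M[C]_7} := lker (linfun (fun X : 'M[C]_7 => X + X^T)).
Definition gsl2 : {vspace 'M[C]_2} := lker (linfun (fun A : 'M[C]_2 => (\tr A : C^o))).
Definition gcommutator (k : nat) (X Y : 'M[C]_k) : 'M[C]_k := X *m Y - Y *m X.

Variable gam : 'I_7 -> 'M[C]_8.
Definition gspin (X : 'M[C]_7) : 'M[C]_8 :=
  4%:R^-1 *: \sum_i \sum_j X i j *: (gam i *m gam j).

Variable B : 'M[C]_(8, 2) -> 'M[C]_(8, 2) -> subvs_of gso7 * subvs_of gsl2.

Definition gF4_alg : superalgebra C :=
  @SuperAlgebra C (subvs_of gso7 * subvs_of gsl2 * 'M[C]_(8, 2))%type
    (fun p => if p then lker (linfun fst) else lker (linfun snd))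
    (fun x y =>
       let: (X, A, psi) := x in let: (Y, D, phi) := y in
       ((vsproj gso7 (gcommutator (vsval X) (vsval Y)),
         vsproj gsl2 (gcommutator (vsval A) (vsval D))) + B psi phi,
        (gspin (vsval X) *m phi + phi *m (vsval A)^T)
        - (gspin (vsval Y) *m psi + psi *m (vsval D)^T))).

Hypothesis clifford : forall i j, gam i *m gam j + gam j *m gam i = (2%:R *+ (i == j))%:M.
Hypothesis lie : is_lie_superalgebra gF4_alg.
Local Notation g := gF4_alg.
Local Notation br := (sa_br gF4_alg).

Lemma mem_so7 X : (X \in gso7) = (X + X^T == 0).
Proof.
rewrite memv_ker linfun_linearE // => a U W.
by rewrite linearP /= scalerDr addrACA.
Qed.
Lemma mem_sl2 A : (A \in gsl2) = (\tr A == 0).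
Proof. by rewrite memv_ker linfun_linearE // => a U W; rewrite linearP. Qed.

(** Elements given by plain matrices, so that brackets can be computed with matrices once membership
    in so(7) and sl(2) is known. *)
Definition F4mk (X : 'M[C]_7) (A : 'M[C]_2) (psi : 'M[C]_(8, 2)) : g :=
  (vsproj gso7 X, vsproj gsl2 A, psi).

Lemma F4mkP a X A psi Y D phi :
  F4mk (a *: X + Y) (a *: A + D) (a *: psi + phi) = a *: F4mk X A psi + F4mk Y D phi.
Proof. by rewrite /F4mk !linearP. Qed.

Lemma F4_ex (x : g) : exists X A psi, [/\ X \in gso7, A \in gsl2 & x = F4mk X A psi].
Proof.
case: x => [[X A] psi]; exists (vsval X), (vsval A), psi; rewrite !subvsP; split=> //.
by rewrite /F4mk !vsvalK.
Qed.

Lemma F4_part_even X A : F4mk X A 0 \in sa_part g false.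
Proof. by rewrite memv_ker lfunE. Qed.
Lemma F4_part_odd psi : F4mk 0 0 psi \in sa_part g true.
Proof. by rewrite memv_ker lfunE /= /F4mk !linear0. Qed.

(** [B] is an arbitrary function; its vanishing at 0 is recovered from linearity of the whole
    bracket. *)
Lemma F4_B0 phi : B 0 phi = 0.
Proof.
have z1 : vsval (vsproj gso7 0) = 0 :> 'M[C]_7 by rewrite !linear0.
have z2 : vsval (vsproj gsl2 0) = 0 :> 'M[C]_2 by rewrite !linear0.
have E0 : F4mk 0 0 0 = 0 by rewrite /F4mk !linear0.
have br0 : br (F4mk 0 0 0) (F4mk 0 0 phi) = 0.
  have linl := lie_linl lie (F4mk 0 0 phi); apply: (addIr (br 0 (F4mk 0 0 phi))).
  by rewrite E0 -{1}[br 0 _]scale1r -linl scale1r !add0r.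
have := congr1 fst br0; rewrite /F4mk /= /gcommutator z1 z2 !mul0mx !subrr !linear0.
by rewrite add0r.
Qed.

Lemma F4_br_even S D Y E phi : S \in gso7 -> D \in gsl2 -> Y \in gso7 -> E \in gsl2 ->
  br (F4mk S D 0) (F4mk Y E phi) =
  F4mk (gcommutator S Y) (gcommutator D E) (gspin S *m phi + phi *m D^T).
Proof.
move=> hS hD hY hE; rewrite /F4mk /= F4_B0 addr0 !vsprojK // mulmx0 mul0mx addr0 subr0.
by [].
Qed.

Lemma gspin_lin : linear gspin.
Proof.
move=> a X Y; rewrite /gspin scalerA mulrC -scalerA -scalerDr; congr (_ *: _).
rewrite scaler_sumr -big_split; apply: eq_bigr => i _ /=.
rewrite scaler_sumr -big_split; apply: eq_bigr => j _ /=.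
by rewrite !mxE scalerDl scalerA.
Qed.

Lemma gspin_delta i j : gspin (delta_mx i j) = 4%:R^-1 *: (gam i *m gam j).
Proof.
rewrite /gspin (bigD1 i) //= (bigD1 j) //= mxE !eqxx scale1r big1 ?addr0 => [|k kj].
  rewrite big1 ?addr0 // => k ki; rewrite big1 // => l _.
  by rewrite mxE (negPf ki) scale0r.
by rewrite mxE (negPf kj) andbF scale0r.
Qed.

Local Notation Q := 'I_(7./2).
Definition gam_ev (k : Q) : 'M[C]_8 := gam (Ordinal (even_bound k)).
Definition gam_od (k : Q) : 'M[C]_8 := gam (Ordinal (odd_bound k)).

Lemma gam_sq i : gam i *m gam i = 1%:M.
Proof.
have := clifford i i; rewrite eqxx mulr1n => E.
have {}E : 2%:R *: (gam i *m gam i) = 2%:R *: 1%:M by rewrite scaler_nat mulr2n E scalemx1.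
by apply: (scalerI _ E); rewrite pnatr_eq0.
Qed.

Lemma gam_anti i j : i != j -> gam j *m gam i = - (gam i *m gam j).
Proof.
move=> ij; apply/eqP; rewrite -addr_eq0 addrC clifford (negPf ij) mulr0n.
by rewrite raddf0.
Qed.

Local Notation T := (spin_op gam_ev gam_od).
Let ac k l : gam_od l *m gam_ev k = - (gam_ev k *m gam_od l).
Proof.
apply: gam_anti; rewrite -val_eqE /=; apply/eqP => E; have := congr1 odd E.
by rewrite /= !odd_double.
Qed.
Let aa k l : k != l -> gam_ev l *m gam_ev k = - (gam_ev k *m gam_ev l).
Proof. by move=> kl; apply: gam_anti; rewrite -val_eqE /= (inj_eq double_inj). Qed.
Let cc k l : k != l -> gam_od l *m gam_od k = - (gam_od k *m gam_od l).
Proof. by move=> kl; apply: gam_anti; rewrite -val_eqE /= eqSS (inj_eq double_inj). Qed.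

(** The spin action carries a factor 1/4, and the two terms of [plane] become equal by
    anticommutation, which leaves 1/2. *)
Lemma gspin_plane k : gspin (plane (so_ev C (m := 7)) (so_od C (m := 7)) k) = 2%:R^-1 *: T k.
Proof.
have spZ a X : gspin (a *: X) = a *: gspin X by apply: linear_propZ; apply: gspin_lin.
have spB X Y : gspin (X - Y) = gspin X - gspin Y.
  by rewrite addrC -scaleN1r gspin_lin scaleN1r addrC.
rewrite /plane spZ spB !trmx_delta !mul_delta_mx !gspin_delta -/(gam_ev k) -/(gam_od k).
rewrite ac scalerN opprK -scalerDl /spin_op !scalerA; congr (_ *: _).
by field.
Qed.

Lemma gspin_torus t : gspin (gso_torus (m := 7) t) = \sum_k t 0 k *: (2%:R^-1 *: T k).
Proof.
rewrite gso_torusE /rotation (linear_prop_sum _ _ _ gspin_lin); apply: eq_bigr => k _.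
by rewrite -gspin_plane (linear_propZ _ _ gspin_lin).
Qed.

Lemma F4_spinors : exists v : {ffun Q -> bool} -> 'cV[C]_8,
  (forall f t, gspin (gso_torus (m := 7) t) *m v f =
     (2%:R^-1 * \sum_k (-1) ^+ f k * t 0 k) *: v f) /\
  (forall u, exists x : {ffun Q -> bool} -> C, u = \sum_f x f *: v f).
Proof.
(* The final [erefl] is 8 = 2^3, the dimension of the space of spinors. *)
have [v [hv hs]] := @spinor_basis C (7./2) 7 gam_ev gam_od (fun k => gam_sq _) (fun k => gam_sq _)
  ac aa cc erefl.
exists v; split=> // f t; rewrite gspin_torus mulmx_suml mulr_sumr scaler_suml; apply: eq_bigr => k _.
by rewrite -scalemxAl -scalemxAl hv !scalerA; congr (_ *: _); ring.
Qed.

End F4Algebra.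

(** * Root vectors of F(4) *)

Section F4Roots.
Variable C : numClosedFieldType.
Variables (gam : 'I_7 -> 'M[C]_8)
  (B : 'M[C]_(8, 2) -> 'M[C]_(8, 2) -> subvs_of (gso7 C) * subvs_of (gsl2 C)).
Local Notation g := (gF4_alg gam B).
Hypothesis lie : is_lie_superalgebra g.
Local Notation br := (sa_br g).
Local Notation mk := (F4mk gam B).
Local Notation Q := 'I_(7./2).

Definition sl2_torus (d : C) : 'M[C]_2 := diag_mx (\row_(i < 2) ((-1) ^+ i * (d / 2%:R))).

Definition gF4_torus (td : 'rV[C]_3 * C^o) : g :=
  (vsproj (gso7 C) (gso_torus (m := 7) td.1), vsproj (gsl2 C) (sl2_torus td.2), 0).

Lemma gF4_torusE td : gF4_torus td = mk (gso_torus (m := 7) td.1) (sl2_torus td.2) 0.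
Proof. by []. Qed.

Local Notation ev := (so_ev C (m := 7)).
Local Notation od := (so_od C (m := 7)).
Local Notation uv := (wvec ev od (so_z C 7)).

Lemma so_torus_so7 t : gso_torus (m := 7) t \in gso7 C.
Proof. by rewrite mem_so7 gso_torusE rotation_tr subrr. Qed.

Lemma sl2_torus_sl2 d : sl2_torus d \in gsl2 C.
Proof.
rewrite mem_sl2 /sl2_torus mxtrace_diag !big_ord_recl big_ord0 !mxE expr0 expr1.
by apply/eqP; ring.
Qed.

Lemma so_torus_lin : linear (gso_torus (C := C) (m := 7)).
Proof.
move=> a x y; rewrite !gso_torusE /rotation scaler_sumr -big_split; apply: eq_bigr => q _ /=.
by rewrite !mxE scalerDl scalerA.
Qed.

Lemma sl2_torus_lin : linear (sl2_torus : C^o -> 'M[C]_2).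
Proof.
move=> a x y; apply/matrixP => i j; rewrite !mxE; case: (i == j); rewrite ?mulr1n ?mulr0n ?mulr0 ?addr0 //.
by rewrite -[a *: x]/(a * x); ring.
Qed.

Lemma gF4_torus_lin : linear gF4_torus.
Proof.
move=> a x y; rewrite !gF4_torusE -F4mkP.
by rewrite -so_torus_lin -sl2_torus_lin scaler0 addr0.
Qed.

Lemma gF4_torus_inj : lker (linfun gF4_torus) == 0%VS.
Proof.
rewrite -subv0; apply/subvP => td; rewrite memv_ker linfun_linearE; last exact: gF4_torus_lin.
rewrite memv0 => /eqP E; have := congr1 (fun x : g => vsval x.1.1) E.
have := congr1 (fun x : g => vsval x.1.2) E; rewrite /= !vsprojK ?so_torus_so7 ?sl2_torus_sl2 //.
move=> /matrixP /(_ 0 0); rewrite !mxE eqxx mulr1n expr0 mul1r => d0.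
rewrite gso_torusE => /(rotation_inj (so_ev_ev C (m := 7)) (so_od_od C (m := 7)) (so_ev_od C (m := 7))) t0.
case: td d0 t0 {E} => t d /= d0 t0; apply/eqP; congr (_, _).
  by apply/rowP => k; rewrite mxE; apply: t0.
by move/eqP: d0; rewrite mulf_eq0 invr_eq0 pnatr_eq0 orbF => /eqP.
Qed.

Definition gF4_cartan : {vspace g} := limg (linfun gF4_torus).

Definition gF4_coord (H : subvs_of gF4_cartan) : 'rV[C]_3 * C^o :=
  ((linfun gF4_torus)^-1)%VF (vsval H).
Definition gF4_eps (i : 'I_3) : weight gF4_cartan :=
  linfun (fun H => ((gF4_coord H).1 ord0 i : C^o)).
Definition gF4_delta : weight gF4_cartan := linfun (fun H => (gF4_coord H).2).

Lemma mem_F4_cartan x : reflect (exists td, x = gF4_torus td) (x \in gF4_cartan).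
Proof.
apply: (iffP idP) => [/memv_imgP [td _ ->]|[td ->]].
  by exists td; rewrite linfun_linearE //; apply: gF4_torus_lin.
rewrite -(linfun_linearE (f := gF4_torus)); last exact: gF4_torus_lin.
by rewrite memv_img ?memvf.
Qed.

Lemma gF4_coordE (H : subvs_of gF4_cartan) td : vsval H = gF4_torus td -> gF4_coord H = td.
Proof.
move=> E; rewrite /gF4_coord E -(linfun_linearE (f := gF4_torus)); last exact: gF4_torus_lin.
exact: (lker0_lfunK gF4_torus_inj).
Qed.

Lemma gF4_coord_lin : linear gF4_coord.
Proof. by move=> a x y; rewrite /gF4_coord !linearP. Qed.

Lemma gF4_epsE (H : subvs_of gF4_cartan) td k : vsval H = gF4_torus td -> gF4_eps k H = td.1 0 k.
Proof.
move=> E; rewrite /gF4_eps linfun_linearE ?(gF4_coordE E) // => a x y.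
by rewrite gF4_coord_lin !mxE.
Qed.

Lemma gF4_deltaE (H : subvs_of gF4_cartan) td : vsval H = gF4_torus td -> gF4_delta H = td.2.
Proof.
move=> E; rewrite /gF4_delta linfun_linearE ?(gF4_coordE E) // => a x y.
by rewrite gF4_coord_lin.
Qed.

Lemma F4_cartan_torus (H : subvs_of gF4_cartan) : exists td, vsval H = gF4_torus td.
Proof. by apply/mem_F4_cartan; rewrite subvsP. Qed.

Lemma F4_cartan_ex td : exists H : subvs_of gF4_cartan, vsval H = gF4_torus td.
Proof. by exists (vsproj gF4_cartan (gF4_torus td)); rewrite vsprojK //; apply/mem_F4_cartan; exists td. Qed.

Local Notation sw := (signed_weight gF4_eps).

Lemma sw_evalF4 x (H : subvs_of gF4_cartan) td : vsval H = gF4_torus td ->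
  sw x H = wcoef (fun k => td.1 0 k) x.
Proof. by move=> E; case: x => [[q s]|] /=; rewrite lfunE //= (gF4_epsE q E). Qed.

Let eps_dual : forall q, exists H : subvs_of gF4_cartan, forall p, gF4_eps p H = (p == q)%:R :> C.
Proof.
move=> q; have [H EH] := F4_cartan_ex (delta_mx 0 q, 0).
by exists H => p; rewrite (gF4_epsE p EH) mxE.
Qed.

Lemma F4_weight_inj x y x' y' : sw x + sw y = sw x' + sw y' -> sw x + sw y <> 0 ->
  (x = x' /\ y = y') \/ (x = y' /\ y = x').
Proof.
have /choice [hh Hh] := eps_dual.
apply: (@signed_pair_inj _ _ _ _ (fun q (w : weight gF4_cartan) => w (hh q) : C)).
- by move=> q u v; rewrite lfunE.
- by move=> q a u; rewrite lfunE.
- by move=> p q; apply: Hh.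
Qed.

Lemma F4_sw_eq0 x y : sw x + sw y = 0 -> y = sflip x.
Proof.
move=> /eqP; rewrite addrC addr_eq0 -signed_weight_flip => /eqP.
have /choice [hh Hh] := eps_dual.
apply: (@signed_weight_inj _ _ _ _ (fun q (w : weight gF4_cartan) => w (hh q) : C)).
- by move=> q a u; rewrite lfunE.
- by move=> p q; apply: Hh.
Qed.

Local Notation P := (option ('I_3 * bool)).
Local Notation F := {ffun Q -> bool}.
Local Notation I := ((P * P + 'I_2) + F * 'I_2)%type.

Variable v : F -> 'cV[C]_8.
Hypothesis v_eigen : forall f t, gspin gam (gso_torus (m := 7) t) *m v f =
  (2%:R^-1 * \sum_k (-1) ^+ f k * t 0 k) *: v f.
Hypothesis v_span : forall u, exists x : F -> C, u = \sum_f x f *: v f.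

(** Realizes so(7) as the exterior square of its natural module. *)
Definition so7_root (x y : P) : 'M[C]_7 := uv x *m (uv y)^T - uv y *m (uv x)^T.

Definition F4_vec (i : I) : g := match i with
  | inl (inl (x, y)) => mk (so7_root x y) 0 0
  | inl (inr j) => mk 0 (delta_mx j (rev_ord j)) 0
  | inr (f, j) => mk 0 0 (v f *m delta_mx 0 j) end.

Definition F4_wt (i : I) : weight gF4_cartan := match i with
  | inl (inl (x, y)) => sw x + sw y
  | inl (inr j) => (-1) ^+ j *: gF4_delta
  | inr (f, j) => 2%:R^-1 *: (\sum_k (-1) ^+ f k *: gF4_eps k) + (2%:R^-1 * (-1) ^+ j) *: gF4_delta end.

Definition F4_par (i : I) : bool := if i is inr _ then true else false.

Lemma so7_root_so7 x y : so7_root x y \in gso7 C.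
Proof. by rewrite mem_so7 /so7_root linearB /= !trmx_mul !trmxK addrA subrK subrr. Qed.

Lemma sl2_root_sl2 (j : 'I_2) : delta_mx j (rev_ord j) \in gsl2 C.
Proof.
rewrite mem_sl2 /mxtrace big1 // => i _; rewrite mxE; case: (i =P j) => [->|//].
by case: j => [[|[|]]].
Qed.

Lemma F4_wt_eval i (H : subvs_of gF4_cartan) td : vsval H = gF4_torus td ->
  (F4_wt i H : C) = match i with
  | inl (inl (x, y)) => wcoef (fun k => td.1 0 k) x + wcoef (fun k => td.1 0 k) y
  | inl (inr j) => (-1) ^+ j * td.2
  | inr (f, j) => 2%:R^-1 * (\sum_k (-1) ^+ f k * td.1 0 k) + 2%:R^-1 * (-1) ^+ j * td.2 end.
Proof.
move=> E; case: i => [[[x y]|j]|[f j]] /=.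
- by rewrite lfunE /= (sw_evalF4 x E) (sw_evalF4 y E).
- by rewrite lfunE /= (gF4_deltaE E).
rewrite lfunE /= lfunE /= lfunE /= (gF4_deltaE E); congr (_ * _ + _).
by rewrite sum_lfunE; apply: eq_bigr => k _; rewrite lfunE /= (gF4_epsE k E).
Qed.

Lemma F4_vec_part i : F4_vec i \in sa_part g (F4_par i).
Proof.
case: i => [[[x y]|j]|[f j]]; [exact: F4_part_even|exact: F4_part_even|exact: F4_part_odd].
Qed.

Lemma so7_root_comm t x y : gcommutator (gso_torus (m := 7) t) (so7_root x y) =
  (wcoef (fun k => t 0 k) x + wcoef (fun k => t 0 k) y) *: so7_root x y.
Proof.
rewrite gso_torusE; set S := rotation _ _ _.
have hu z : S *m uv z = wcoef (fun k => t 0 k) z *: uv z.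
  apply: rotation_wvec; [exact: so_ev_ev|exact: so_od_od|exact: so_ev_od|exact: so_ev_z|exact: so_od_z].
have hu' z : (uv z)^T *m S = - (wcoef (fun k => t 0 k) z *: (uv z)^T).
  have St : S^T = - S by apply: rotation_tr.
  by rewrite -[LHS]trmxK trmx_mul trmxK St mulNmx hu linearN /= linearZ.
rewrite /gcommutator /so7_root mulmxBr mulmxBl !mulmxA !hu -!mulmxA !hu' !mulmxN -!scalemxAl -!scalemxAr.
move: (uv x *m _) (uv y *m _) (wcoef _ x) (wcoef _ y) => X Y a b.
rewrite opprB scalerBr !scalerDl opprK opprD.
by apply/matrixP => i j; rewrite !mxE; ring.
Qed.

Lemma sl2_root_comm d (j : 'I_2) : gcommutator (sl2_torus d) (delta_mx j (rev_ord j)) =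
  ((-1) ^+ j * d) *: delta_mx j (rev_ord j).
Proof.
rewrite /gcommutator /sl2_torus mul_diag_mx mul_mx_diag; apply/matrixP => i k; rewrite !mxE.
case: (i =P j) => [->|_] /=; last by rewrite !(mulr0, mul0r) subrr.
case: (k =P rev_ord j) => [->|_] /=; last by rewrite !(mulr0, mul0r) subrr.
have -> : (-1) ^+ (rev_ord j) = - (-1) ^+ j :> C.
  by case: j => [[|[|//]] ?] /=; rewrite ?expr0 ?expr1 ?opprK.
by field.
Qed.

Lemma spinor_weight t d f (j : 'I_2) :
  gspin gam (gso_torus (m := 7) t) *m (v f *m delta_mx 0 j) + (v f *m delta_mx 0 j) *m (sl2_torus d)^T =
  (2%:R^-1 * (\sum_k (-1) ^+ f k * t 0 k) + 2%:R^-1 * (-1) ^+ j * d) *: (v f *m delta_mx 0 j).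
Proof.
rewrite scalerDl mulmxA v_eigen -scalemxAl -mulmxA; congr (_ + _).
have -> : delta_mx 0 j *m (sl2_torus d)^T = (2%:R^-1 * (-1) ^+ j * d) *: delta_mx 0 j :> 'rV[C]_2.
  rewrite /sl2_torus tr_diag_mx mul_mx_diag; apply/matrixP => i k; rewrite !mxE.
  case: (k =P j) => [->|_] /=; last by rewrite andbF mulr0 mul0r.
  by ring.
by rewrite -scalemxAr.
Qed.

Lemma F4_vec_root i : F4_vec i \in rootspace (F4_wt i).
Proof.
apply/(mem_rootspace _ _ (lie_linl lie) (lie_linr lie)) => H.
have [[t d] E] := F4_cartan_torus H; rewrite (F4_wt_eval i E) E gF4_torusE.
rewrite -[(t, d).1]/t -[(t, d).2]/d.
have mkZ a X A psi : mk (a *: X) (a *: A) (a *: psi) = a *: mk X A psi.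
  by rewrite /F4mk !linearZ.
have hS := so_torus_so7 t; have hD := sl2_torus_sl2 d.
have c0 k (X : 'M[C]_k) a : gcommutator X 0 = a *: 0.
  by rewrite /gcommutator mulmx0 mul0mx subrr scaler0.
case: i => [[[x y]|j]|[f j]]; rewrite /F4_vec.
- rewrite (F4_br_even lie) ?so7_root_so7 ?mem0v // -mkZ so7_root_comm (c0 _ _ (wcoef (fun k => t 0 k) x + wcoef (fun k => t 0 k) y)).
  by rewrite mulmx0 mul0mx addr0 !scaler0.
- rewrite (F4_br_even lie) ?sl2_root_sl2 ?mem0v // -mkZ sl2_root_comm (c0 _ _ ((-1) ^+ j * d)).
  by rewrite mulmx0 mul0mx addr0 !scaler0.
rewrite (F4_br_even lie) ?mem0v // -mkZ spinor_weight.
by rewrite /gcommutator !mulmx0 !mul0mx !subrr !scaler0.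
Qed.

Lemma sl2_torus0 : sl2_torus 0 = 0.
Proof. by apply/matrixP => i j; rewrite !mxE mul0r mulr0 mul0rn. Qed.

(** Equality of weights in a form that can be tested at chosen torus elements (t, d). *)
Lemma F4_num_eq i j : F4_wt i = F4_wt j -> forall (t : 'rV[C]_3) (d : C),
  match i with
  | inl (inl (x, y)) => wcoef (fun k => t 0 k) x + wcoef (fun k => t 0 k) y
  | inl (inr j) => (-1) ^+ j * d
  | inr (f, j) => 2%:R^-1 * (\sum_k (-1) ^+ f k * t 0 k) + 2%:R^-1 * (-1) ^+ j * d end =
  match j with
  | inl (inl (x, y)) => wcoef (fun k => t 0 k) x + wcoef (fun k => t 0 k) y
  | inl (inr j) => (-1) ^+ j * d
  | inr (f, j) => 2%:R^-1 * (\sum_k (-1) ^+ f k * t 0 k) + 2%:R^-1 * (-1) ^+ j * d end :> C.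
Proof.
move=> E t d; have [H EH] := F4_cartan_ex (t, d).
by have := F4_wt_eval i EH; have := F4_wt_eval j EH; rewrite E => -> ->.
Qed.

(* The absolute value of the weight F4_wt i at the torus element (0, 2). *)
Definition F4_kind (i : I) : nat :=
  match i with inl (inl _) => 0 | inl (inr _) => 2 | inr _ => 1 end.

Lemma F4_kind_eq i j : F4_wt i = F4_wt j -> F4_kind i = F4_kind j.
Proof.
move=> /F4_num_eq /(_ 0 2%:R) E; apply/eqP; rewrite -(eqr_nat C); apply/eqP.
have K x : wcoef (fun k => (0 : 'rV[C]_3) 0 k) x = 0 by case: x => [[q s]|] //=; rewrite mxE mulr0.
have S (f : F) : \sum_k (-1) ^+ f k * (0 : 'rV[C]_3) 0 k = 0 by apply: big1 => k _; rewrite mxE mulr0.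
have N (l : nat) : `|(-1) ^+ l : C| = 1 by rewrite normrX normrN1 expr1n.
have H (l : 'I_2) : `|2%:R^-1 * (-1) ^+ l * 2%:R| = 1 :> C.
  by rewrite mulrAC mulVf ?pnatr_eq0 // mul1r N.
have D (l : 'I_2) : `|(-1) ^+ l * 2%:R| = 2%:R :> C by rewrite normrM N mul1r normr_nat.
move/(congr1 Num.norm): E.
by case: i => [[[x y]|l]|[f l]]; case: j => [[[x' y']|l']|[f' l']];
  rewrite /= ?K ?S ?mulr0 ?add0r ?addr0 ?H ?D ?normr0.
Qed.

Lemma F4_kind0 i : F4_wt i = 0 -> F4_kind i = 0%N.
Proof.
move=> E; apply: (@F4_kind_eq i (inl (inl (None, None)))).
by rewrite E /= addr0.
Qed.

Lemma so7_rootC x y : so7_root y x = - so7_root x y.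
Proof. by rewrite /so7_root opprB. Qed.

Lemma so7_root_flip q s : so7_root (Some (q, s)) (Some (q, ~~ s)) = (2%:R * (-1) ^+ s) *: plane ev od q.
Proof.
have ss : (-1) ^+ (~~ s) = - (-1) ^+ s :> C by case: (s); rewrite ?expr0 ?expr1 ?opprK.
rewrite /so7_root /= ss /plane; move: ((-1) ^+ s) => e.
by apply/matrixP => i j; rewrite !mxE !big_ord1 !mxE; ring.
Qed.

Lemma plane_F4_cartan c q : mk (c *: plane ev od q) 0 0 \in gF4_cartan.
Proof.
apply/mem_F4_cartan; exists (c *: delta_mx 0 q, 0); rewrite gF4_torusE /= sl2_torus0.
congr (F4mk _ _ _ _ _); rewrite gso_torusE /rotation (bigD1 q) //= big1 => [|p pq].
  by rewrite !mxE !eqxx mulr1 addr0.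
by rewrite !mxE (negPf pq) mulr0 scale0r.
Qed.

Lemma F4_vec_zero i : F4_wt i = 0 -> F4_vec i \in gF4_cartan.
Proof.
move=> E; have := F4_kind0 E; case: i E => [[[x y]|//]|//] /= /F4_sw_eq0 -> _.
case: x => [[q s]|] /=; first by rewrite so7_root_flip plane_F4_cartan.
have -> : mk (so7_root None None) 0 0 = 0 by rewrite /so7_root subrr /F4mk !linear0.
exact: mem0v.
Qed.

Lemma sign_ord2_inj (j j' : 'I_2) : (-1) ^+ j = (-1) ^+ j' :> C -> j = j'.
Proof.
have n1 : (1 : C) <> -1 by move/eqP; rewrite -subr_eq0 opprK -[1 + 1]/(2%:R) pnatr_eq0.
move=> E; apply: val_inj; move: E; case: j => [[|[|//]] ?]; case: j' => [[|[|//]] ?] //=.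
by rewrite expr0 expr1 => /esym.
Qed.

(** [F4_kind] separates the three types of weights; among the spinors, the torus elements (0, 2) and
    (2 e_k, 0) read off the sign given by [l] and the k-th sign of [f]. *)
Lemma F4_vec_line i j : F4_wt i = F4_wt j -> F4_wt i <> 0 -> F4_vec i \in <[F4_vec j]>%VS.
Proof.
move=> E nz; have := F4_kind_eq E; have N := F4_num_eq E; move: E nz N.
case: i => [[[x y]|l]|[f l]]; case: j => [[[x' y']|l']|[f' l']] // E nz N _.
- case: (F4_weight_inj E nz) => [[-> ->]|[-> ->]]; first exact: memv_line.
  have -> : F4_vec (inl (inl (y', x'))) = -1 *: F4_vec (inl (inl (x', y'))).
    by rewrite /F4_vec so7_rootC /F4mk scaleN1r -[in RHS]/(vsproj _ _, _, _); congr (_, _, _);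
      rewrite ?linearN ?linear0 ?oppr0.
  by rewrite memvZ ?memv_line.
- have := N 0 1; rewrite !mulr1 => /sign_ord2_inj ->; exact: memv_line.
have S0 (h : F) : \sum_k (-1) ^+ h k * (0 : 'rV[C]_3) 0 k = 0 by apply: big1 => k _; rewrite mxE mulr0.
have two : (2%:R : C) != 0 by rewrite pnatr_eq0.
have -> : l = l'.
  apply: sign_ord2_inj; have := N 0 2%:R; rewrite !S0 mulr0 !add0r ![_ * _ * 2%:R]mulrAC mulVf // !mul1r.
  by [].
have -> : f = f'; last exact: memv_line.
apply/ffunP => k; apply: (@signr_inj C).
have Sk (h : F) : \sum_i (-1) ^+ h i * (2%:R *: delta_mx 0 k : 'rV[C]_3) 0 i = (-1) ^+ h k * 2%:R.
  rewrite (bigD1 k) //= !mxE !eqxx mulr1 big1 ?addr0 // => i ik.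
  by rewrite !mxE (negPf ik) !mulr0.
have := N (2%:R *: delta_mx 0 k) 0; rewrite !Sk !mulr0 !addr0 ![2%:R^-1 * (_ * _)]mulrC -!mulrA mulfV // !mulr1.
by [].
Qed.

Lemma F4_span (S : {vspace g}) : (gF4_cartan <= S)%VS -> (forall i, F4_vec i \in S) -> S = fullv.
Proof.
move=> hS wS; apply/eqP; rewrite eqEsubv subvf /=; apply/subvP => x _.
have [X [A [psi [hX hA Ex]]]] := F4_ex (x : g).
rewrite Ex.
have -> : mk X A psi = mk X 0 0 + (mk 0 A 0 + mk 0 0 psi).
  have mkD X1 A1 p1 X2 A2 p2 : mk (X1 + X2) (A1 + A2) (p1 + p2) = mk X1 A1 p1 + mk X2 A2 p2.
    by have := F4mkP gam B 1 X1 A1 p1 X2 A2 p2; rewrite !scale1r.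
  by rewrite -!mkD !add0r !addr0.
apply: memvD; last apply: memvD.
- pose m1 X := mk X 0 0; have m1lin : linear m1.
    by move=> a U W; rewrite /m1 -F4mkP !scaler0 !addr0.
  (* An antisymmetric matrix is half of X - X^T, so a spanning set of all matrices antisymmetrizes
     to one of so(7). *)
  rewrite -/(m1 X); have -> : X = 2%:R^-1 *: (X - X^T).
    move: hX; rewrite mem_so7 addr_eq0 => /eqP hX; rewrite -hX -mulr2n -[X *+ 2]scaler_nat scalerA.
    by rewrite mulVf ?pnatr_eq0 // scale1r.
  have [k ->] : exists k : P -> P -> C, X = \sum_x \sum_y k x y *: (uv x *m (uv y)^T).
    by apply: wvec_span; apply: so_complete.
  have -> : (\sum_x \sum_y k x y *: (uv x *m (uv y)^T) - (\sum_x \sum_y k x y *: (uv x *m (uv y)^T))^T) =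
      \sum_x \sum_y k x y *: so7_root x y.
    rewrite linear_sum -sumrB; apply: eq_bigr => x0 _; rewrite linear_sum -sumrB; apply: eq_bigr => y0 _.
    by rewrite linearZ /= trmx_mul trmxK -scalerBr.
  pose ml := linfun m1; have mlE : ml =1 m1 by apply: linfun_linearE.
  rewrite -mlE linearZ /= linear_sum; apply: memvZ; apply: memv_suml => x0 _.
  rewrite linear_sum; apply: memv_suml => y0 _; rewrite linearZ /= mlE; apply: memvZ.
  exact: (wS (inl (inl (x0, y0)))).
- pose m1 A := mk 0 A 0; have m1lin : linear m1.
    by move=> a U W; rewrite /m1 -F4mkP !scaler0 !addr0.
  pose ml := linfun m1; have mlE : ml =1 m1 by apply: linfun_linearE.
  rewrite -/(m1 A) -mlE.
  (* The diagonal part of a traceless matrix is a torus element; the factor 2 undoes the halving in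
     [sl2_torus]. *)
  have -> : A = sl2_torus (2%:R * A 0 0) + \sum_(j < 2) A j (rev_ord j) *: delta_mx j (rev_ord j).
    move: hA; rewrite mem_sl2 /mxtrace !big_ord_recl !big_ord0 /= addr0 addrC addr_eq0 => /eqP hA.
    have r0 : rev_ord (ord0 : 'I_2) = lift ord0 ord0 by apply: val_inj.
    have r1 : rev_ord (lift ord0 ord0 : 'I_2) = ord0 by apply: val_inj.
    rewrite r0 r1 addr0; apply/matrixP => i j; rewrite !mxE.
    case: (unliftP ord0 i) => [i' ->|->]; case: (unliftP ord0 j) => [j' ->|->];
      rewrite ?[i']ord1 ?[j']ord1 /= ?hA; by field.
  rewrite linearD; apply: memvD.
    rewrite /= mlE; apply: (subvP hS); apply/mem_F4_cartan; exists (0, 2%:R * A 0 0).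
    rewrite gF4_torusE; congr (F4mk _ _ _ _ _); rewrite /= gso_torusE /rotation big1 // => k _.
    by rewrite mxE scale0r.
  rewrite linear_sum; apply: memv_suml => j _; rewrite linearZ; apply: memvZ; rewrite /= mlE.
  exact: (wS (inl (inr j))).
pose m1 psi := mk 0 0 psi; have m1lin : linear m1.
  by move=> a U W; rewrite /m1 -F4mkP !scaler0 !addr0.
pose ml := linfun m1; have mlE : ml =1 m1 by apply: linfun_linearE.
rewrite -/(m1 psi) -mlE.
have -> : psi = \sum_(j < 2) col j psi *m delta_mx 0 j.
  rewrite {1}[psi]matrix_sum_delta exchange_big; apply: eq_bigr => j _ /=.
  apply/matrixP => i k; rewrite summxE !mxE big_ord1 !mxE (bigD1 i) //= !mxE eqxx /=.
  by rewrite big1 ?addr0 // => l li; rewrite !mxE eq_sym (negPf li) mulr0.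
rewrite linear_sum; apply: memv_suml => j _.
have [x0 ->] := v_span (col j psi).
rewrite mulmx_suml linear_sum; apply: memv_suml => f _; rewrite -scalemxAl linearZ; apply: memvZ.
by rewrite /= mlE; apply: (wS (inr (f, j))).
Qed.

End F4Roots.

(** * A nonzero value of the Killing form of F(4) *)

Section F4BasicStructure.
Variable C : numClosedFieldType.
Variables (gam : 'I_7 -> 'M[C]_8)
  (B : 'M[C]_(8, 2) -> 'M[C]_(8, 2) -> subvs_of (gso7 C) * subvs_of (gsl2 C)).
Hypothesis clifford : forall i j, gam i *m gam j + gam j *m gam i = (2%:R *+ (i == j))%:M.
Local Notation g := (gF4_alg gam B).
Hypothesis lie : is_lie_superalgebra g.
Hypothesis simple : is_simple g.
Local Notation br := (sa_br g).
Local Notation mk := (F4mk gam B).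

(** Together with [sl2_root_incl] it factors the projector of [g] onto the two root spaces of sl(2)
    through C^2, so that a trace becomes a dimension. *)
Definition sl2_root_part (x : g) : 'rV[C]_2 := \row_j (vsval x.1.2) j (rev_ord j).
Definition sl2_root_incl (r : 'rV[C]_2) : g :=
  mk 0 (\sum_j r 0 j *: delta_mx j (rev_ord j)) 0.
Definition spinor_incl (psi : 'M[C]_(8, 2)) : g := mk 0 0 psi.

Lemma sl2_root_part_lin : linear sl2_root_part.
Proof. by move=> a x y; apply/rowP => j; rewrite !mxE. Qed.

Lemma sl2_root_incl_lin : linear sl2_root_incl.
Proof.
move=> a x y; rewrite /sl2_root_incl -F4mkP !scaler0 !addr0; congr (F4mk _ _ _ _ _).
rewrite scaler_sumr -big_split; apply: eq_bigr => j _ /=.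
by rewrite !mxE scalerDl scalerA.
Qed.

Lemma spinor_incl_lin : linear spinor_incl.
Proof. by move=> a x y; rewrite /spinor_incl -F4mkP !scaler0 !addr0. Qed.

Lemma sl2_antidiag_mem (r : 'rV[C]_2) : \sum_j r 0 j *: delta_mx j (rev_ord j) \in gsl2 C.
Proof. by apply: memv_suml => j _; apply: memvZ; apply: sl2_root_sl2. Qed.

Lemma sl2_antidiagE (r : 'rV[C]_2) j : (\sum_j r 0 j *: delta_mx j (rev_ord j) : 'M[C]_2) j (rev_ord j) = r 0 j.
Proof.
rewrite summxE (bigD1 j) //= !mxE !eqxx mulr1 big1 ?addr0 // => k kj.
by rewrite !mxE eq_sym (negPf kj) mulr0.
Qed.

Lemma sl2_root_inclK : cancel sl2_root_incl sl2_root_part.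
Proof.
move=> r; apply/rowP => j; rewrite mxE /sl2_root_incl /=.
by rewrite vsprojK ?sl2_antidiag_mem // sl2_antidiagE.
Qed.

Let H1 : g := gF4_torus gam B (0, 1).

(** [H1] is diag(1/2, -1/2) in sl(2): its adjoint eigenvalues are 1 and -1 on the root vectors of
    sl(2), and 1/2 and -1/2 on the odd part; their squares appear here. *)
Lemma ad_sl2_torus_sq Y E phi : Y \in gso7 C -> E \in gsl2 C ->
  br H1 (br H1 (mk Y E phi)) = mk 0 (\sum_j E j (rev_ord j) *: delta_mx j (rev_ord j)) (4%:R^-1 *: phi).
Proof.
move=> hY hE; have E0 : gso_torus (m := 7) 0 = 0 :> 'M[C]_7.
  by rewrite gso_torusE /rotation big1 // => k _; rewrite mxE scale0r.
have cm k (X Z : 'M[C]_k) : \tr (gcommutator X Z) = 0 by rewrite /gcommutator linearB /= mxtrace_mulC subrr.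
have s0 : gspin gam 0 = 0 by apply: linear_prop0; apply: gspin_lin.
have c0 (Z : 'M[C]_7) : gcommutator 0 Z = 0 by rewrite /gcommutator mul0mx mulmx0 subrr.
rewrite /H1 gF4_torusE -[(0, 1).1]/(0 : 'rV[C]_3) -[(0, 1).2]/(1 : C) E0.
rewrite !(F4_br_even lie) ?mem0v ?sl2_torus_sl2 ?c0 ?mem0v //; last by rewrite mem_sl2 cm.
rewrite s0 !mul0mx !add0r; congr (F4mk _ _ _ _ _).
  rewrite /gcommutator /sl2_torus; apply/matrixP => i j.
  rewrite mul_diag_mx mul_mx_diag mul_diag_mx mul_mx_diag summxE big_ord_recl big_ord1 !mxE.
  have r0 : rev_ord (ord0 : 'I_2) = lift ord0 ord0 by apply: val_inj.
  have r1 : rev_ord (lift ord0 ord0 : 'I_2) = ord0 by apply: val_inj.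
  rewrite r0 r1.
  case: (unliftP ord0 i) => [i' ->|->]; case: (unliftP ord0 j) => [j' ->|->];
    by rewrite ?[i']ord1 ?[j']ord1 /= -?[bump 0 0]/1%N ?expr0 ?expr1; field.
rewrite -mulmxA /sl2_torus tr_diag_mx mulmx_diag mul_mx_diag; apply/matrixP => i j; rewrite !mxE.
  case: (unliftP ord0 j) => [j' ->|->]; rewrite ?[j']ord1 /= ?expr0 ?expr1; by field.
Qed.

(* For H = diag(1/2, -1/2) in sl(2), (ad H)^2 is the identity on the two root
   spaces of sl(2), 1/4 on the 16-dimensional odd part and 0 on the rest, so that
   K(H, H) = 2 - 16/4. *)
Lemma F4_killing_neq0 : exists x y : g, super_killing x y != 0.
Proof.
exists H1, H1; rewrite /super_killing supertraceE.
(* The parity operator turns the eigenvalue 1/4 on the odd part into -1/4. *)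
have -> : (parity_end g \o (linfun (br H1) \o linfun (br H1)) =
  linfun sl2_root_incl \o linfun sl2_root_part - 4%:R^-1 *: (linfun spinor_incl \o linfun (snd : g -> 'M[C]_(8,2))))%VF.
  apply/lfunP => x; have [Y [E [phi [hY hE ->]]]] := F4_ex (x : g).
  rewrite add_lfunE opp_lfunE scale_lfunE !comp_lfunE !(adE lie) (ad_sl2_torus_sq phi hY hE).
  have snd_lin : linear (snd : g -> 'M[C]_(8, 2)) by [].
  rewrite (linfun_linearE snd_lin) (linfun_linearE sl2_root_part_lin).
  rewrite (linfun_linearE sl2_root_incl_lin) (linfun_linearE spinor_incl_lin).
  set A := \sum_j _; have -> : mk 0 A (4%:R^-1 *: phi) = mk 0 A 0 + 4%:R^-1 *: mk 0 0 phi.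
    by have := F4mkP gam B (4%:R^-1) 0 0 phi 0 A 0; rewrite !scaler0 !add0r addr0 addrC => ->.
  rewrite linearD linearZ /= (parity_endE lie (F4_part_even _ _ _ _)) (parity_endE lie (F4_part_odd _ _ _)).
  rewrite expr0 expr1 scale1r scaleN1r scalerN; congr (F4mk _ _ _ _ _ - _).
  by apply: eq_bigr => j _; rewrite mxE /= vsprojK.
(* Cyclicity replaces both compositions by identity maps, on the 8 x 2 matrices and on C^2. *)
rewrite -scaleNr addrC etrP (etrC (linfun sl2_root_part)) (etrC (linfun (snd : g -> 'M[C]_(8,2)))).
have -> : (linfun (snd : g -> 'M[C]_(8,2)) \o linfun spinor_incl)%VF = \1%VF.
  apply/lfunP => psi; rewrite comp_lfunE id_lfunE linfun_linearE ?linfun_linearE //; exact: spinor_incl_lin.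
have -> : (linfun sl2_root_part \o linfun sl2_root_incl)%VF = \1%VF.
  apply/lfunP => r; rewrite comp_lfunE id_lfunE linfun_linearE; last exact: sl2_root_part_lin.
  by rewrite linfun_linearE ?sl2_root_inclK //; exact: sl2_root_incl_lin.
rewrite !etr_id !dimvf /dim /=.
have -> : - 4%:R^-1 * (8 * 2)%:R + (1 * 2)%:R = - 2%:R :> C by field.
by rewrite oppr_eq0 pnatr_eq0.
Qed.

Lemma gF4_cartan_even : (gF4_cartan gam B <= sa_part g false)%VS.
Proof. by apply/subvP => x /mem_F4_cartan [td ->]; apply: F4_part_even. Qed.

Lemma gF4_cartan_abelian x y : x \in gF4_cartan gam B -> y \in gF4_cartan gam B -> br x y = 0.
Proof.
move=> /mem_F4_cartan [[s c] ->] /mem_F4_cartan [[t d] ->]; rewrite !gF4_torusE.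
rewrite (F4_br_even lie) ?so_torus_so7 ?sl2_torus_sl2 // !mulmx0 mul0mx addr0.
have -> : gcommutator (gso_torus (m := 7) s) (gso_torus (m := 7) t) = 0.
  rewrite /gcommutator !gso_torusE rotation_comm ?subrr //; [exact: so_ev_ev|exact: so_od_od|exact: so_ev_od].
have -> : gcommutator (sl2_torus c) (sl2_torus d) = 0.
  by rewrite /gcommutator /sl2_torus diag_mxC subrr.
by rewrite /F4mk !linear0.
Qed.

Lemma gF4_basic_structure (c : C) : c != 0 ->
  basic_structure (fun x y => c * super_killing x y) (gF4_cartan gam B).
Proof.
move=> c0; apply: (killing_basic_structure lie simple c0 F4_killing_neq0 gF4_cartan_even gF4_cartan_abelian).
have [v [hv hs]] := F4_spinors clifford.
exists _, (F4_vec gam B v), (F4_wt gam B), (@F4_par); split.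
- exact: F4_vec_part.
- exact: F4_vec_root.
- exact: F4_vec_zero.
- by move=> i j E nz _; apply: F4_vec_line.
- exact: F4_span.
Qed.

End F4BasicStructure.

(** * F(4) over the complex numbers and its list of positive roots *)

Lemma half_double (K : numFieldType) (V : lmodType K) (x : V) : (2%:R^-1 *: x) *+ 2 = x.
Proof. by rewrite -[_ *+ 2]scaler_nat scalerA mulfV ?scale1r // pnatr_eq0. Qed.

Lemma halfK (K : numFieldType) : 2%:R^-1 * 2%:R = 1 :> K.
Proof. by rewrite mulVf // pnatr_eq0. Qed.

Lemma gF4_torus_injective (C : numClosedFieldType) (gam : 'I_7 -> 'M[C]_8)
    (B : 'M[C]_(8, 2) -> 'M[C]_(8, 2) -> subvs_of (gso7 C) * subvs_of (gsl2 C)) :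
  injective (gF4_torus gam B).
Proof.
move=> td td' E; apply: (lker0P (gF4_torus_inj gam B)).
by rewrite !(linfun_linearE (@gF4_torus_lin _ gam B)).
Qed.

Lemma F4_data_basic (R : realType) (gam : 'I_7 -> 'M[R[i]]_8)
    (B : 'M[R[i]]_(8, 2) -> 'M[R[i]]_(8, 2) -> subvs_of (so7 R) * subvs_of (sl2 R)) :
  is_clifford gam -> is_lie_superalgebra (F4_alg gam B) -> is_simple (F4_alg gam B) ->
  basic_structure (bd_form (F4_data gam B)) (bd_cartan (F4_data gam B)).
Proof.
move=> clifford lie simple.
have six : (6%:R^-1 : R[i]) != 0 by rewrite invr_eq0 pnatr_eq0.
(* exact_no_check leaves the conversion to the kernel, which is much faster
   than the unifier on this specialization to R[i]. *)
exact_no_check (@gF4_basic_structure R[i] gam B clifford lie simple _ six).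
Qed.

Section F4Coordinates.
Variables (R : realType) (gam : 'I_7 -> 'M[R[i]]_8)
  (B : 'M[R[i]]_(8, 2) -> 'M[R[i]]_(8, 2) -> subvs_of (so7 R) * subvs_of (sl2 R)).

Lemma F4_torus_injective : injective (F4_torus gam B).
Proof. exact_no_check (@gF4_torus_injective R[i] gam B). Qed.

Lemma F4_torus_lin : linear (F4_torus gam B).
Proof. exact_no_check (@gF4_torus_lin R[i] gam B). Qed.

Lemma F4_cartan_eval (t : 'rV[R[i]]_3) (d : R[i]) :
  exists H : subvs_of (F4_cartan gam B),
    (forall k, F4_eps gam B k H = t 0 k) /\ F4_delta gam B H = d.
Proof.
have inj : lker (linfun (F4_torus gam B)) == 0%VS.
  by apply/lker0P => x y; rewrite !(linfun_linearE F4_torus_lin) => /F4_torus_injective.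
exists (vsproj (F4_cartan gam B) (linfun (F4_torus gam B) (t, d))).
have coordE : F4_coord (vsproj (F4_cartan gam B) (linfun (F4_torus gam B) (t, d))) = (t, d).
  by rewrite /F4_coord vsprojK ?memv_img ?memvf // (lker0_lfunK inj).
have coord_lin : linear (@F4_coord R gam B) by move=> a x y; rewrite /F4_coord !linearP.
split=> [k|]; rewrite linfun_linearE ?coordE // => a x y.
  by rewrite coord_lin !mxE.
by rewrite coord_lin.
Qed.

End F4Coordinates.

Lemma F4_data_pos0_uniq (R : realType) (gam : 'I_7 -> 'M[R[i]]_8)
    (B : 'M[R[i]]_(8, 2) -> 'M[R[i]]_(8, 2) -> subvs_of (so7 R) * subvs_of (sl2 R)) :
  uniq (bd_pos0 (F4_data gam B)).
Proof.
(* With delta/2 in the role of the symplectic weight, the even roots of F(4)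
   become those of osp(7|2). *)
pose b (q : 'I_3 + 'I_1) : weight (F4_cartan gam B) :=
  match q with inl k => F4_eps gam B k | inr a => 2%:R^-1 *: F4_delta gam B end.
have /choice [hh Hh] : forall q, exists H : subvs_of (F4_cartan gam B), forall p, b p H = (p == q)%:R.
  case=> [k|a].
    have [H [He Hd]] := F4_cartan_eval gam B (delta_mx 0 k) 0; exists H => -[l|a] /=; first by rewrite He mxE.
    by rewrite lfunE /= Hd scaler0.
  (* The value 2 of delta makes delta/2 equal to 1. *)
  have [H [He Hd]] := F4_cartan_eval gam B 0 2%:R; exists H => -[l|c] /=; first by rewrite He mxE.
  by rewrite lfunE /= Hd [a]ord1 [c]ord1 eqxx; apply: halfK.
pose ev q (w : weight (F4_cartan gam B)) := w (hh q) : R[i].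
have evD q u v : ev q (u + v) = ev q u + ev q v by rewrite /ev lfunE.
have evZ q a u : ev q (a *: u) = a * ev q u by rewrite /ev lfunE.
have evb p q : ev q (b p) = (p == q)%:R by apply: Hh.
have sE x : signed b x = signed_weight b x by apply: signedE.
have inj x y x' y' : signed b x + signed b y = signed b x' + signed b y' ->
    signed b x + signed b y <> 0 -> (x = x' /\ y = y') \/ (x = y' /\ y = x').
  rewrite !sE; exact: (signed_pair_inj evD evZ evb).
have eq0 x y : signed b x + signed b y = 0 -> y = sflip x.
  move=> /eqP; rewrite !sE addrC addr_eq0 -signed_weight_flip => /eqP.
  exact: (signed_weight_inj evZ evb).
have := @osp_positive_uniq _ 3 1 true b inj eq0.
have -> : ltpairs 1 = [::].
  rewrite /ltpairs; apply: size0nil; rewrite -cardE; apply: eq_card0 => -[k l].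
  by rewrite !inE /= [k]ord1 [l]ord1.
have -> : enum 'I_1 = [:: ord0].
  by apply: (inj_map val_inj); rewrite val_enum_ord.
have -> : [seq b (inr a) *+ 2 | a <- [:: ord0]] = [:: F4_delta gam B] by rewrite /= half_double.
set A := [seq b (inl ij.1) + _ | ij <- _]; set A' := [seq b (inl ij.1) - _ | ij <- _].
set E := [seq b (inl k) | k <- _] => U.
suff : uniq ([:: F4_delta gam B] ++ E ++ A ++ A') by [].
(* [F4_pos0] has the short roots of so(7) before the long ones, the osp list has them after. *)
rewrite (perm_uniq (perm_cat (perm_refl _) (permEl (perm_catC E (A ++ A'))))) -catA.
exact: U.
Qed.

(** * The four families together, and the formula *)

Lemma is_basic_structure (R : realType) (D : basic_data R) : is_basic D ->
  basic_structure (bd_form D) (bd_cartan D) /\ uniq (bd_pos0 D).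
Proof.
case=> [m n _ _ mn|n _|m n _ _|gam B clifford lie simple].
- by split; [apply: sl_data_basic|apply: sl_pos0_uniq].
- by split; [apply: gl_data_basic|apply: gl_pos0_uniq].
- by split; [apply: osp_data_basic|apply: osp_data_pos0_uniq].
by split; [apply: F4_data_basic|apply: F4_data_pos0_uniq].
Qed.

Theorem proposition54 (R : realType) (D : basic_data R)
  (omega : bd_alg D -> bd_alg D) (pos1 : seq (weight (bd_cartan D)))
  (M : representation (bd_alg D)) (Lam mu : weight (bd_cartan D))
  (hD : is_basic D)
  (homega : anti_involution omega) (homegaD : bd_omega D omega)
  (hpos : positive_system pos1) (hadapted : adapted omega pos1)
  (hM : highest_weight_rep pos1 M Lam)
  (hmu : exists2 v : M, v <> 0 & weight_space M mu v) :
  let form := dual_form (bd_form D) in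
  let d := wdim M in
  let rh := rho pos1 in
  let p := fun al : weight (bd_cartan D) => (al \in pos1 : nat) in
  (- form (Lam + rh *+ 2) Lam + form (mu + rh *+ 2) mu) * (d mu)%:R =
  - 2%:R * \sum_(al <- bd_pos0 D ++ pos1)
      \sum_(k \in [set k : nat | (1 <= k)%N]%classic)
        (-1) ^+ ((k + 1) * p al) * form (mu + al *+ k) al * (d (mu + al *+ k))%:R.
Proof.
have [bs pos0_uniq] := is_basic_structure hD.
exact: freudenthal_basic_data.
Qed.
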